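(* Let $\Omega$ be a natural domain for $N$ and $h_0$ a natural boundary value, let $\sigma$ be a surface tension, and let $h$ be the minimizer of $\int_\Omega\sigma(\nabla u)\,dz$ over $\mathscr A_N(\Omega,h_0)$, with (possibly empty) liquid region $\mathcal L$. Then $h$ is (countably) piecewise affine in $\Omega\setminus\overline{\mathcal L}$, with $\nabla h$ taking values in $\mathscr P\cup\mathscr Q\cup\mathscr G$.
   Context: Surface tension: $N\subset\mathbb R^2$ compact convex polygon with corners $\mathscr P=\{p_1,\dots,p_k\}$ listed counter-clockwise (indices mod $k$); $\mathscr G=\{q_1,\dots,q_l\}\subset N^\circ$ finite (possibly empty) set of gas points; $c_j>0$; $L:\partial N\to\mathbb R$ continuous, piecewise affine, admitting a convex extension; $\sigma:N\to\mathbb R$ the unique bounded convex solution of $\det D^2\sigma=1+\sum_jc_j\delta_{q_j}$ in $N^\circ$, $\sigma=L$ on $\partial N$; $\mathscr Q$ = points of $\partial N\setminus\mathscr P$ where $L$ is not differentiable along $\partial N$. Natural domain: a (possibly non-convex, possibly multiply connected) polygonal domain $\Omega$ whose boundary vertices $z_1,\dots,z_d$ (listed cyclically along each boundary component, indices mod $d$) can each be assigned a corner $p_n\in\mathscr P$ such that either (ND1) $\langle z_j-z_{j-1},p_n-p_{n-1}\rangle=0$ and $\langle z_{j+1}-z_j,p_{n+1}-p_n\rangle=0$, or (ND3) $\langle z_j-z_{j-1},p_{n+1}-p_n\rangle=0$ and $\langle z_{j+1}-z_j,p_n-p_{n-1}\rangle=0$. Natural boundary value: an admissible $h_0:\partial\Omega\to\mathbb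 R$ such that for each $j$, $h_0(z)=\langle p_n,z-z_j\rangle+h_0(z_j)$ for all $z$ on the segments $[z_{j-1},z_j]$ and $[z_j,z_{j+1}]$, with $p_n$ the corner assigned to $z_j$. $\mathscr A_N(\Omega,h_0)$ = Lipschitz $u$ on $\overline\Omega$ with $\nabla u\in N$ a.e., $u=h_0$ on $\partial\Omega$; admissible means nonempty; the minimizer is unique. Liquid region: $\mathcal L=\{z\in\Omega:h$ differentiable at $z$, $\nabla h(z)\in N^\circ\setminus\mathscr G\}$. *)

(* Defs.v *)
From mathcomp Require Import all_boot all_order all_algebra.
From mathcomp Require Import all_classical all_reals all_analysis.
Import Order.TTheory GRing.Theory Num.Theory numFieldTopology.Exports
  numFieldNormedType.Exports.

Set Implicit Arguments.
Unset Strict Implicit.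
Unset Printing Implicit Defensive.

Local Open Scope ring_scope.
Local Open Scope classical_set_scope.

Section Plane.
Variable R : realType.
Notation pt := (R * R)%type.

Definition dotp (p q : pt) : R := p.1 * q.1 + p.2 * q.2.
Definition crossp (p q : pt) : R := p.1 * q.2 - p.2 * q.1.
Definition subp (p q : pt) : pt := (p.1 - q.1, p.2 - q.2).
Definition enorm (p : pt) : R := Num.sqrt (dotp p p).
Definition affc (a b : pt) (t : R) : pt :=
  (a.1 + t * (b.1 - a.1), a.2 + t * (b.2 - a.2)).
Definition seg (a b : pt) : set pt :=
  [set z | exists t : R, 0 <= t <= 1 /\ z = affc a b t].

Definition leb2 := ((@lebesgue_measure R) \x (@lebesgue_measure R))%E.

Definition cv (s : seq pt) (i : nat) : pt := nth (0, 0) s (i %% size s).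
Definition cvprev (s : seq pt) (i : nat) : pt := cv s (i + (size s).-1).
Definition cvnext (s : seq pt) (i : nat) : pt := cv s i.+1.

Definition ccw_convex_polygon (P : seq pt) : Prop :=
  (3 <= size P)%N /\
  forall i j, (i < size P)%N -> (j < size P)%N -> j <> i -> j <> (i.+1 %% size P)%N ->
    0 < crossp (subp (cvnext P i) (cv P i)) (subp (cv P j) (cv P i)).

Definition polyN (P : seq pt) : set pt :=
  [set z | forall i, (i < size P)%N ->
     0 <= crossp (subp (cvnext P i) (cv P i)) (subp z (cv P i))].
Definition interiorN (P : seq pt) : set pt :=
  [set z | forall i, (i < size P)%N ->
     0 < crossp (subp (cvnext P i) (cv P i)) (subp z (cv P i))].
Definition boundaryN (P : seq pt) : set pt := polyN P `\` interiorN P.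

Definition convex_on (A : set pt) (f : pt -> R) : Prop :=
  forall x y t, A x -> A y -> 0 <= t <= 1 ->
    f (affc x y t) <= (1 - t) * f x + t * f y.

Definition has_deriv1 (f : R -> R) (t s : R) : Prop :=
  forall eps : R, 0 < eps -> exists2 delta : R, 0 < delta &
    forall t', `|t' - t| < delta -> `|f t' - f t - s * (t' - t)| <= eps * `|t' - t|.

Definition pw_affine01 (f : R -> R) : Prop :=
  exists (n : nat) (s : nat -> R),
    s 0%N = 0 /\ s n = 1 /\ (forall m, (m < n)%N -> s m < s m.+1) /\
    forall m, (m < n)%N -> exists a b : R,
      forall t, s m <= t <= s m.+1 -> f t = a * t + b.

Definition boundary_datum (P : seq pt) (L : pt -> R) : Prop :=
  {within boundaryN P, continuous L} /\
  (forall i, (i < size P)%N -> pw_affine01 (fun t => L (affc (cv P i) (cvnext P i) t))) /\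
  (exists F : pt -> R, convex_on (polyN P) F /\
     forall z, boundaryN P z -> F z = L z).

Definition Qset (P : seq pt) (L : pt -> R) : set pt :=
  [set z | exists i t, (i < size P)%N /\ 0 < t < 1 /\
     z = affc (cv P i) (cvnext P i) t /\
     ~ (exists s, has_deriv1 (fun t' => L (affc (cv P i) (cvnext P i) t')) t s)].

Definition subgrad (A : set pt) (f : pt -> R) (x : pt) : set pt :=
  [set g | forall y, A y -> f x + dotp g (subp y x) <= f y].
Definition subgrad_img (A : set pt) (f : pt -> R) (E : set pt) : set pt :=
  \bigcup_(x in E) subgrad A f x.

(* sigma is the bounded convex solution of det D^2 sigma = 1 + sum_j c_j delta_{q_j}
   in N°, sigma = L on the boundary (Monge-Ampere measure in the sense of
   Alexandrov, tested on compact subsets of N°). *)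
Definition surface_tension (P G : seq pt) (c : pt -> R) (L sigma : pt -> R) : Prop :=
  convex_on (polyN P) sigma /\
  (exists M : R, forall z, polyN P z -> `|sigma z| <= M) /\
  {within polyN P, continuous sigma} /\
  (forall z, boundaryN P z -> sigma z = L z) /\
  (forall E : set pt, compact E -> E `<=` interiorN P ->
     leb2 (subgrad_img (polyN P) sigma E)
     = (leb2 E + (\sum_(q <- G | `[< E q >]) c q)%:E)%E).

Definition edge (C : seq pt) (j : nat) : set pt := seg (cv C j) (cvnext C j).

Definition simple_closed_polygon (C : seq pt) : Prop :=
  (3 <= size C)%N /\
  (forall j, (j < size C)%N -> cv C j <> cvnext C j) /\
  (forall i j z, (i < size C)%N -> (j < size C)%N -> i <> j ->
     edge C i z -> edge C j z ->
     (j = (i.+1 %% size C)%N /\ z = cvnext C i) \/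
     (i = (j.+1 %% size C)%N /\ z = cv C i)).

Definition comp_boundary (C : seq pt) : set pt :=
  [set z | exists2 j, (j < size C)%N & edge C j z].

Definition polygon_boundary (comps : seq (seq pt)) : set pt :=
  [set z | exists2 a, (a < size comps)%N & comp_boundary (nth [::] comps a) z].

Definition bounded_set (A : set pt) : Prop :=
  exists M : R, forall z, A z -> `|z.1| <= M /\ `|z.2| <= M.

Definition polygonal_domain (Om : set pt) (comps : seq (seq pt)) : Prop :=
  open Om /\ connected Om /\ Om !=set0 /\ bounded_set Om /\
  comps <> [::] /\
  (forall a, (a < size comps)%N -> simple_closed_polygon (nth [::] comps a)) /\
  (forall a b, (a < size comps)%N -> (b < size comps)%N -> a <> b ->
     [disjoint comp_boundary (nth [::] comps a) & comp_boundary (nth [::] comps b)]) /\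
  closure Om `\` Om = polygon_boundary comps.

(* asg a j = index (mod size P) of the corner assigned to the vertex j of the
   boundary component a *)
Definition natural_domain (P : seq pt) (Om : set pt) (comps : seq (seq pt))
    (asg : nat -> nat -> nat) : Prop :=
  polygonal_domain Om comps /\
  forall a j, (a < size comps)%N -> (j < size (nth [::] comps a))%N ->
    let C := nth [::] comps a in
    let n := asg a j in
    (n < size P)%N /\
    ((dotp (subp (cv C j) (cvprev C j)) (subp (cv P n) (cvprev P n)) = 0 /\
      dotp (subp (cvnext C j) (cv C j)) (subp (cvnext P n) (cv P n)) = 0)
    \/
     (dotp (subp (cv C j) (cvprev C j)) (subp (cvnext P n) (cv P n)) = 0 /\
      dotp (subp (cvnext C j) (cv C j)) (subp (cv P n) (cvprev P n)) = 0)).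

Definition has_grad (u : pt -> R) (z g : pt) : Prop :=
  forall eps : R, 0 < eps -> exists2 delta : R, 0 < delta &
    forall w, enorm (subp w z) < delta ->
      `|u w - u z - dotp g (subp w z)| <= eps * enorm (subp w z).

Definition gradf (u : pt -> R) (z : pt) : pt := xget (0, 0) [set g | has_grad u z g].

Definition lipschitz_on (A : set pt) (u : pt -> R) : Prop :=
  exists K : R, forall x y, A x -> A y -> `|u x - u y| <= K * enorm (subp x y).

Definition AN (P : seq pt) (Om : set pt) (h0 : pt -> R) : set (pt -> R) :=
  [set u | lipschitz_on (closure Om) u /\
     leb2.-negligible [set z | Om z /\ ~ (exists g, has_grad u z g /\ polyN P g)] /\
     (forall z, (closure Om `\` Om) z -> u z = h0 z)].

Definition natural_boundary_value (P : seq pt) (Om : set pt) (comps : seq (seq pt))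
    (asg : nat -> nat -> nat) (h0 : pt -> R) : Prop :=
  AN P Om h0 !=set0 /\
  forall a j, (a < size comps)%N -> (j < size (nth [::] comps a))%N ->
    let C := nth [::] comps a in
    forall z, seg (cvprev C j) (cv C j) z \/ seg (cv C j) (cvnext C j) z ->
      h0 z = dotp (cv P (asg a j)) (subp z (cv C j)) + h0 (cv C j).

Definition energy (sigma : pt -> R) (Om : set pt) (u : pt -> R) : \bar R :=
  (\int[leb2]_(z in Om) (sigma (gradf u z))%:E)%E.

Definition is_minimizer (P : seq pt) (sigma : pt -> R) (Om : set pt) (h0 h : pt -> R) : Prop :=
  AN P Om h0 h /\ forall u, AN P Om h0 u -> (energy sigma Om h <= energy sigma Om u)%E.

Definition liquid (P G : seq pt) (Om : set pt) (h : pt -> R) : set pt :=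
  [set z | Om z /\ exists g, has_grad h z g /\ interiorN P g /\ ~ (g \in G)].

Definition countably_pw_affine (F : set pt) (h : pt -> R) (S : set pt) : Prop :=
  exists U : nat -> set pt,
    (forall i, open (U i) /\ U i `<=` F) /\
    (forall i j, i <> j -> [disjoint U i & U j]) /\
    (forall i, exists a b, S a /\ forall z, U i z -> h z = dotp a z + b) /\
    leb2.-negligible (F `\` \bigcup_i U i).

End Plane.

(* Main.v *)
(* Off the closure of the liquid region the gradient of the minimizer h avoids the open set
   N° \ G almost everywhere, and a paraboloid touching h from above or below has its slope in
   N \ (N° \ G): a slope in N° \ G would let one cut h by a cone or a plane and strictly lower
   the energy, since sigma lies strictly above its supporting planes at points of N° \ G (strict
   convexity comes from the Monge-Ampère equation).

   Let nu be the inward normal of an edge of N. Then h(z - Y nu) <= h z - Y b with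
   b = min <., nu> on N, and z is tight for that edge when equality holds along the whole ray.
   If z is not tight, comparison with planes of slope slightly inside N shows that a slope in the
   open edge cannot touch h at z with strict concavity along the edge. If no edge is tight at a
   differentiability point z0 with gradient s, cones with vertices near z0 show that h minus its
   tangent plane is Lipschitz with an arbitrarily small constant near z0; the slopes of touching
   paraboloids near s then lie on at most two lines through s, which forces h to be affine along
   the two dual directions, hence affine near z0. The slope s is a corner, a gas point, or lies in
   an open edge, where s must be in Q: if L is affine near s, sigma is infinitely steep at s in
   the inward directions, and lifting h by a roof with slopes t-close to s lowers the energy.

   If an edge is tight at z0, the ray ends at an interior point of a boundary segment (unless z0
   is on one of finitely many lines), and along that segment the natural boundary value is
   extremal for another edge. The bounds of the two edges make h affine on a parallelogram with
   vertex z0, with slope a corner. So translating z0 by a small multiple of one of finitely many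
   vectors leads to points where h is locally affine, and the set of such z0 is null: otherwise
   it would have infinitely many disjoint translates in a bounded set. *)

(* Off the liquid region the gradient is known only almost everywhere, and confinement to a set such
   as an edge of N gives no regularity by itself. Slopes of touching paraboloids can be controlled
   at every point, so all rigidity is read off at contact points of test functions.

   Every energy comparison uses one competitor, [h - t (h - psi)^+] truncated to an open set, with
   [psi] a maximum of finitely many planes. The gradient of the added term has integral zero, so a
   linear function may be subtracted from sigma and only the gap to a supporting plane counts. The
   value t = 1 serves slopes in N° \ G; on an open edge t is small: the loss where the gradient is
   unknown is O(t), while steepness gains C t with C at will.

   A slope on an edge cannot be moved out of N. Non-tightness supplies the missing room: the
   comparison region is a thin box along the ray, ending where h is strictly below its tangent
   plane.

   Only contact from above is studied; contact from below is the same statement for -h, -N and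
   sigma(-x). Together they make h minus its tangent plane bilinear in dual coordinates, and the
   gradients of a product term would leave the two lines. *)
Require Import Defs.
From mathcomp Require Import all_boot all_order all_algebra.
From mathcomp Require Import all_classical all_reals all_analysis.
From mathcomp Require Import measurable_realfun ring lra zify.
Import Order.TTheory GRing.Theory Num.Theory numFieldTopology.Exports
  numFieldNormedType.Exports.
Set Implicit Arguments.
Unset Strict Implicit.
Unset Printing Implicit Defensive.
Local Open Scope ring_scope.
Local Open Scope classical_set_scope.

(** * The plane *)

Section PlaneBasics.
Variable R : realType.
Notation pt := (R * R)%type.
Implicit Types (z w g d : pt) (A B K : set pt).

Lemma normE z : `|z| = Num.max `|z.1| `|z.2|.
Proof. by rewrite prod_normE. Qed.

Lemma norm_fst z : `|z.1| <= `|z|. Proof. by rewrite normE le_max lexx. Qed.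

Lemma norm_snd z : `|z.2| <= `|z|. Proof. by rewrite normE le_max lexx orbT. Qed.

Lemma norm_leP z (c : R) : `|z| <= c <-> `|z.1| <= c /\ `|z.2| <= c.
Proof. by rewrite normE ge_max; split=> [/andP//|[-> ->]]. Qed.

Lemma norm_ltP z (c : R) : `|z| < c <-> `|z.1| < c /\ `|z.2| < c.
Proof. by rewrite normE gt_max; split=> [/andP//|[-> ->]]. Qed.

Lemma dotpDl g g' z : dotp (g + g') z = dotp g z + dotp g' z.
Proof. rewrite /dotp /=; ring. Qed.
Lemma dotpDr g z z' : dotp g (z + z') = dotp g z + dotp g z'.
Proof. rewrite /dotp /=; ring. Qed.
Lemma dotpNl g z : dotp (- g) z = - dotp g z.
Proof. rewrite /dotp /=; ring. Qed.
Lemma dotpNr g z : dotp g (- z) = - dotp g z.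
Proof. rewrite /dotp /=; ring. Qed.
Lemma dotpBl g g' z : dotp (g - g') z = dotp g z - dotp g' z.
Proof. by rewrite dotpDl dotpNl. Qed.
Lemma dotpBr g z z' : dotp g (z - z') = dotp g z - dotp g z'.
Proof. by rewrite dotpDr dotpNr. Qed.
Lemma dotpZl (t : R) g z : dotp (t *: g) z = t * dotp g z.
Proof. rewrite /dotp /= /GRing.scale /=; ring. Qed.
Lemma dotpZr (t : R) g z : dotp g (t *: z) = t * dotp g z.
Proof. rewrite /dotp /= /GRing.scale /=; ring. Qed.
Lemma dotpC g z : dotp g z = dotp z g.
Proof. rewrite /dotp /=; ring. Qed.
Lemma dotp0l z : dotp 0 z = 0.
Proof. by rewrite /dotp /= !mul0r addr0. Qed.
Lemma dotp0r z : dotp z 0 = 0.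
Proof. by rewrite /dotp /= !mulr0 addr0. Qed.

Lemma dotp_le g z : `|dotp g z| <= 2 * `|g| * `|z|.
Proof.
rewrite /dotp (le_trans (ler_normD _ _))// !normrM.
have h1 : `|g.1| * `|z.1| <= `|g| * `|z| by apply: ler_pM; rewrite // ?norm_fst.
have h2 : `|g.2| * `|z.2| <= `|g| * `|z| by apply: ler_pM; rewrite // ?norm_snd.
lra.
Qed.

Lemma enorm_ge z : `|z| <= enorm z.
Proof.
rewrite /enorm /dotp normE ge_max; apply/andP; split.
- by rewrite -sqrtr_sqr ler_wsqrtr// -!expr2 lerDl sqr_ge0.
- by rewrite -sqrtr_sqr ler_wsqrtr// -!expr2 lerDr sqr_ge0.
Qed.

Lemma enorm_le z : enorm z <= 2 * `|z|.
Proof.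
have z0 : 0 <= 2 * `|z| by rewrite mulr_ge0.
rewrite /enorm -(ger0_norm z0) -sqrtr_sqr ler_wsqrtr// /dotp.
have h1 : z.1 * z.1 <= `|z| ^+ 2.
  by rewrite -expr2 -[z.1 ^+ 2]ger0_norm ?sqr_ge0// normrX lerXn2r ?nnegrE// norm_fst.
have h2 : z.2 * z.2 <= `|z| ^+ 2.
  by rewrite -expr2 -[z.2 ^+ 2]ger0_norm ?sqr_ge0// normrX lerXn2r ?nnegrE// norm_snd.
have := sqr_ge0 `|z|; rewrite exprMn; lra.
Qed.

Lemma enorm_ge0 z : 0 <= enorm z. Proof. exact: sqrtr_ge0. Qed.

Lemma enorm_sqr z : enorm z ^+ 2 = dotp z z.
Proof. by rewrite /enorm sqr_sqrtr// /dotp -!expr2 addr_ge0 ?sqr_ge0. Qed.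

Lemma enorm_eq0 z : (enorm z == 0) = (z == 0).
Proof.
apply/eqP/eqP => [h|->]; last by rewrite /enorm dotp0r sqrtr0.
by apply/eqP; rewrite -normr_le0 -h enorm_ge.
Qed.

Lemma enormN z : enorm (- z) = enorm z.
Proof. by rewrite /enorm dotpNl dotpNr opprK. Qed.

Lemma has_gradP (u : pt -> R) z g : has_grad u z g <->
  forall e : R, 0 < e -> exists2 d : R, 0 < d &
    forall w, `|w - z| < d -> `|u w - u z - dotp g (w - z)| <= e * `|w - z|.
Proof.
split=> H e e0.
- have [d d0 Hd] := H (e / 2) (divr_gt0 e0 (ltr0n _ 2)).
  exists (d / 2); first exact: divr_gt0.
  move=> w wz; have := Hd w; rewrite -[subp w z]/(w - z) => Hw.
  have E := enorm_le (w - z).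
  have /Hw {}Hw : enorm (w - z) < d by lra.
  apply: (le_trans Hw); have -> : e * `|w - z| = e / 2 * (2 * `|w - z|) by field.
  by rewrite ler_pM2l ?divr_gt0.
- have [d d0 Hd] := H e e0.
  exists d => // w wz; rewrite -[subp w z]/(w - z) in wz *.
  have E := enorm_ge (w - z).
  apply: (le_trans (Hd w _)); first exact: le_lt_trans wz.
  by rewrite ler_wpM2l// ltW.
Qed.

Lemma openP A : open A <-> forall z, A z -> exists2 r : R, 0 < r & forall w, `|w - z| < r -> A w.
Proof.
rewrite openE; split=> H z Az.
- have /nbhs_ballP[r /= r0 Hr] := H _ Az.
  exists r => // w wz; apply: Hr; rewrite -ball_normE /ball_/=.
  by rewrite distrC.
- have [r r0 Hr] := H z Az.
  apply/nbhs_ballP; exists r => //= w; rewrite -ball_normE /ball_/= => zw.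
  by apply: Hr; rewrite distrC.
Qed.

Lemma closureP A z : closure A z <-> forall r : R, 0 < r -> exists2 w, A w & `|w - z| < r.
Proof.
split=> H.
- move=> r r0; have [w [Aw Bw]] := H (ball z r) (nbhsx_ballx z r r0).
  by exists w => //; move: Bw; rewrite -ball_normE /ball_/= distrC.
- move=> B /nbhs_ballP[r /= r0 rB]; have [w Aw wz] := H r r0.
  exists w; split=> //; apply: rB; rewrite -ball_normE /ball_/=.
  by rewrite distrC.
Qed.

Lemma continuousP_norm (u : pt -> R) z : {for z, continuous u} <->
  forall e : R, 0 < e -> exists2 d : R, 0 < d & forall w, `|w - z| < d -> `|u w - u z| < e.
Proof.
split=> H.
- move=> e e0; move/cvgrPdist_lt : H => /(_ e e0) /nbhs_ballP[d /= d0 Hd].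
  exists d => // w wz; rewrite distrC; apply: Hd.
  by rewrite -ball_normE /ball_/= distrC.
- apply/cvgrPdist_lt => e e0; have [d d0 Hd] := H e e0.
  apply/(@nbhs_ballP R pt); exists d => //= w; rewrite -ball_normE /ball_/= => zw.
  by rewrite distrC; apply: Hd; rewrite distrC.
Qed.

Lemma within_continuousP (u : pt -> R) A : {within A, continuous u} <->
  forall z, A z -> forall e : R, 0 < e ->
    exists2 d : R, 0 < d & forall w, A w -> `|w - z| < d -> `|u w - u z| < e.
Proof.
split=> H.
- move=> z Az e e0.
  have := H z; rewrite /continuous_at.
  move/cvgrPdist_lt => /(_ e e0); rewrite /nbhs /= -nbhs_subspace_in//.
  move=> /nbhs_ballP[d /= d0 Hd]; exists d => // w Aw wz.
  rewrite distrC; apply: Hd => //.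
  by rewrite -ball_normE /ball_/= distrC.
- move=> z.
  have [Az|nAz] := pselect (A z).
    rewrite /continuous_at /= ; apply/cvgrPdist_lt => e e0.
    have [d d0 Hd] := H z Az e e0.
    rewrite /nbhs /= -nbhs_subspace_in//; apply/nbhs_ballP; exists d => //= w zw Aw.
    rewrite distrC; apply: Hd => //.
    by move: zw; rewrite -ball_normE /ball_/= distrC.
  rewrite /continuous_at; apply/cvgrPdist_lt => e e0.
  rewrite /nbhs /= -nbhs_subspace_out//= => w /= ->.
  by rewrite subrr normr0.
Qed.

Lemma closed_bounded_compact A (M : R) :
  closed A -> (forall z, A z -> `|z| <= M) -> compact A.
Proof.
move=> cA bA.
apply: (@subclosed_compact _ _ (`[- M, M] `*` `[- M, M])%classic) => //.
- by apply: compact_setX; apply: segment_compact.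
- move=> z /bA /norm_leP[h1 h2]; split => /=; rewrite in_itv /= -ler_norml//.
Qed.

Lemma closedP A : closed A <->
  forall z, (forall r : R, 0 < r -> exists2 w, A w & `|w - z| < r) -> A z.
Proof.
split=> [cA z /closureP|H z /closureP]; last exact: H.
exact: cA.
Qed.

Lemma closed_norm_le (M : R) : closed [set z : pt | `|z| <= M].
Proof.
apply/closedP => z H /=; apply/ler_addgt0Pr => e /H[w /= wM wz].
have := ler_normD w (z - w); rewrite [`|z - w|]distrC.
by rewrite [w + _]addrC subrK; lra.
Qed.

Lemma continuous_lip (u : pt -> R) (k : R) :
  (forall z w, `|u z - u w| <= k * `|z - w|) -> continuous u.
Proof.
move=> H z; apply/continuousP_norm => e e0.
have k1 : 0 < `|k| + 1 by rewrite ltr_wpDl.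
exists (e / (`|k| + 1)); first by rewrite divr_gt0.
move=> w wz; apply: (le_lt_trans (H _ _)).
apply: (@le_lt_trans _ _ ((`|k| + 1) * `|w - z|)).
  by rewrite ler_wpM2r// (le_trans (ler_norm _))// lerDl.
by rewrite mulrC -ltr_pdivlMr.
Qed.

(** The distance to the complement of [Om] is 1-Lipschitz, so it attains its minimum on [K], and
    openness of [Om] at the minimizer makes this minimum positive. *)
Lemma tube K (Om : set pt) : compact K -> open Om -> K `<=` Om ->
  exists2 r : R, 0 < r & forall z w, K z -> `|w - z| < r -> Om w.
Proof.
move=> cK oOm KOm.
have [[z0 Kz0]|K0] := pselect (K !=set0); last first.
  by exists 1 => // z w Kz; case: K0; exists z.
have [[w0 nw0]|nC] := pselect (exists w, ~ Om w); last first.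
  by exists 1 => // z w _ _; apply: contrapT => nw; apply: nC; exists w.
pose S z := [set `|w - z| | w in ~` Om].
have S0 z : has_inf (S z).
  by split; [exists `|w0 - z|; exists w0|exists 0 => _ [w _ <-]].
have flip z w : inf (S z) - inf (S w) <= `|z - w|.
  rewrite lerBlDr -lerBlDl; apply: lb_le_inf; first exact: (S0 w).1.
  move=> _ [v nv <-]; rewrite lerBlDl.
  apply: (@le_trans _ _ `|v - z|); first by apply: (ge_inf (S0 z).2); exists v.
  by have := ler_distD w v z; rewrite [`|z - w|]distrC; lra.
have fc : continuous (fun z => inf (S z)).
  apply: (@continuous_lip _ 1) => z w; rewrite mul1r ler_norml flip andbT.
  by rewrite lerNl opprB distrC flip.
have [c cK' Hc] := compact_EVT_min (ex_intro _ z0 Kz0) cK (continuous_subspaceT fc).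
have Kc : K c by apply: set_mem.
have /openP /(_ c (KOm _ Kc))[r r0 Hr] := oOm.
exists r => // z w Kz wz; apply: contrapT => nw.
have : r <= inf (S c).
  apply: lb_le_inf; first exact: (S0 c).1.
  by move=> _ [v nv <-]; rewrite leNgt; apply/negP => /Hr.
have := Hc z (mem_set Kz).
have : inf (S z) <= `|w - z| by apply: (ge_inf (S0 z).2); exists w.
lra.
Qed.

Lemma affcE (a b : pt) (t : R) : affc a b t = a + t *: (b - a).
Proof. by []. Qed.

Lemma affc0 (a b : pt) : affc a b 0 = a.
Proof. by rewrite affcE scale0r addr0. Qed.

Lemma affc1 (a b : pt) : affc a b 1 = b.
Proof. by rewrite affcE scale1r addrC subrK. Qed.

(** The exit parameter is the infimum of the parameters outside [W]. Openness of [W] puts the exit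
    point outside, and the points just before it put it in the closure. *)
Lemma seg_exit (W : set pt) (a b : pt) : open W -> W a -> ~ W b ->
  exists t : R, [/\ 0 <= t <= 1, closure W (affc a b t), ~ W (affc a b t) &
    forall s, 0 <= s < t -> W (affc a b s)].
Proof.
move=> oW Wa nWb.
pose S := [set t : R | 0 <= t <= 1 /\ ~ W (affc a b t)].
have S1 : S 1 by split; rewrite ?affc1 ?ler01 ?lexx.
have hS : has_inf S.
  by split; [exists 1|exists 0 => t [/andP[]]].
pose t := inf S.
have t0 : 0 <= t by apply: lb_le_inf; [exists 1|move=> s [/andP[]]].
have t1 : t <= 1 by apply: ge_inf => //; exact: hS.2.
have B s s' : `|affc a b s - affc a b s'| <= `|s - s'| * `|b - a|.
  rewrite !affcE opprD addrACA subrr add0r -scalerBl normrZ//.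
have M0 : 0 < `|b - a| + 1 by rewrite ltr_wpDl.
exists t; split; first by rewrite t0 t1.
- apply/closureP => r r0.
  have [t00|tp] := eqVneq t 0.
    by exists a => //; rewrite t00 affc0 subrr normr0.
  have tpos : 0 < t by rewrite lt_neqAle eq_sym tp.
  pose s := Num.max 0 (t - r / (`|b - a| + 1) / 2).
  have r1 : 0 < r / (`|b - a| + 1) by rewrite divr_gt0.
  have st : s < t by rewrite /s gt_max tpos/=; lra.
  have s0 : 0 <= s by rewrite /s le_max lexx.
  exists (affc a b s).
    apply: contrapT => nW; have : S s by split=> //; rewrite s0 (ltW (lt_le_trans st t1)).
    by move/(ge_inf hS.2); rewrite leNgt st.
  apply: (le_lt_trans (B _ _)).
  have -> : `|s - t| = t - s by rewrite distrC ger0_norm// subr_ge0 ltW.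
  have h : t - s <= r / (`|b - a| + 1) / 2.
    by have : t - r / (`|b - a| + 1) / 2 <= s; [rewrite /s le_max lexx orbT|lra].
  apply: (@le_lt_trans _ _ (r / (`|b - a| + 1) / 2 * (`|b - a| + 1))).
    by apply: ler_pM => //; [lra|lra].
  by rewrite mulrAC divfK ?lt0r_neq0//; lra.
- move=> Wt; have /openP /(_ _ Wt)[r r0 Hr] := oW.
  have r1 : 0 < r / (`|b - a| + 1) by rewrite divr_gt0.
  have [s Ss st] := inf_adherent r1 hS.
  have ts : t <= s := ge_inf hS.2 Ss.
  case: Ss => _; apply; apply: Hr; apply: (le_lt_trans (B _ _)).
  rewrite ger0_norm ?subr_ge0//.
  apply: (@le_lt_trans _ _ ((s - t) * (`|b - a| + 1))).
    by rewrite ler_wpM2l ?subr_ge0// lerDl.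
  by rewrite -ltr_pdivlMr//; rewrite -/t in st; lra.
- move=> s /andP[s0 st]; apply: contrapT => nW.
  have : S s by split=> //; rewrite s0 (ltW (lt_le_trans st t1)).
  by move/(ge_inf hS.2); rewrite leNgt st.
Qed.

Lemma has_grad_unique (u : pt -> R) z g g' : has_grad u z g -> has_grad u z g' -> g = g'.
Proof.
move=> /has_gradP H /has_gradP H'; apply/eqP; rewrite -subr_eq0; apply/eqP.
suff P d : dotp (g - g') d = 0.
  have := P (1, 0); have := P (0, 1); rewrite /dotp /= => p2 p1.
  move: p1 p2; rewrite !mulr0 !mulr1 addr0 add0r => p1 p2.
  by rewrite [g - g']surjective_pairing /= p1 p2.
have [->|d0] := eqVneq d 0; first exact: dotp0r.
apply/eqP; rewrite -normr_le0; apply/ler_addgt0Pl => e e0; rewrite addr0.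
have dp : 0 < `|d| by rewrite normr_gt0.
have e2 : 0 < e / `|d| / 2 by rewrite !divr_gt0.
have [r r0 Hr] := H _ e2; have [r' r'0 Hr'] := H' _ e2.
pose t := Num.min r r' / 2 / `|d|.
have m0 : 0 < Num.min r r' by rewrite lt_min r0.
have t0 : 0 < t by rewrite !divr_gt0.
have Et : `|z + t *: d - z| = Num.min r r' / 2.
  by rewrite addrC addKr normrZ gtr0_norm// /t divfK// gt_eqF.
have Et' : `|z + t *: d - z| = t * `|d| by rewrite addrC addKr normrZ gtr0_norm.
have mr : Num.min r r' / 2 < r by rewrite ltr_pdivrMr// (@le_lt_trans _ _ r)// ?ge_min ?lexx//; lra.
have mr' : Num.min r r' / 2 < r' by rewrite ltr_pdivrMr// (@le_lt_trans _ _ r')// ?ge_min ?lexx ?orbT//; lra.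
have := Hr (z + t *: d); have := Hr' (z + t *: d).
rewrite Et => /(_ mr') h1 /(_ mr) h2; move: h1 h2; rewrite -Et Et'.
rewrite [z + t *: d - z]addrC addKr !dotpZr.
set U := u _ - _; set a := dotp g d; set b := dotp g' d => h1 h2.
have : `|t * (a - b)| <= t * e.
  have -> : t * (a - b) = (U - t * b) - (U - t * a) by ring.
  rewrite (le_trans (ler_normB _ _))//.
  have E : e / `|d| / 2 * (t * `|d|) = t * e / 2.
    by field; rewrite gt_eqF.
  by rewrite E in h1 h2; lra.
by rewrite normrM gtr0_norm// ler_pM2l// /a /b -dotpBl.
Qed.

Lemma gradfE (u : pt -> R) z g : has_grad u z g -> gradf u z = g.
Proof.
move=> H; rewrite /gradf; case: xgetP => [g' _ /= Hg'|/(_ g)//].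
exact: has_grad_unique Hg' H.
Qed.

Lemma has_grad_near (u v : pt -> R) z g (r : R) : 0 < r ->
  (forall w, `|w - z| < r -> u w = v w) -> has_grad u z g -> has_grad v z g.
Proof.
move=> r0 uv /has_gradP H; apply/has_gradP => e e0; have [d d0 Hd] := H e e0.
exists (Num.min d r); first by rewrite lt_min d0.
move=> w; rewrite lt_min => /andP[wd wr].
by rewrite -!uv ?subrr ?normr0//; exact: Hd.
Qed.

Lemma has_gradD (u v : pt -> R) z g g' : has_grad u z g -> has_grad v z g' ->
  has_grad (fun x => u x + v x) z (g + g').
Proof.
move=> /has_gradP H /has_gradP H'; apply/has_gradP => e e0.
have e2 : 0 < e / 2 by rewrite divr_gt0.
have [d d0 Hd] := H _ e2; have [d' d'0 Hd'] := H' _ e2.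
exists (Num.min d d'); first by rewrite lt_min d0.
move=> w; rewrite lt_min => /andP[/Hd h1 /Hd' h2].
have -> : u w + v w - (u z + v z) - dotp (g + g') (w - z) =
  (u w - u z - dotp g (w - z)) + (v w - v z - dotp g' (w - z)).
  rewrite dotpDl; ring.
by rewrite (le_trans (ler_normD _ _))//; lra.
Qed.

Lemma has_gradZ (u : pt -> R) z g (c : R) : has_grad u z g -> has_grad (fun x => c * u x) z (c *: g).
Proof.
move=> /has_gradP H; apply/has_gradP => e e0.
have c1 : 0 < `|c| + 1 by rewrite ltr_wpDl.
have [d d0 Hd] := H _ (divr_gt0 e0 c1).
exists d => // w /Hd h.
have -> : c * u w - c * u z - dotp (c *: g) (w - z) = c * (u w - u z - dotp g (w - z)).
  rewrite dotpZl; ring.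
rewrite normrM; apply: (@le_trans _ _ ((`|c| + 1) * (e / (`|c| + 1) * `|w - z|))).
  by apply: ler_pM => //; rewrite lerDl.
by rewrite mulrA mulrCA divff ?mulr1// gt_eqF.
Qed.

Lemma has_gradN (u : pt -> R) z g : has_grad u z g -> has_grad (fun x => - u x) z (- g).
Proof.
move=> /(has_gradZ (-1)); rewrite scaleN1r => H.
by under eq_fun do rewrite -mulN1r.
Qed.

Lemma has_grad_aff (g : pt) (c : R) z : has_grad (fun x => dotp g x + c) z g.
Proof.
apply/has_gradP => e e0; exists 1 => // w _.
rewrite dotpBr opprD addrACA subrr addr0 subrr normr0 mulr_ge0// ltW//.
Qed.

Lemma has_grad_cst (c : R) z : has_grad (fun=> c) z 0.
Proof.
apply/has_gradP => e e0; exists 1 => // w _.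
by rewrite dotp0l !subrr normr0 mulr_ge0// ltW.
Qed.

End PlaneBasics.

(** * Planar Lebesgue measure *)

(* The Borel structure for which [leb2] is a measure. *)
Notation mpt R := (measurableTypeR R * measurableTypeR R)%type.

Section PlaneMeasure.
Variable R : realType.
Notation pt := (R * R)%type.
Local Notation mu1 := (@lebesgue_measure R).
Local Notation mu2 := (@leb2 R).
Implicit Types (A B : set (mpt R)).

(** The sigma-algebra of [leb2] is generated by rectangles. An open set is the union of those
    squares inside it whose centre is rational and whose half-side is 1/(n+1), and these are
    countably many. *)
Lemma open_measurable2 (A : set pt) : open A -> measurable (A : set (mpt R)).
Proof.
move=> oA.
pose box (q : rat * rat * nat) : set pt :=
  `]ratr q.1.1 - q.2.+1%:R^-1, ratr q.1.1 + q.2.+1%:R^-1[ `*`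
  `]ratr q.1.2 - q.2.+1%:R^-1, ratr q.1.2 + q.2.+1%:R^-1[.
pose F n := match unpickle n : option (rat * rat * nat)%type with
  | Some q => if `[< box q `<=` A >] then box q else set0 | None => set0 end.
rewrite (_ : A = \bigcup_n F n); last first.
  apply/seteqP; split; last first.
    move=> z [n _]; rewrite /F; case: unpickle => [q|//].
    by case: asboolP => // qA /qA.
  move=> z Az; have /openP /(_ z Az)[r r0 Hr] := oA.
  have r2 : 0 < r / 2 by rewrite divr_gt0.
  have [n /= Hn] : exists n : nat, n.+1%:R^-1 < r / 2.
    near \oo => n; exists n; near: n.
    exact: near_infty_natSinv_lt (PosNum r2).
  set e : R := n.+1%:R^-1 in Hn.
  have e0 : 0 < e by rewrite invr_gt0.
  have [q1] : exists q : rat, z.1 - e < ratr q < z.1 + e.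
    have h : z.1 - e < z.1 + e by lra.
    have [q] := rat_in_itvoo h.
    by rewrite in_itv /=; exists q.
  have [q2] : exists q : rat, z.2 - e < ratr q < z.2 + e.
    have h : z.2 - e < z.2 + e by lra.
    have [q] := rat_in_itvoo h.
    by rewrite in_itv /=; exists q.
  move=> /andP[h3 h4] /andP[h1 h2].
  have In : setT (pickle (q1, q2, n)) by exact: I.
  exists (pickle (q1, q2, n)); first exact: In.
  rewrite /F pickleK.
  case: asboolP => [_|[]].
    rewrite /box /= /setX /= !in_itv/= -/e; split; apply/andP; split; lra.
  move=> w; rewrite /box /= /setX /= !in_itv/= -/e => -[/andP[h5 h6] /andP[h7 h8]].
  apply: Hr; apply/norm_ltP; rewrite !ltr_norml /=; split; apply/andP; split; lra.
apply: bigcupT_measurable => n; rewrite /F; case: unpickle => [q|//].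
by case: asboolP => // _; apply: measurableX; exact: measurable_itv.
Unshelve. all: by end_near. Qed.

Lemma closed_measurable2 (A : set pt) : closed A -> measurable (A : set (mpt R)).
Proof.
by move=> cA; rewrite -[A]setCK; apply: measurableC; apply: open_measurable2; rewrite openC.
Qed.

Lemma continuous_measurable2 (f : pt -> R) : continuous f -> measurable_fun (setT : set (mpt R)) f.
Proof.
move=> cf; apply: (measurability _ (RGenOpens.measurableE R)).
move=> /= _ [_ [a [b ->]] <-]; rewrite setTI.
apply: open_measurable2; move/continuousP : cf; apply.
exact: interval_open.
Qed.

Lemma within_continuous_open_measurable (f : pt -> R) (A : set pt) : open A ->
  {within A, continuous f} -> measurable_fun (A : set (mpt R)) f.
Proof.
move=> oA /within_continuousP cf; apply: (measurability _ (RGenOpens.measurableE R)).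
move=> /= _ [_ [a [b ->]] <-].
apply: open_measurable2; apply/openP => z [Az].
rewrite /preimage /= in_itv /= => /andP[h1 h2].
have e0 : 0 < Num.min (f z - a) (b - f z) by rewrite lt_min !subr_gt0 h1.
have [d d0 Hd] := cf z Az _ e0; have /openP /(_ z Az)[r r0 Hr] := oA.
exists (Num.min d r); first by rewrite lt_min d0.
move=> w; rewrite lt_min => /andP[wd wr]; have Aw := Hr w wr; split=> //=.
have := Hd w Aw wd; rewrite lt_min in_itv /= !ltr_norml => /andP[/andP[h3 _] /andP[_ h4]].
by apply/andP; split; lra.
Qed.

Lemma within_continuous_closed_measurable (f : pt -> R) (A : set pt) : closed A ->
  {within A, continuous f} -> measurable_fun (A : set (mpt R)) f.
Proof.
move=> cA /within_continuousP cf; apply: (measurability _ (RGenCInfty.measurableE R)).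
move=> /= _ [_ [a ->] <-].
apply: closed_measurable2; apply/closedP => z H.
have Az : A z.
  by move/closedP : cA; apply=> r /H [w [Aw _] wz]; exists w.
split=> //; rewrite /preimage /= in_itv /= andbT leNgt; apply/negP => fa.
have e0 : 0 < a - f z by rewrite subr_gt0.
have [d d0 Hd] := cf z Az _ e0; have [w [Aw]] := H d d0.
rewrite /preimage /= in_itv /= andbT => aw wz.
by have := Hd w Aw wz; rewrite ltr_norml => /andP[_]; lra.
Qed.

Lemma measurable_shift1 (d : R) : measurable_fun setT (fun x : measurableTypeR R => (x : R) + d : measurableTypeR R).
Proof. exact: measurable_funD. Qed.

Lemma measurable_shift2 (d : pt) : measurable_fun setT (fun z : mpt R => (z : pt) + d : mpt R).
Proof.
apply/measurable_fun_pairP; split => /=.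
- by apply: measurable_funD => //; exact: measurable_fst.
- by apply: measurable_funD => //; exact: measurable_snd.
Qed.

Lemma lebesgue_shift (d : R) (X : set (measurableTypeR R)) : measurable X ->
  mu1 ((fun x : R => x + d) @^-1` X) = mu1 X.
Proof.
move=> mX; symmetry.
pose f : measurableTypeR R -> measurableTypeR R := fun x : R => x + d.
have mf : measurable_fun setT f by exact: measurable_shift1.
pose m' := [the measure _ _ of pushforward mu1 f].
apply: (@lebesgue_measure_unique R (m' mf)) => // _ [[a b] _ <-] /=.
rewrite /pushforward (_ : f @^-1` _ = `]a - d, b - d]%classic).
  rewrite !lebesgue_measure_itv /= !lte_fin ltrD2r -!EFinB.
  by case: ifP => // _; congr EFin; ring.
by apply/seteqP; split=> x; rewrite /f /preimage /= !in_itv /= ltrBlDr lerBrDr.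
Qed.

Lemma leb2X (X Y : set (measurableTypeR R)) : measurable X -> measurable Y -> mu2 (X `*` Y) = (mu1 X * mu1 Y)%E.
Proof. by move=> mX mY; rewrite /leb2 product_measure1E. Qed.

(** The image measure under [f] agrees with [leb2] on rectangles, and a product measure is
    determined by them. *)
Lemma leb2_unique (f : mpt R -> mpt R) : measurable_fun setT f ->
  (forall X Y, measurable X -> measurable Y -> mu2 (f @^-1` (X `*` Y)) = (mu1 X * mu1 Y)%E) ->
  forall A, measurable A -> mu2 (f @^-1` A) = mu2 A.
Proof.
move=> mf H A mA; symmetry.
pose m' := [the measure _ _ of pushforward mu2 f].
rewrite [LHS]/leb2 (product_measure_unique (m' := m' mf))//.
Qed.

Lemma leb2_shift (d : pt) A : measurable A -> mu2 ((fun z : pt => z + d) @^-1` A) = mu2 A.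
Proof.
apply: leb2_unique => [|X Y mX mY]; first exact: measurable_shift2.
rewrite -[in RHS](lebesgue_shift d.1 mX) -[in RHS](lebesgue_shift d.2 mY) -leb2X//.
- by rewrite -[X in measurable X]setTI; exact: measurable_shift1.
- by rewrite -[X in measurable X]setTI; exact: measurable_shift1.
Qed.

Lemma leb2_swap A : measurable A -> mu2 ((fun z : pt => (z.2, z.1)) @^-1` A) = mu2 A.
Proof.
apply: leb2_unique => [|X Y mX mY].
  apply/measurable_fun_pairP; split; [exact: measurable_snd|exact: measurable_fst].
rewrite (_ : _ @^-1` _ = Y `*` X); last by apply/seteqP; split=> z [].
by rewrite leb2X// muleC.
Qed.

Lemma measurable_shear (m : R) : measurable_fun setT (fun z : mpt R => ((z.1, (z.2 : R) + m * (z.1 : R)) : mpt R)).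
Proof.
apply/measurable_fun_pairP; split => /=; first exact: measurable_fst.
apply: measurable_funD; first exact: measurable_snd.
by apply: measurable_funM => //; exact: measurable_fst.
Qed.

(** On each section with fixed first coordinate the shear is a translation. *)
Lemma leb2_shear (m : R) A : measurable A ->
  mu2 ((fun z : pt => (z.1, z.2 + m * z.1)) @^-1` A) = mu2 A.
Proof.
apply: leb2_unique => [|X Y mX mY]; first exact: measurable_shear.
rewrite -leb2X// /leb2 /product_measure1; apply: eq_integral => x _ /=.
rewrite -(lebesgue_shift (m * x) (measurable_xsection x (measurableX mX mY))).
congr mu1; apply/seteqP; split=> y; rewrite /xsection /=; by rewrite !inE.
Qed.

Lemma leb2_box (a b c d : R) : a <= b -> c <= d ->
  mu2 (`[a, b] `*` `[c, d]) = ((b - a) * (d - c))%:E.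
Proof.
move=> ab cd; rewrite leb2X// !lebesgue_measure_itv /= !lte_fin.
move: ab cd; rewrite !le_eqVlt => /orP[/eqP->|ab]; first by rewrite ltxx subrr !mul0r mul0e.
move=> /orP[/eqP->|cd]; first by rewrite ltxx subrr !mulr0 mule0.
by rewrite ab cd -!EFinB -EFinM.
Qed.

Lemma leb2_bounded_lty (A : set (mpt R)) (M : R) : measurable A -> (forall z : pt, A z -> `|z| <= M) ->
  (mu2 A < +oo)%E.
Proof.
move=> mA AM; apply: (@le_lt_trans _ _ (mu2 (`[- `|M|, `|M|] `*` `[- `|M|, `|M|]))).
  apply: le_measure; rewrite ?inE//.
    by apply: measurableX; exact: measurable_itv.
  move=> z /AM zM; have {}zM := le_trans zM (ler_norm M).
  move/norm_leP : zM => [h1 h2].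
  by split=> /=; rewrite in_itv /= -ler_norml.
by rewrite leb2_box ?ltry// -subr_ge0 opprK addr_ge0.
Qed.

Lemma leb2_open_gt0 (A : set pt) : open A -> A !=set0 -> (0 < mu2 A)%E.
Proof.
move=> oA [z Az]; have /openP /(_ z Az)[r r0 Hr] := oA.
apply: (@lt_le_trans _ _ (mu2 (`[z.1 - r / 2, z.1 + r / 2] `*` `[z.2 - r / 2, z.2 + r / 2]))).
  rewrite leb2_box ?lte_fin ?mulr_gt0//; lra.
apply: le_measure; rewrite ?inE//.
- by apply: measurableX; exact: measurable_itv.
- exact: open_measurable2.
- move=> w [/=]; rewrite !in_itv/= => /andP[h1 h2] /andP[h3 h4].
  by apply: Hr; apply/norm_ltP; rewrite !ltr_norml /=; split; apply/andP; split; lra.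
Qed.

(* Infinitely many disjoint translates of Z fit into a bounded region. *)
Lemma null_translates (Z : set pt) (M : R) (d : pt) (t : nat -> R) :
  measurable (Z : set (mpt R)) -> (forall z, Z z -> `|z| <= M) -> (forall n, `|t n| <= 1) ->
  (forall n m z z', n <> m -> Z z -> Z z' -> z + t n *: d <> z' + t m *: d) ->
  mu2 Z = 0%E.
Proof.
move=> mZ bZ t1 tr.
pose F n : set (mpt R) := (fun z : pt => z + - (t n *: d)) @^-1` Z.
have mF n : measurable (F n).
  by rewrite /F -[X in measurable X]setTI; exact: measurable_shift2.
have FE n : mu2 (F n) = mu2 Z by rewrite leb2_shift.
have tF : trivIset setT F.
  apply/trivIsetP => n m _ _ nm; apply/seteqP; split=> // z [Fn Fm].
  have := @tr n m _ _ (elimN eqP nm) Fn Fm; apply.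
  by rewrite !subrK.
have Ub : (mu2 (\bigcup_n F n) < +oo)%E.
  apply: (@leb2_bounded_lty _ (M + `|d|)); first exact: bigcupT_measurable.
  move=> z [n _ /bZ h]; rewrite -[z](subrK (t n *: d)).
  rewrite (le_trans (ler_normD _ _))// lerD// normrZ -[leRHS]mul1r.
  by rewrite ler_wpM2r.
have UE := @measure_bigcup _ _ _ (leb2 (R:=R)) setT F (fun n _ => mF n) tF.
have := eq_ind _ (fun x => (x < +oo)%E) Ub _ UE.
rewrite (eq_eseriesr (g := fun=> mu2 Z)); last by move=> n _; exact: FE.
have Zlty : (mu2 Z < +oo)%E by exact: leb2_bounded_lty bZ.
have Zfin : mu2 Z \is a fin_num by rewrite ge0_fin_numE.
rewrite -(fineK Zfin); set c := fine _ => h.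
have c0 : 0 <= c by rewrite fine_ge0.
apply/eqP; rewrite eqe; apply/eqP/le_anti; rewrite c0 andbT leNgt; apply/negP => cp.
set S := (X in (X < _)%E) in h.
have HS n : ((c *+ n)%:E <= S)%E.
  apply: (@le_trans _ _ (\sum_(0 <= i < n | i \in setT) c%:E)%E); last first.
    by apply: nneseries_lim_ge => i _; rewrite lee_fin.
  rewrite (eq_bigl xpredT); last by move=> i; rewrite in_setT.
  by rewrite sumEFin sumr_const_nat subn0.
have S0 : (0 <= S)%E by have := HS 0%N.
have Sfin : S \is a fin_num by rewrite ge0_fin_numE.
have [n Hn] : exists n, fine S < c *+ n.
  exists (Num.bound (fine S / c)).
  rewrite -mulr_natr -ltr_pdivrMl// mulrC.
  by apply: archi_boundP; rewrite divr_ge0// fine_ge0.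
by have := HS n; rewrite -(fineK Sfin) lee_fin leNgt Hn.
Qed.

End PlaneMeasure.

(** * Null sets and gradients *)

Section PlaneNull.
Variable R : realType.
Notation pt := (R * R)%type.
Local Notation mu2 := (@leb2 R).

(** This replaces density theorems. The set is exhausted by bounded pieces [Z N M] whose points
    leave [E] under every rational multiple of [d] in (0, 1/(N+1)). Suitable translates of one piece
    are pairwise disjoint, so each piece is null. Rational multiples keep the pieces measurable. *)
Lemma negligible_escape (E : set pt) (d : pt) : measurable (E : set (mpt R)) ->
  mu2.-negligible [set z | E z /\ exists2 tau : R, 0 < tau &
    forall t, 0 < t < tau -> ~ E (z + t *: d)].
Proof.
move=> mE.
pose Z (N M : nat) : set (mpt R) := [set z : pt | [/\ E z, `|z| <= M%:R &
  forall q : rat, 0 < (ratr q : R) < N.+1%:R^-1 -> ~ E (z + ratr q *: d)]].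
have mZ N M : measurable (Z N M : set (mpt R)).
  rewrite (_ : Z N M = E `&` [set z : pt | `|z| <= M%:R] `&`
    ~` \bigcup_(q : rat) (if 0 < (ratr q : R) < N.+1%:R^-1
      then (fun z : pt => z + ratr q *: d) @^-1` E else set0)); last first.
    apply/seteqP; split=> z.
      by move=> [? ? h]; split=> // -[q _]; case: ifP => // /h.
    by move=> [[? ?] h]; split=> // q q0 Eq; apply: h; exists q => //; rewrite q0.
  apply: measurableI; first apply: measurableI => //.
    by apply: closed_measurable2; exact: closed_norm_le.
  apply: measurableC; apply: bigcupT_measurable_rat => q; case: ifP => // _.
  by rewrite -[X in measurable X]setTI; exact: (@measurable_shift2 R (ratr q *: d)).
have Z0 N M : mu2 (Z N M) = 0%E.
  (* Differences of these numbers are rational and, when positive, below 1/(N+1). If two translates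
     met, a point of the piece would be carried back into [E] by such a difference. *)
  pose t n : R := (N.+1 * n.+2)%:R^-1.
  have tq n m : n <> m -> (t m < t n) -> exists2 q : rat, ratr q = t n - t m & 0 < (ratr q : R) < N.+1%:R^-1.
    move=> nm tmn; exists ((N.+1 * n.+2)%:R^-1 - (N.+1 * m.+2)%:R^-1).
      by rewrite rmorphB /= !fmorphV /= !ratr_nat.
    rewrite rmorphB /= !fmorphV /= !ratr_nat -/(t n) -/(t m) subr_gt0 tmn /=.
    apply: (@lt_trans _ _ (t n)).
      by rewrite ltrBlDr ltrDl invr_gt0 ltr0n.
    by rewrite /t ltf_pV2 ?posrE ?ltr0n// ltr_nat -{1}[N.+1]muln1 ltn_pmul2l.
  apply: (@null_translates R (Z N M) M%:R d t) => //.
  - by move=> z [].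
  - move=> n; rewrite ger0_norm ?invr_ge0//; rewrite invf_le1 ?ltr0n// ler1n.
    by rewrite muln_gt0.
  - move=> n m z z' nm; wlog tt : n m z z' nm / t m < t n => [H|].
      have [tt|tt|/eqP] := ltgtP (t m) (t n); first exact: H.
        by move=> Zz Zz' /esym; apply: (H m n) => // /esym.
      move=> /eqP /invr_inj /eqP; rewrite eqr_nat eqn_pmul2l// !eqSS => /eqP mn _; by case: nm.
    move=> [Ez _ hz] [Ez' _ _]; have [q qE q0] := tq n m nm tt.
    move=> E0; apply: (hz q q0); rewrite qE scalerBl addrA E0 addrK.
    exact: Ez'.
apply: (@negligibleS _ _ _ _ (\bigcup_N \bigcup_M Z N M)).
  move=> z [Ez [tau tau0 Ht]].
  near \oo => N; near \oo => M; exists N => //; exists M => //; split=> //.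
    near: M; exists (Num.truncn `|z|).+1 => //= M hM.
    by rewrite (le_trans (ltW (truncnS_gt _)))// ler_nat.
  move=> q /andP[q0 qN]; apply: Ht; rewrite q0 (lt_trans qN)//.
  by near: N; exact: near_infty_natSinv_lt (PosNum tau0).
apply: negligible_bigcup => N; apply: negligible_bigcup => M.
by exists (Z N M); split; [exact: mZ|exact: Z0|].
Unshelve. all: by end_near. Qed.

Lemma grad_dir (u : pt -> R) z g d (c : R) : has_grad u z g -> c < dotp g d ->
  exists2 tau : R, 0 < tau & forall t, 0 < t < tau -> u z + t * c < u (z + t *: d).
Proof.
move=> /has_gradP H cg.
have d1 : 0 < `|d| + 1 by rewrite ltr_wpDl.
have e0 : 0 < (dotp g d - c) / (`|d| + 1) by rewrite divr_gt0// subr_gt0.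
have [r r0 Hr] := H _ e0.
exists (r / (`|d| + 1)); first by rewrite divr_gt0.
move=> t /andP[t0 tr]; have := Hr (z + t *: d).
rewrite [z + t *: d - z]addrC addKr normrZ gtr0_norm// dotpZr.
have tr' : t * `|d| < r.
  rewrite ltr_pdivlMr// in tr; apply: le_lt_trans tr.
  by rewrite ler_pM2l// lerDl.
move=> /(_ tr'); rewrite ler_norml => /andP[h _].
suff : (dotp g d - c) / (`|d| + 1) * (t * `|d|) < t * (dotp g d - c) by lra.
rewrite mulrCA ltr_pM2l// mulrAC ltr_pdivrMr// ltr_pM2l ?subr_gt0//.
by rewrite ltrDl.
Qed.

(** A nonzero gradient is positive on one of the four axis directions. Along that direction [u]
    becomes positive at once, so the point escapes from the zero set. *)
Lemma negligible_level (u : pt -> R) (U : set pt) : open U -> {within U, continuous u} ->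
  mu2.-negligible [set z | [/\ U z, u z = 0 & exists g, has_grad u z g /\ g <> 0]].
Proof.
move=> oU cu.
pose E := U `&` [set z | u z = 0].
have mE : measurable (E : set (mpt R)).
  have mu := within_continuous_open_measurable oU cu.
  rewrite (_ : E = U `&` u @^-1` [set 0]).
    by apply: mu; [exact: open_measurable2|exact: measurable_set1].
  by [].
have P d g z : has_grad u z g -> 0 < dotp g d -> E z ->
    [set z | E z /\ exists2 tau : R, 0 < tau &
    forall t, 0 < t < tau -> ~ E (z + t *: d)] z.
  move=> H gd [Uz uz]; split=> //.
  have [tau tau0 Ht] := grad_dir H gd; exists tau => // t /Ht.
  by rewrite uz mulr0 addr0 => h [_ /= u0]; rewrite u0 ltxx in h.
pose Esc (d : pt) : set (mpt R) := [set z | E z /\ exists2 tau : R, 0 < tau &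
    forall t, 0 < t < tau -> ~ E ((z : pt) + t *: d)].
have nE d : mu2.-negligible (Esc d) by exact: negligible_escape.
apply: (@negligibleS _ _ _ _ (Esc (1, 0) `|` Esc (-1, 0) `|` (Esc (0, 1) `|` Esc (0, -1)))); last first.
  by apply: negligibleU; apply: negligibleU; exact: nE.
  move=> z [Uz uz [g [H g0]]].
  have Ez : E z by [].
  have [g1|g1|g1] := ltgtP g.1 0.
  - left; right; apply: (P _ _ _ H) => //; rewrite /dotp /=; lra.
  - left; left; apply: (P _ _ _ H) => //; rewrite /dotp /=; lra.
  - have [g2|g2|g2] := ltgtP g.2 0.
    + right; right; apply: (P _ _ _ H) => //; rewrite /dotp /=; lra.
    + right; left; apply: (P _ _ _ H) => //; rewrite /dotp /=; lra.
    + by case: g0; rewrite [g]surjective_pairing g1 g2.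
Qed.

Lemma negligible_line (g : pt) (c : R) : g <> 0 -> mu2.-negligible [set z | dotp g z = c].
Proof.
move=> g0; have H z : has_grad (fun x => dotp g x + - c) z g by exact: has_grad_aff.
apply: negligibleS (@negligible_level (fun x => dotp g x + - c) setT openT _).
  by move=> z /= gz; split=> //; [rewrite gz subrr|exists g].
apply/continuous_subspaceT/(@continuous_lip _ _ (2 * `|g|)) => z w.
rewrite opprD addrACA subrr addr0 -dotpBr.
exact: dotp_le.
Qed.

Lemma cvg_grad_dir (u : pt -> R) z g d : has_grad u z g ->
  (fun n => n.+1%:R * (u (z + n.+1%:R^-1 *: d) - u z)) @ \oo --> dotp g d.
Proof.
move=> /has_gradP H; apply/cvgrPdist_lt => e e0.
have d1 : 0 < `|d| + 1 by rewrite ltr_wpDl.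
have e1 : 0 < e / (`|d| + 1) by rewrite divr_gt0.
have [r r0 Hr] := H _ e1.
have r1 : 0 < r / (`|d| + 1) by rewrite divr_gt0.
near=> n.
have nr : n.+1%:R^-1 < r / (`|d| + 1).
  by near: n; exact: near_infty_natSinv_lt (PosNum r1).
set t : R := n.+1%:R^-1 in nr *.
have t0 : 0 < t by rewrite invr_gt0.
have -> : n.+1%:R = t^-1 by rewrite invrK.
have := Hr (z + t *: d); rewrite [z + t *: d - z]addrC addKr normrZ gtr0_norm// dotpZr.
have tr' : t * `|d| < r.
  rewrite ltr_pdivlMr// in nr; apply: le_lt_trans nr.
  by rewrite ler_pM2l// lerDl.
move=> /(_ tr').
have -> : dotp g d - t^-1 * (u (z + t *: d) - u z) = - t^-1 * (u (z + t *: d) - u z - t * dotp g d).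
  by field; rewrite gt_eqF.
rewrite normrM normrN (gtr0_norm (_ : 0 < t^-1)) ?invr_gt0// => h.
rewrite mulrC ltr_pdivrMr//; apply: (le_lt_trans h).
rewrite mulrCA [e * t]mulrC ltr_pM2l// mulrAC ltr_pdivrMr// ltr_pM2l//.
by rewrite ltrDl.
Unshelve. all: by end_near. Qed.

(** A directional derivative is a pointwise limit of difference quotients; extending [u] by zero
    outside [U] makes these quotients measurable on the whole plane without changing them near a
    point of [U]. *)
Lemma measurable_grad (u : pt -> R) (U D : set pt) (g : pt -> pt) d :
  open U -> {within U, continuous u} -> measurable (D : set (mpt R)) -> D `<=` U ->
  (forall z, D z -> has_grad u z (g z)) ->
  measurable_fun (D : set (mpt R)) (fun z => dotp (g z) d).
Proof.
move=> oU cu mD DU H.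
pose v : mpt R -> R := (u \_ U).
have mv : measurable_fun setT v.
  have := (@measurable_restrict _ _ (mpt R) R U setT u (open_measurable2 oU) measurableT).
  rewrite setTI => -[h _]; apply: h.
  exact: within_continuous_open_measurable.
have vU z : U z -> v z = u z by move=> Uz; rewrite /v patchE mem_set.
apply: (@measurable_fun_cvg _ (mpt R) R D (fun n z => n.+1%:R * (v ((z : pt) + n.+1%:R^-1 *: d) - v z))).
- move=> n; apply: measurable_funTS; apply: measurable_funM => //.
  apply: measurable_funB => //.
  exact: (measurableT_comp mv (@measurable_shift2 R (n.+1%:R^-1 *: d))).
- move=> z Dz; apply: cvg_grad_dir.
  have /openP /(_ z (DU _ Dz))[r r0 Hr] := oU.
  by apply: (has_grad_near r0 _ (H _ Dz)) => w /Hr /vU.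
Qed.

End PlaneNull.

(** * Integrals of bounded functions *)

Section NullModification.
Local Open Scope ereal_scope.
Context d (T : measurableType d) (R : realType) (mu : {measure set T -> \bar R}).
Import HBNNSimple.

(* No measurability of f and g is assumed: the integral of an arbitrary
   nonnegative function is a supremum over simple functions. *)
Lemma le_integral_null (N : set T) (f g : T -> \bar R) : measurable N -> mu N = 0 ->
  (forall x, 0 <= f x) -> (forall x, 0 <= g x) -> (forall x, ~ N x -> f x = g x) ->
  \int[mu]_x f x <= \int[mu]_x g x.
Proof.
move=> mN N0 f0 g0 fg; rewrite !ge0_integralTE//.
apply: ge_ereal_sup => _ [h /= hf <-].
have mNC : measurable (~` N) by exact: measurableC.
apply: ereal_sup_ubound; exists (proj_nnsfun h mNC) => [x /=|].
  rewrite /mindic indicE; have [xN|xN] := boolP (x \in ~` N).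
    by rewrite mulr1 -fg//; apply: set_mem.
  by rewrite mulr0.
rewrite -!integralT_nnsfun /=.
transitivity (\int[mu]_(x in ~` N) (h x)%:E).
  by rewrite [RHS]integral_mkcond; apply: eq_integral => x _; rewrite patchE /= /mindic indicE;
    case: ifPn => _; rewrite ?mulr1 ?mulr0.
symmetry; have mh : measurable_fun setT (EFin \o h) by exact/measurable_EFinP.
have h0 x : setT x -> 0 <= (EFin \o h) x by rewrite lee_fin.
by rewrite (ge0_negligible_integral mN measurableT mh h0 N0) setTD.
Qed.

(** The energy integrates [sigma (gradf u z)], and on the null set where [u] has no gradient in N
    nothing is known about the integrand, not even measurability. This lemma discards that set. *)
Lemma eq_integral_null (D E N : set T) (f g : T -> \bar R) : measurable N -> mu N = 0 ->
  (forall x, ~ N x -> (f \_ D) x = (g \_ E) x) ->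
  \int[mu]_(x in D) f x = \int[mu]_(x in E) g x.
Proof.
move=> mN N0 fg; rewrite integral_mkcond [RHS]integral_mkcond.
have fgp x : ~ N x -> ((f \_ D) ^\+ x) = ((g \_ E) ^\+ x) by rewrite !funeposE => /fg ->.
have fgn x : ~ N x -> ((f \_ D) ^\- x) = ((g \_ E) ^\- x) by rewrite !funenegE => /fg ->.
rewrite integralE [RHS]integralE; congr (_ - _); apply/le_anti/andP; split.
- exact: (le_integral_null mN N0).
- by apply: (le_integral_null mN N0) => // x /fgp.
- exact: (le_integral_null mN N0).
- by apply: (le_integral_null mN N0) => // x /fgn.
Qed.

End NullModification.

Section BoundedIntegrals.
Variable R : realType.
Notation pt := (R * R)%type.
Local Notation mu2 := (@leb2 R).

Definition bfun (D : set (mpt R)) (f : pt -> R) := [/\ measurable D, (mu2 D < +oo)%E,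
  measurable_fun D (f : mpt R -> R) & exists C, forall z, D z -> `|f z| <= C].

Lemma bfun_integrable D f : bfun D f -> mu2.-integrable D (EFin \o f).
Proof.
move=> [mD fD mf [C HC]]; apply: (measurable_bounded_integrable mD fD mf).
exists C; split; first exact: num_real.
by move=> x Cx z Dz /=; apply: (le_trans (HC z Dz)); exact: ltW.
Qed.

Lemma bfunS D E f : bfun D f -> measurable E -> E `<=` D -> bfun E f.
Proof.
move=> [mD fD mf [C HC]] mE ED; split=> //.
- by apply: le_lt_trans fD; apply: le_measure; rewrite ?inE.
- exact: measurable_funS mf.
- by exists C => z /ED/HC.
Qed.

Lemma bfunB D f g : bfun D f -> bfun D g -> bfun D (fun z => f z - g z).
Proof.
move=> [mD fD mf [C HC]] [_ _ mg [C' HC']]; split=> //; first exact: measurable_funB.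
by exists (C + C') => z Dz; rewrite (le_trans (ler_normB _ _))// lerD ?HC ?HC'.
Qed.

Lemma bfun_cst D (k : R) : measurable D -> (mu2 D < +oo)%E -> bfun D (fun=> k).
Proof. by move=> mD fD; split=> //; exists `|k|. Qed.

Lemma Rintegral_null (D N : set (mpt R)) f : bfun D f -> measurable N -> mu2 N = 0%E ->
  \int[mu2]_(z in D) f z = \int[mu2]_(z in D `\` N) f z.
Proof.
move=> bf mN N0; rewrite /Rintegral; congr fine.
by apply: (@negligible_integral _ _ _ mu2) => //; [case: bf|exact: bfun_integrable].
Qed.

Definition bsupp (f : pt -> R) := [/\ measurable_fun (setT : set (mpt R)) (f : mpt R -> R),
  exists C, forall z, `|f z| <= C & exists M, forall z, M < `|z| -> f z = 0].

Lemma bsupp_integrable f : bsupp f -> mu2.-integrable setT (EFin \o (f : mpt R -> R)).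
Proof.
move=> [mf [C HC] [M HM]].
pose B : set (mpt R) := [set z : pt | `|z| <= M].
have mB : measurable B.
  by apply: closed_measurable2; exact: closed_norm_le.
have bf : bfun B f.
  split=> //; [exact: (@leb2_bounded_lty _ _ M)|exact: measurable_funTS|by exists C].
have := bfun_integrable bf; rewrite (integrable_mkcond _ mB).
congr (_.-integrable _ _); apply/funext => z; rewrite patchE /=.
case: ifPn => //; rewrite notin_setE /B /= => /negP; rewrite -ltNge => /HM ->//.
Qed.

Lemma bsupp_shift f d : bsupp f -> bsupp (fun z => f (z + d)).
Proof.
move=> [mf [C HC] [M HM]]; split.
- exact: (measurableT_comp mf (@measurable_shift2 R d)).
- by exists C.
- exists (M + `|d|) => z h; apply: HM.
  have := ler_normB (z + d) d; rewrite addrK; lra.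
Qed.

Lemma bsuppB f g : bsupp f -> bsupp g -> bsupp (fun z => f z - g z).
Proof.
move=> [mf [C HC] [M HM]] [mg [C' HC'] [M' HM']]; split; first exact: measurable_funB.
- by exists (C + C') => z; rewrite (le_trans (ler_normB _ _))// lerD ?HC ?HC'.
- exists (Num.max M M') => z; rewrite gt_max => /andP[h h'].
  by rewrite HM// HM'// subrr.
Qed.

Lemma Rintegral_shift (d : pt) f : bsupp f ->
  \int[mu2]_z f (z + d) = \int[mu2]_z f z.
Proof.
move=> bf; rewrite /Rintegral; congr fine.
have [mf _ _] := bf.
pose s : mpt R -> mpt R := fun z : pt => z + d.
have ms : measurable_fun setT s := @measurable_shift2 R d.
pose m' := [the measure _ _ of pushforward mu2 s].
have mf' : measurable_fun setT (EFin \o f : mpt R -> \bar R) by exact/measurable_EFinP.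
have H := (@integral_pushforward _ _ _ _ R s ms mu2 setT (EFin \o f) mf'
  (bsupp_integrable (bsupp_shift d bf)) measurableT).
apply: (eq_trans (esym H)).
apply: (@eq_measure_integral _ _ _ setT mu2 (m' ms)) => A mA _.
exact: (leb2_shift d mA).
Qed.

Lemma Rdominated (D : set (mpt R)) (f_ : nat -> pt -> R) (f : pt -> R) (C : R) :
  measurable D -> (mu2 D < +oo)%E -> (forall n, measurable_fun D (f_ n : mpt R -> R)) ->
  measurable_fun D (f : mpt R -> R) -> (forall n z, D z -> `|f_ n z| <= C) ->
  (forall z, D z -> f_ ^~ z @ \oo --> f z) ->
  (fun n => \int[mu2]_(z in D) f_ n z) @ \oo --> \int[mu2]_(z in D) f z.
Proof.
move=> mD fD mf_ mf HC cf.
have mf' : measurable_fun D (EFin \o f) by exact/measurable_EFinP.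
have mf_' n : measurable_fun D (EFin \o f_ n) by exact/measurable_EFinP.
have cf' : {ae mu2, forall z, D z -> (fun n => (f_ n z)%:E) @ \oo --> (f z)%:E}.
  by apply: aeW => z /cf h; apply: cvg_EFin => //; apply: nearW.
have ig : mu2.-integrable D (EFin \o (fun=> C)) by apply/bfun_integrable/bfun_cst.
have fg' : {ae mu2, forall z n, D z -> (`|(f_ n z)%:E| <= (fun=> C%:E) z)%E}.
  by apply: aeW => z n Dz; rewrite /= lee_fin; exact: HC.
have [intf _ H] := dominated_convergence mD mf_' mf' cf' ig fg'.
apply: fine_cvg; move: H; rewrite /= => H.
by rewrite fineK//; apply: (integrable_fin_num mD); exact: intf.
Qed.

Lemma measurable_norm_le (M : R) : measurable ([set z : pt | `|z| <= M] : set (mpt R)).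
Proof. by apply: closed_measurable2; exact: closed_norm_le. Qed.

(** Difference quotients of a bounded function with bounded support integrate to zero by translation
    invariance; the Lipschitz bound dominates them, so their limit does too. This makes the gradient
    a null Lagrangian. *)
Lemma grad_int0 (w : pt -> R) (K C M : R) (D : set pt) (g : pt -> pt) d : 0 <= K -> 0 <= M ->
  (forall z z', `|w z - w z'| <= K * `|z - z'|) -> (forall z, `|w z| <= C) ->
  (forall z, M < `|z| -> w z = 0) -> (forall z, D z -> has_grad w z (g z)) ->
  mu2.-negligible [set z | ~ D z /\ ~ has_grad w z 0] ->
  \int[mu2]_(z in D) dotp (g z) d = 0.
Proof.
move=> K0 M0 wK wC wM Hg [N [mN N0 HN]].
have cw : continuous w by exact: continuous_lip wK.
have mw := continuous_measurable2 cw.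
have bw : bsupp w by split=> //; [exists C|exists M].
pose L := M + `|d|.
have ML : M <= L by rewrite lerDl.
pose B : set (mpt R) := [set z : pt | `|z| <= L].
have mB : measurable B by exact: measurable_norm_le.
have fB : (mu2 B < +oo)%E by exact: (@leb2_bounded_lty _ _ L).
pose E : set (mpt R) := B `\` N.
have mE : measurable E by exact: measurableD.
have EB : E `<=` B by move=> z [].
have fE : (mu2 E < +oo)%E by apply: le_lt_trans fB; apply: le_measure; rewrite ?inE.
(* [D] need not be measurable, so the integral is moved to the ball [B] minus a null set, where [g']
   is the full gradient of [w]. *)
pose g' z := if z \in D then g z else 0.
have Hg' z : ~ N z -> has_grad w z (g' z).
  move=> nNz; rewrite /g'; have [zD|zD] := boolP (z \in D); first by apply: Hg; exact: set_mem.
  by apply: contrapT => h; apply: nNz; apply: HN; split=> //; move: zD; rewrite notin_setE.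
have g'0 z : ~ B z -> has_grad w z (g' z) -> g' z = 0.
  move=> /negP; rewrite -ltNge => h H; apply: (has_grad_unique H).
  have r0 : 0 < `|z| - M by rewrite subr_gt0 (le_lt_trans ML).
  apply: (has_grad_near r0 _ (@has_grad_cst R 0 z)) => x xz.
  rewrite wM//; have := ler_normD x (z - x); rewrite addrC subrK [`|z - x|]distrC.
  by lra.
pose f_ (n : nat) (z : pt) := n.+1%:R * (w (z + n.+1%:R^-1 *: d) - w z).
have mf_ n : measurable_fun (setT : set (mpt R)) (f_ n : mpt R -> R).
  apply: measurable_funM => //; apply: measurable_funB => //.
  exact: (measurableT_comp mw (@measurable_shift2 R (n.+1%:R^-1 *: d))).
have f_C n z : `|f_ n z| <= K * `|d|.
  rewrite /f_ normrM ger0_norm//.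
  apply: (@le_trans _ _ (n.+1%:R * (K * `|z + n.+1%:R^-1 *: d - z|))).
    by rewrite ler_wpM2l.
  rewrite [z + _]addrC addrK normrZ ger0_norm ?invr_ge0// mulrCA.
  by rewrite mulVKf ?pnatr_eq0 // mulrC.
have cf : (fun n => \int[mu2]_(z in E) f_ n z) @ \oo --> \int[mu2]_(z in E) dotp (g' z) d.
  apply: (@Rdominated E f_ _ (K * `|d|)) => //.
  - by move=> n; apply: measurable_funTS.
  - apply: (@measurable_grad R w setT E g' d openT) => //.
      exact: continuous_subspaceT.
    by move=> z [_ /Hg'].
  - by move=> z [_ /Hg' h]; exact: cvg_grad_dir.
have f0 n : \int[mu2]_(z in E) f_ n z = 0.
  have bf : bfun B (f_ n) by split=> //; [exact: measurable_funTS|exists (K * `|d|)].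
  rewrite -(Rintegral_null bf mN N0) Rintegral_mkcond.
  transitivity (\int[mu2]_z (f_ n z)).
    apply: eq_Rintegral => z _; rewrite patchE; case: ifPn => //.
    rewrite notin_setE /B /= => /negP; rewrite -ltNge => h.
    rewrite /f_ !wM ?subrr ?mulr0//; first exact: le_lt_trans h.
    have := ler_normB (z + n.+1%:R^-1 *: d) (n.+1%:R^-1 *: d).
    rewrite addrK normrZ ger0_norm ?invr_ge0// => h1.
    have h2 : n.+1%:R^-1 * `|d| <= `|d| by rewrite ler_piMl// invf_le1 ?ltr0n// ler1n.
    by move: h h1 h2; rewrite /L; set a := _ * `|d|; lra.
  rewrite /f_; have bw' := bsupp_shift (n.+1%:R^-1 *: d) bw.
  have i1 := bsupp_integrable bw; have i2 := bsupp_integrable bw'.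
  rewrite RintegralZl//; last by apply: bsupp_integrable; exact: bsuppB.
  by rewrite RintegralB// Rintegral_shift// subrr mulr0.
have lim0 : \int[mu2]_(z in E) dotp (g' z) d = 0.
  move: cf; rewrite (_ : (fun n => _) = cst 0); last by apply/funext => n; exact: f0.
  by move=> /cvg_lim <-//; rewrite lim_cst.
rewrite -lim0 /Rintegral; congr fine.
apply: (@eq_integral_null _ _ _ mu2 D E N) => // z nNz.
have h := Hg' z nNz.
have [zB|zB] := pselect (B z).
  have zE : z \in E by rewrite inE.
  by rewrite [RHS]patchE zE patchE /g'; case: ifPn => // _; rewrite dotp0l.
have zE : z \in E = false by apply/negbTE; rewrite notin_setE => -[].
rewrite [RHS]patchE zE patchE; have := g'0 z zB h; rewrite /g'.
by case: ifPn => // _ ->; rewrite dotp0l.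
Qed.

Lemma Rintegral_le_cst (D : set (mpt R)) f (c : R) : bfun D f -> (forall z, D z -> f z <= c) ->
  \int[mu2]_(z in D) f z <= c * fine (mu2 D).
Proof.
move=> bf fc; have [mD fD _ _] := bf; rewrite -(Rintegral_cst mu2 mD c).
by apply: le_Rintegral => //; apply: bfun_integrable => //; exact: bfun_cst.
Qed.

(** A function whose upper right Dini derivative is nonnegative does not decrease. The supremum of
    the parameters reached with loss at most [eta] per unit of time is [T], for otherwise one more
    step could be made. *)
Lemma mono_of_small_steps (F : R -> R) (C T : R) : 0 <= T -> 0 <= C ->
  (forall s t, 0 <= s <= T -> 0 <= t <= T -> `|F s - F t| <= C * `|s - t|) ->
  (forall t eta delta, 0 <= t -> t < T -> 0 < eta -> 0 < delta ->
    exists2 e, 0 < e < delta & F t - eta * e <= F (t + e)) ->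
  F 0 <= F T.
Proof.
move=> T0 C0 FL FS; apply/ler_addgt0Pr => e0 e00.
have T1 : 0 < T + 1 by rewrite ltr_wpDl.
pose eta := e0 / (T + 1).
have eta0 : 0 < eta by rewrite divr_gt0.
pose S := [set t | 0 <= t <= T /\ F 0 - eta * t <= F t].
have S0 : S 0 by split; rewrite ?lexx ?T0// mulr0 subr0.
have hS : has_sup S by split; [exists 0|exists T => t [/andP[]]].
pose s := sup S.
have s0 : 0 <= s by apply: ub_le_sup => //; exact: hS.2.
have sT : s <= T by apply: ge_sup; [exists 0|move=> t [/andP[]]].
have Ss : F 0 - eta * s <= F s.
  apply/ler_addgt0Pr => e e_gt0.
  have Ce : 0 < C + eta + 1 by rewrite ltr_wpDl// addr_ge0// ltW.
  have d0 : 0 < e / (C + eta + 1) by rewrite divr_gt0.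
  have [t [t0T Ft] ts] := sup_adherent d0 hS.
  have tls : t <= s by apply: ub_le_sup => //; exact: hS.2.
  have := FL s t; rewrite s0 sT => /(_ isT t0T).
  rewrite (ger0_norm (_ : 0 <= s - t)) ?subr_ge0// ler_norml => /andP[h _].
  have st : s - t <= e / (C + eta + 1) by rewrite -/s in ts; lra.
  have h2 : (s - t) * (C + eta + 1) <= e by rewrite -ler_pdivlMr.
  have h3 : 0 <= s - t by rewrite subr_ge0.
  have h4 : 0 <= (s - t) * eta by rewrite mulr_ge0// ltW.
  have := h4; nra.
have [sTlt|sTge] := ltP s T.
  have d0 : 0 < T - s by rewrite subr_gt0.
  have [e /andP[e_gt0 eT] h] := FS s eta (T - s) s0 sTlt eta0 d0.
  have : S (s + e).
    split; first by apply/andP; split; lra.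
    by rewrite mulrDr; lra.
  by move/(ub_le_sup hS.2); rewrite -/s; lra.
have sE : s = T by apply/le_anti; rewrite sT sTge.
rewrite sE in Ss; have : eta * T <= e0.
  by rewrite /eta mulrAC ler_pdivrMr// ler_pM2l// lerDl.
by lra.
Qed.

(** The segment may lie entirely in the exceptional null set. Averaging [k] over a small ball that
    travels along the segment lets almost every point count, and dominated convergence gives the
    average a nonnegative derivative. *)
Lemma mono_dir (k : pt -> R) (U : set pt) (K : R) (nu z0 : pt) (T : R) : open U -> 0 <= K ->
  (forall z w, U z -> U w -> `|k z - k w| <= K * `|z - w|) ->
  mu2.-negligible [set z | U z /\ ~ exists g, has_grad k z g /\ 0 <= dotp g nu] ->
  0 <= T -> (forall t, 0 <= t <= T -> U (z0 + t *: nu)) ->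
  k z0 <= k (z0 + T *: nu).
Proof.
move=> oU K0 kL [N [mN N0 HN]] T0 seg; rewrite leNgt; apply/negP => gap.
pose gam := k z0 - k (z0 + T *: nu).
have gam0 : 0 < gam by rewrite subr_gt0.
pose S : set pt := [set z | exists2 t, 0 <= t <= T & z = z0 + t *: nu].
have cS : compact S.
  rewrite (_ : S = (fun t : R => z0 + t *: nu) @` `[0, T]%classic).
    apply: continuous_compact; last exact: segment_compact.
    apply: continuous_subspaceT => t; apply: cvgD; first exact: cvg_cst.
    by apply: cvgZr_tmp; exact: cvg_id.
  apply/seteqP; split=> z.
    by move=> [t t0 ->]; exists t => //=; rewrite in_itv.
  by move=> [t /=]; rewrite in_itv /= => t0 <-; exists t.
have SU : S `<=` U by move=> z [t /seg h ->].
have [r r0 Hr] := tube cS oU SU.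
(* The radius keeps the moving ball in [U], and with [K * rho <= gam / 4] averaging changes the two
   end values by at most half the assumed drop [gam]. *)
pose rho := Num.min (r / 2) (gam / (4 * (K + 1))).
have K1 : 0 < K + 1 by rewrite ltr_wpDl.
have rho0 : 0 < rho by rewrite lt_min !divr_gt0// mulr_gt0.
have rhor : rho < r by rewrite /rho gt_min; apply/orP; left; lra.
have rhoK : K * rho <= gam / 4.
  apply: (@le_trans _ _ ((K + 1) * (gam / (4 * (K + 1))))).
    by apply: ler_pM => //; [exact: ltW|lra|rewrite /rho ge_min lexx orbT].
  by rewrite le_eqVlt; apply/orP; left; apply/eqP; field; rewrite gt_eqF.
pose B : set (mpt R) := [set z : pt | `|z| <= rho].
have mB : measurable B by exact: measurable_norm_le.
have fB : (mu2 B < +oo)%E by exact: (@leb2_bounded_lty _ _ rho).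
have oB : open [set z : pt | `|z| < rho].
  apply/openP => z /= zr; exists (rho - `|z|); first by rewrite subr_gt0.
  by move=> w wz; have := ler_normD z (w - z); rewrite addrC subrK; lra.
have pB : 0 < fine (mu2 B).
  apply: fine_gt0; rewrite fB andbT.
  have b0 : [set z : pt | `|z| < rho] !=set0 by exists 0; rewrite /= normr0.
  apply: (lt_le_trans (leb2_open_gt0 oB b0)); apply: le_measure; rewrite ?inE//.
    exact: open_measurable2.
  by move=> z /ltW.
have UB t z : 0 <= t <= T -> B z -> U (z + (z0 + t *: nu)).
  move=> tT Bz; apply: (Hr (z0 + t *: nu)); first by exists t.
  by rewrite addrK; apply: le_lt_trans rhor.
have ck : {within U, continuous k}.
  apply/within_continuousP => z Uz e e0; exists (e / (K + 1)); first by rewrite divr_gt0.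
  move=> w Uw wz; apply: (le_lt_trans (kL _ _ Uw Uz)).
  apply: (@le_lt_trans _ _ ((K + 1) * `|w - z|)); first by rewrite ler_wpM2r// lerDl.
  by rewrite mulrC -ltr_pdivlMr.
pose v : mpt R -> R := (k \_ U).
have mv : measurable_fun setT v.
  have := (@measurable_restrict _ _ (mpt R) R U setT k (open_measurable2 oU) measurableT).
  rewrite setTI => -[h _]; apply: h.
  exact: within_continuous_open_measurable.
have vU z : U z -> v z = k z by move=> Uz; rewrite /v patchE mem_set.
have mvs d : measurable_fun (setT : set (mpt R)) (fun z : mpt R => v ((z : pt) + d)).
  exact: (measurableT_comp mv (@measurable_shift2 R d)).
pose p t := z0 + t *: nu.
have pD s t z : z + p s - (z + p t) = (s - t) *: nu.
  by rewrite /p opprD addrACA subrr add0r opprD addrACA subrr add0r -scalerBl.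
have bv t : 0 <= t <= T -> bfun B (fun z => v (z + p t)).
  move=> tT; split=> //; first exact: measurable_funTS.
  exists (`|k (p t)| + K * rho) => z Bz; have Uz := UB t z tT Bz; rewrite vU//.
  have Up : U (p t) by exact: seg.
  have := kL _ _ Uz Up; rewrite addrK => h.
  have := ler_normD (k (p t)) (k (z + p t) - k (p t)); rewrite addrC subrK.
  have : K * `|z| <= K * rho by rewrite ler_wpM2l.
  by lra.
pose F t := \int[mu2]_(z in B) v (z + p t).
have FB s t : 0 <= s <= T -> 0 <= t <= T -> F s - F t = \int[mu2]_(z in B) (v (z + p s) - v (z + p t)).
  by move=> sT tT; rewrite RintegralB//; apply: bfun_integrable; exact: bv.
have vL s t z : 0 <= s <= T -> 0 <= t <= T -> B z -> `|v (z + p s) - v (z + p t)| <= K * `|nu| * `|s - t|.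
  move=> sT tT Bz; have Us := UB s z sT Bz; have Ut := UB t z tT Bz; rewrite !vU//.
  by apply: (le_trans (kL _ _ Us Ut)); rewrite pD normrZ [`|s - t| * _]mulrC mulrA.
have F1 s t : 0 <= s <= T -> 0 <= t <= T -> F s - F t <= K * `|nu| * fine (mu2 B) * `|s - t|.
  move=> sT tT; rewrite FB// mulrAC; apply: Rintegral_le_cst.
    by apply: bfunB; exact: bv.
  by move=> z Bz; apply: (le_trans (ler_norm _)); exact: vL.
have FL s t : 0 <= s <= T -> 0 <= t <= T -> `|F s - F t| <= K * `|nu| * fine (mu2 B) * `|s - t|.
  move=> sT tT; rewrite ler_norml F1// andbT lerNl opprB distrC; exact: F1.
have T0T : 0 <= (0 : R) <= T by apply/andP; split.
have TTT : 0 <= T <= T by apply/andP; split.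
suff : F 0 <= F T.
  rewrite -subr_ge0 FB// leNgt => /negP; apply.
  apply: (@le_lt_trans _ _ (- (gam / 2) * fine (mu2 B))).
    apply: Rintegral_le_cst; first by apply: bfunB; exact: bv.
    move=> z Bz; have U0 := UB 0 z T0T Bz; have UT := UB T z TTT Bz; rewrite !vU//.
    have := kL _ _ U0 (seg _ T0T); have := kL _ _ UT (seg _ TTT).
    rewrite !addrK -/(p 0) -/(p T) !ler_norml => /andP[_ h1] /andP[h2 _].
    have h3 : K * `|z| <= gam / 4 by apply: le_trans rhoK; rewrite ler_wpM2l.
    have : k (p 0) = k z0 by rewrite /p scale0r addr0.
    have gE : gam = k z0 - k (p T) by [].
    by lra.
  by rewrite mulNr oppr_lt0 mulr_gt0// divr_gt0.
have C0 : 0 <= K * `|nu| * fine (mu2 B) by rewrite !mulr_ge0// ltW.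
apply: (mono_of_small_steps T0 C0 FL) => t eta delta t0 tT eta0 delta0.
have tTT : 0 <= t <= T by rewrite t0 ltW.
have dT : 0 < Num.min delta (T - t) by rewrite lt_min delta0 subr_gt0.
have [n0 Hn0] : exists n0 : nat, forall n, (n0 <= n)%N -> n.+1%:R^-1 < Num.min delta (T - t).
  have [n0 _ H] := near_infty_natSinv_lt (PosNum dT); exists n0 => n nn; exact: H.
(* The shift by [n0] keeps all steps shorter than both [delta] and [T - t], so that the quotients
   stay in the tube. *)
pose f_ n z := (n + n0).+1%:R * (v (z + p (t + (n + n0).+1%:R^-1)) - v (z + p t)).
have tn n : 0 <= t + (n + n0).+1%:R^-1 <= T.
  have := Hn0 (n + n0)%N (leq_addl _ _); rewrite lt_min => /andP[_ h].
  have : 0 <= ((n + n0).+1%:R^-1 : R) by rewrite invr_ge0.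
  by move: h t0; set q : R := _%:R^-1; clear => h ? ?; apply/andP; split; lra.
pose E : set (mpt R) := B `\` (fun z : pt => z + p t) @^-1` N.
have mNs : measurable ((fun z : pt => z + p t) @^-1` N : set (mpt R)).
  by rewrite -[X in measurable X]setTI; exact: (@measurable_shift2 R (p t)).
have Ns0 : mu2 ((fun z : pt => z + p t) @^-1` N) = 0%E by rewrite leb2_shift.
have mE : measurable E by exact: measurableD.
have EB : E `<=` B by move=> z [].
have fE : (mu2 E < +oo)%E by apply: le_lt_trans fB; apply: le_measure; rewrite ?inE.
have gE z : E z -> has_grad v (z + p t) (gradf v (z + p t)) /\ 0 <= dotp (gradf v (z + p t)) nu.
  move=> [Bz nNz]; have Ut := UB t z tTT Bz.
  have [g [Hg gnu]] : exists g, has_grad k (z + p t) g /\ 0 <= dotp g nu.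
    by apply: contrapT => h; apply: nNz; apply: HN.
  have /openP /(_ _ Ut)[r' r'0 Hr'] := oU.
  have Hv : has_grad v (z + p t) g.
    by apply: (has_grad_near r'0 _ Hg) => w /Hr' /vU.
  by rewrite (gradfE Hv).
have mf_ n : measurable_fun B (f_ n : mpt R -> R).
  by apply: measurable_funTS; apply: measurable_funM => //; apply: measurable_funB; exact: mvs.
have f_C n z : B z -> `|f_ n z| <= K * `|nu|.
  move=> Bz; rewrite /f_ normrM ger0_norm//.
  have := vL _ _ z (tn n) tTT Bz; rewrite [t + _]addrC addrK => h.
  apply: (le_trans (ler_wpM2l _ h)) => //.
  by rewrite ger0_norm ?invr_ge0// mulrCA mulfV ?mulr1// pnatr_eq0.
have f_cvg z : E z -> f_ ^~ z @ \oo --> dotp (gradf v (z + p t)) nu.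
  move=> /gE [Hg _]; have := @cvg_grad_dir R v _ _ nu Hg.
  rewrite -(cvg_shiftn n0) /f_ => h.
  rewrite (_ : (fun _ => _) = (fun n => (n + n0).+1%:R * (v (z + p t + (n + n0).+1%:R^-1 *: nu) - v (z + p t))))//.
  by apply/funext => n; congr (_ * (v _ - _)); rewrite /p scalerDl !addrA.
have cvI : (fun n => \int[mu2]_(z in E) f_ n z) @ \oo --> \int[mu2]_(z in E) dotp (gradf v (z + p t)) nu.
  apply: (@Rdominated E f_ _ (K * `|nu|)) => //.
  - by move=> n; exact: measurable_funS (mf_ n).
  - apply: (@measurable_fun_cvg _ (mpt R) R E f_) => //.
    by move=> n; exact: measurable_funS (mf_ n).
  - by move=> n z /EB; exact: f_C.
have I0 : 0 <= \int[mu2]_(z in E) dotp (gradf v (z + p t)) nu.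
  by apply: Rintegral_ge0 => z /gE[].
have [n Hn] : exists n, - eta < \int[mu2]_(z in E) f_ n z.
  have hneg : - eta < \int[mu2]_(z in E) dotp (gradf v (z + p t)) nu.
    by apply: lt_le_trans I0; rewrite oppr_lt0.
  by have [n _ /(_ n (leqnn n))] := cvgr_gt _ cvI _ hneg; exists n.
exists ((n + n0).+1%:R^-1).
  have := Hn0 (n + n0)%N (leq_addl _ _); rewrite lt_min => /andP[h _].
  by rewrite invr_gt0 ltr0n h.
have bf : bfun B (f_ n).
  by split=> //; exists (K * `|nu|) => z; exact: f_C.
move: Hn; rewrite -(Rintegral_null bf mNs Ns0) /f_ RintegralZl//; last first.
  by apply: bfun_integrable; apply: bfunB; exact: bv.
rewrite -FB// => Hn.
have i0 : 0 < ((n + n0).+1%:R^-1 : R) by rewrite invr_gt0 ltr0n.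
have := ltr_pM2l i0 (- eta) ((n + n0).+1%:R * (F (t + (n + n0).+1%:R^-1) - F t)).
rewrite Hn mulKf ?pnatr_eq0// mulrN; set q := _^-1; rewrite [q * eta]mulrC => h.
by rewrite -lerBrDl; apply: ltW; rewrite h.
Qed.

End BoundedIntegrals.

(** * Minimizers and their competitors *)

Section Competitors.
Variable R : realType.
Notation pt := (R * R)%type.
Local Notation mu2 := (@leb2 R).
Implicit Types (z w g d : pt).

(* Good stands for N° \ G: there sigma has a supporting plane touching it
   only at gradients that do not occur on F. *)
Record setting (Om F N Good : set pt) (sigma h : pt -> R) : Prop := Setting {
  s_open : open Om;
  s_bdd : exists M : R, forall z, Om z -> `|z| <= M;
  s_Fopen : open F;
  s_FOm : F `<=` Om;
  s_Nclosed : closed N;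
  s_Nconv : forall x y (t : R), N x -> N y -> 0 <= t <= 1 -> N ((1 - t) *: x + t *: y);
  s_Nhalf : forall p, ~ N p -> exists (nu : pt) (b : R),
    [/\ nu <> 0, dotp nu p < b & forall x, N x -> b <= dotp nu x];
  s_Gopen : open Good;
  s_GN : Good `<=` N;
  s_sconv : forall x y (t : R), N x -> N y -> 0 <= t <= 1 ->
    sigma ((1 - t) *: x + t *: y) <= (1 - t) * sigma x + t * sigma y;
  s_scont : {within N, continuous sigma};
  s_sbdd : exists M : R, forall x, N x -> `|sigma x| <= M;
  s_strict : forall p, Good p -> exists g0 : pt,
    (forall x, N x -> sigma p + dotp g0 (x - p) <= sigma x) /\
    (forall x, N x -> ~ Good x -> sigma p + dotp g0 (x - p) < sigma x);
  s_lip : exists2 K : R, 0 <= K & forall x y, closure Om x -> closure Om y -> `|h x - h y| <= K * `|x - y|;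
  s_ae : mu2.-negligible [set z | Om z /\ ~ exists g, has_grad h z g /\ N g];
  s_frozen : forall z x, F z -> has_grad h z x -> N x -> ~ Good x;
  s_min : forall u, Defs.lipschitz_on (closure Om) u ->
    mu2.-negligible [set z | Om z /\ ~ exists g, has_grad u z g /\ N g] ->
    (forall z, (closure Om `\` Om) z -> u z = h z) ->
    (energy sigma Om h <= energy sigma Om u)%E }.

Definition affv (q : pt * R) z : R := dotp q.1 z + q.2.
Definition maxaff (q0 : pt * R) (l : seq (pt * R)) z : R :=
  foldr (fun q m => Num.max (affv q z) m) (affv q0 z) l.

Lemma has_grad_cont (u : pt -> R) z g : has_grad u z g -> {for z, continuous u}.
Proof.
move=> /has_gradP H; apply/continuousP_norm => e e0.
have [d d0 Hd] := H 1 ltr01.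
have c0 : 0 < 2 * `|g| + 2 by rewrite ltr_wpDl// mulr_ge0.
exists (Num.min d (e / (2 * `|g| + 2))); first by rewrite lt_min d0 divr_gt0.
move=> w; rewrite lt_min => /andP[/Hd h1 h2].
have h3 := dotp_le g (w - z).
rewrite ltr_pdivlMr// in h2.
have : `|u w - u z| <= `|u w - u z - dotp g (w - z)| + `|dotp g (w - z)|.
  by rewrite -[in leLHS](subrK (dotp g (w - z)) (u w - u z)) ler_normD.
have := normr_ge0 (w - z); nra.
Qed.

Lemma cont_lt_near (u v : pt -> R) z : {for z, continuous u} -> {for z, continuous v} ->
  u z < v z -> exists2 r : R, 0 < r & forall w, `|w - z| < r -> u w < v w.
Proof.
move=> /continuousP_norm cu /continuousP_norm cv uv.
have e0 : 0 < (v z - u z) / 2 by rewrite divr_gt0// subr_gt0.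
have [d d0 Hd] := cu _ e0; have [d' d'0 Hd'] := cv _ e0.
exists (Num.min d d'); first by rewrite lt_min d0.
move=> w; rewrite lt_min => /andP[/Hd + /Hd'].
by rewrite !ltr_norml => /andP[h1 h2] /andP[h3 h4]; lra.
Qed.

Lemma has_grad_max (u v : pt -> R) z g g' : has_grad u z g -> has_grad v z g' ->
  (u z = v z -> g = g') ->
  has_grad (fun x => Num.max (u x) (v x)) z g \/ has_grad (fun x => Num.max (u x) (v x)) z g'.
Proof.
move=> Hu Hv uvg; have cu := has_grad_cont Hu; have cv := has_grad_cont Hv.
have [uv|vu|uv] := ltgtP (u z) (v z).
- right; have [r r0 Hr] := cont_lt_near cu cv uv.
  by apply: (has_grad_near r0 _ Hv) => w /Hr h; rewrite max_r// ltW.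
- left; have [r r0 Hr] := cont_lt_near cv cu vu.
  by apply: (has_grad_near r0 _ Hu) => w /Hr h; rewrite max_l// ltW.
- left; have E := uvg uv; subst g'.
  apply/has_gradP => e e0; move/has_gradP : Hu => Hu; move/has_gradP : Hv => Hv.
  have [d d0 Hd] := Hu e e0; have [d' d'0 Hd'] := Hv e e0.
  exists (Num.min d d'); first by rewrite lt_min d0.
  move=> w; rewrite lt_min => /andP[/Hd + /Hd']; rewrite uv maxxx.
  by case: (leP (u w) (v w)).
Qed.

Lemma affv_lip q z w : `|affv q z - affv q w| <= 2 * `|q.1| * `|z - w|.
Proof. by rewrite /affv opprD addrACA subrr addr0 -dotpBr dotp_le. Qed.

Lemma maxaff_lip q0 l : exists2 K, 0 <= K & forall z w, `|maxaff q0 l z - maxaff q0 l w| <= K * `|z - w|.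
Proof.
elim: l => [|q l [K K0 IH]].
  by exists (2 * `|q0.1|); [rewrite mulr_ge0|move=> z w; exact: affv_lip].
exists (2 * `|q.1| + K); first by rewrite addr_ge0// mulr_ge0.
move=> z w; rewrite /= -/(maxaff _ _ _) -/(maxaff _ _ _).
have := affv_lip q z w; have := IH z w; have n0 := normr_ge0 (z - w).
have h1 : 0 <= 2 * `|q.1| * `|z - w| by rewrite !mulr_ge0.
have h2 : 0 <= K * `|z - w| by rewrite mulr_ge0.
rewrite /maxaff; set a := affv q z; set b := affv q w; set c := foldr _ _ _; set e := foldr _ _ _.
rewrite mulrDl !ler_norml => /andP[h3 h4] /andP[h5 h6].
by case: (leP a c) => ac; case: (leP b e) => be; apply/andP; split; lra.
Qed.

Lemma maxaff_cont q0 l : continuous (maxaff q0 l).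
Proof. by have [K _ H] := maxaff_lip q0 l; exact: continuous_lip H. Qed.

(** Two planes of different slopes agree only on a null set, by [negligible_level] applied to the
    difference; off these ties one plane is active. *)
Lemma maxaff_grad q0 l : mu2.-negligible
  [set z | ~ exists2 q, q \in q0 :: l & has_grad (maxaff q0 l) z q.1].
Proof.
elim: l => [|q l IH].
  apply: negligibleS (negligible_set0 _) => z /=; apply.
  by exists q0; rewrite ?mem_head//; exact: has_grad_aff.
have cl : {within setT, continuous (fun z => affv q z - maxaff q0 l z)}.
  apply: continuous_subspaceT => z; apply: cvgB; last exact: maxaff_cont.
  exact: (has_grad_cont (@has_grad_aff R q.1 q.2 z)).
have := negligibleU IH (negligible_level openT cl).
apply: negligibleS => z nz; apply: contrapT => /not_orP[/contrapT[q' q'l Hq'] h]; apply: nz.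
have Hq : has_grad (affv q) z q.1 by exact: has_grad_aff.
have [|H|H] := has_grad_max Hq Hq'.
- move=> E; apply: contrapT => ne; apply: h; split=> //; first by rewrite E subrr.
  exists (q.1 - q'.1); split; first by have := has_gradD Hq (has_gradN Hq').
  by move/subr0_eq.
- by exists q; rewrite // !inE eqxx orbT.
- by exists q'; rewrite // !inE; move: q'l; rewrite inE => /orP[->|->]//; rewrite !orbT.
Qed.

Lemma has_grad0_dom (u f : pt -> R) z : (forall w, `|u w| <= `|f w|) -> f z = 0 ->
  has_grad f z 0 -> has_grad u z 0.
Proof.
move=> uf fz /has_gradP H; apply/has_gradP => e e0; have [d d0 Hd] := H e e0.
exists d => // w /Hd; rewrite dotp0l !subr0 fz subr0 => h.
have -> : u z = 0 by apply/eqP; rewrite -normr_le0 (le_trans (uf z))// fz normr0.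
by rewrite subr0 (le_trans (uf w)).
Qed.

Lemma setting_cont Om F N Good sigma h : setting Om F N Good sigma h ->
  {within closure Om, continuous h}.
Proof.
move=> S; have [K K0 hK] := s_lip S.
have K1 : 0 < K + 1 by rewrite ltr_wpDl.
apply/within_continuousP => z Oz e e0; exists (e / (K + 1)); first by rewrite divr_gt0.
move=> w Ow wz; apply: (le_lt_trans (hK _ _ Ow Oz)).
apply: (@le_lt_trans _ _ ((K + 1) * `|w - z|)); first by rewrite ler_wpM2r// lerDl.
by rewrite mulrC -ltr_pdivlMr.
Qed.

Lemma setting_contO Om F N Good sigma h : setting Om F N Good sigma h ->
  {within Om, continuous h}.
Proof. by move=> S; apply: continuous_subspaceW (setting_cont S); exact: subset_closure. Qed.

Lemma within_open_cont (A : set pt) (u : pt -> R) z : open A -> {within A, continuous u} -> A z ->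
  {for z, continuous u}.
Proof.
move=> oA /within_continuousP cu Az; apply/continuousP_norm => e e0.
have [d d0 Hd] := cu z Az e e0; have /openP /(_ _ Az)[r r0 Hr] := oA.
exists (Num.min d r); first by rewrite lt_min d0.
by move=> w; rewrite lt_min => /andP[wd /Hr Aw]; exact: Hd.
Qed.

Lemma measurable_comp_grad (sigma : pt -> R) (N : set pt) (D : set (mpt R)) (g : pt -> pt) :
  closed N -> {within N, continuous sigma} -> measurable D ->
  (forall d, measurable_fun D (fun z : mpt R => dotp (g z) d)) -> (forall z, D z -> N (g z)) ->
  measurable_fun D (fun z : mpt R => sigma (g z)).
Proof.
move=> cN cs mD mg gN.
have mN : measurable (N : set (mpt R)) by exact: closed_measurable2.
have mgp : measurable_fun D (fun z : mpt R => g z : mpt R).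
  have m1 : measurable_fun setT ((fun z : mpt R => dotp (g z) (1, 0)) \_ D).
    have := (@measurable_restrict _ _ (mpt R) R D setT (fun z => dotp (g z) (1, 0)) mD measurableT).
    by rewrite setTI => -[h _]; apply: h; exact: mg.
  have m2 : measurable_fun setT ((fun z : mpt R => dotp (g z) (0, 1)) \_ D).
    have := (@measurable_restrict _ _ (mpt R) R D setT (fun z => dotp (g z) (0, 1)) mD measurableT).
    by rewrite setTI => -[h _]; apply: h; exact: mg.
  have := measurable_funTS (D := D) (measurable_fun_pair m1 m2).
  apply: eq_measurable_fun => z zD; rewrite !patchE zD /dotp /= !mulr0 !mulr1 addr0 add0r.
  by rewrite -surjective_pairing.
apply: (@measurable_comp _ _ _ (mpt R) (mpt R) R N sigma D (fun z => g z)) => //.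
  by move=> _ [z Dz <-]; exact: gN.
exact: within_continuous_closed_measurable.
Qed.

Lemma lipschitz_onP (A : set pt) (u : pt -> R) (K : R) :
  (forall x y, A x -> A y -> `|u x - u y| <= K * `|x - y|) -> Defs.lipschitz_on A u.
Proof.
move=> H; exists `|K| => x y Ax Ay; apply: (le_trans (H _ _ Ax Ay)).
apply: (@le_trans _ _ (`|K| * `|x - y|)); first by rewrite ler_wpM2r// ler_norm.
by rewrite ler_wpM2l// enorm_ge.
Qed.

Lemma grad_dir_le (u : pt -> R) (U : set pt) (K : R) z g d : open U ->
  (forall x y, U x -> U y -> `|u x - u y| <= K * `|x - y|) -> U z -> has_grad u z g ->
  dotp g d <= K * `|d|.
Proof.
move=> oU uK Uz Hg; rewrite leNgt; apply/negP => h.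
have [tau tau0 Ht] := grad_dir Hg h; have /openP /(_ _ Uz)[r r0 Hr] := oU.
have d1 : 0 < `|d| + 1 by rewrite ltr_wpDl.
pose t := Num.min (tau / 2) (r / 2 / (`|d| + 1)).
have t0 : 0 < t by rewrite lt_min !divr_gt0.
have tt : t < tau by rewrite /t gt_min; apply/orP; left; lra.
have tr : t * (`|d| + 1) <= r / 2 by rewrite -ler_pdivlMr// ge_min lexx orbT.
have E : `|z + t *: d - z| = t * `|d| by rewrite addrC addKr normrZ gtr0_norm.
have Uz' : U (z + t *: d).
  by apply: Hr; rewrite E; rewrite mulrDr in tr; lra.
have := uK _ _ Uz' Uz; rewrite E ler_norml => /andP[_ h1].
have := Ht t; rewrite t0 tt => /(_ isT); lra.
Qed.

(** * Cutting the minimizer down to a maximum of planes *)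

Section Cut.
Variables (Om F N Good : set pt) (sigma h : pt -> R).
Hypothesis S : setting Om F N Good sigma h.
Variables (W : set pt) (q0 : pt * R) (l : seq (pt * R)).
Hypotheses (oW : open W) (WOm : closure W `<=` Om)
  (slN : forall q, q \in q0 :: l -> N q.1)
  (bdW : forall z, closure W z -> ~ W z -> h z <= maxaff q0 l z).

Let psi := maxaff q0 l.
Let A : set pt := [set z | W z /\ psi z < h z].
(** The amount cut off, [(h - psi)^+], set to zero outside [W]. As [h <= psi] on the boundary of
    [W], the truncation creates no jump. *)
Let om z : R := if `[< W z >] then Num.max (h z - psi z) 0 else 0.

Let WsubOm : W `<=` Om. Proof. by move=> z Wz; apply: WOm; exact: subset_closure. Qed.

Let contOm z : Om z -> {for z, continuous h}.
Proof. exact: within_open_cont (s_open S) (setting_contO S). Qed.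

Let oA : open A.
Proof.
apply/openP => z [Wz hz].
have [r r0 Hr] := cont_lt_near (@maxaff_cont q0 l z) (contOm (WsubOm Wz)) hz.
have /openP /(_ _ Wz)[r' r'0 Hr'] := oW.
exists (Num.min r r'); first by rewrite lt_min r0.
by move=> w; rewrite lt_min => /andP[/Hr ? /Hr' ?].
Qed.

Let om_dom z : `|om z| <= `|h z - psi z|.
Proof.
rewrite /om; case: asboolP => _; last by rewrite normr0.
case: (leP (h z - psi z) 0) => //; by rewrite normr0.
Qed.

Let om_out z : ~ W z -> om z = 0.
Proof. by rewrite /om => nW; case: asboolP. Qed.

(** Between a point of [W] and a point outside, the segment meets the boundary of [W], where
    [h - psi <= 0]. Comparing with that exit point bounds the positive part by the Lipschitz
    constants of [h] and [psi]. *)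
Let om_lip : exists2 K, 0 <= K & forall z z', `|om z - om z'| <= K * `|z - z'|.
Proof.
have [K1 K10 H1] := s_lip S; have [K2 K20 H2] := maxaff_lip q0 l.
have K120 : 0 <= K1 + K2 by exact: addr_ge0.
exists (K1 + K2) => // z z'.
have cW x : W x -> closure Om x by move=> /WsubOm; exact: subset_closure.
have D x y : closure Om x -> closure Om y ->
    `|(h x - psi x) - (h y - psi y)| <= (K1 + K2) * `|x - y|.
  move=> Ox Oy; have := H1 _ _ Ox Oy; have := H2 x y; rewrite -/psi => h2 h1.
  have -> : h x - psi x - (h y - psi y) = (h x - h y) - (psi x - psi y) by ring.
  by rewrite (le_trans (ler_normB _ _))// mulrDl lerD.
have half x y : W x -> ~ W y -> `|om x - om y| <= (K1 + K2) * `|x - y|.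
  move=> Wx nWy; rewrite (om_out nWy) subr0.
  have [t [/andP[t0 t1] ct nt _]] := seg_exit oW Wx nWy.
  set v := affc x y t in ct nt.
  have := D x v (cW _ Wx) (subset_closure (WOm ct)); have := bdW ct nt; rewrite -/psi => hv.
  have xv : `|x - v| <= `|x - y|.
    rewrite /v affcE opprD addNKr; rewrite normrN normrZ ger0_norm// distrC.
    by rewrite ler_piMl.
  have : (K1 + K2) * `|x - v| <= (K1 + K2) * `|x - y| by rewrite ler_wpM2l.
  rewrite /om asboolT// ler_norml => h1 /andP[h2 h3].
  case: (leP (h x - psi x) 0) => h4; first by rewrite normr0 mulr_ge0.
  by rewrite gtr0_norm//; lra.
have [Wz|nWz] := pselect (W z); have [Wz'|nWz'] := pselect (W z').
- have := D _ _ (cW _ Wz) (cW _ Wz'); rewrite /om !asboolT//.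
  set a := h z - psi z; set b := h z' - psi z'; rewrite !ler_norml => /andP[h1 h2].
  by case: (leP a 0) => a0; case: (leP b 0) => b0; apply/andP; split; lra.
- exact: half.
- by rewrite distrC [`|z - z'|]distrC; exact: half.
- by rewrite !om_out// subrr normr0 mulr_ge0.
Qed.

(** The last clause makes the gradient of [h - psi] vanish at contact points, so that its positive
    part is differentiable there. It fails only on a null set, again by [negligible_level]. *)
Let good := [set z | [/\ Om z, exists g, has_grad h z g /\ N g,
  exists2 q, q \in q0 :: l & has_grad psi z q.1 &
  h z = psi z -> forall g g', has_grad h z g -> has_grad psi z g' -> g = g']].

Let good_ae : mu2.-negligible (Om `\` good).
Proof.
have cl : {within Om, continuous (fun z => h z - psi z)}.
  apply/within_continuousP => z Oz e e0; have e2 : 0 < e / 2 by rewrite divr_gt0.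
  have /within_continuousP /(_ z Oz _ e2)[d d0 Hd] := setting_contO S.
  have /continuousP_norm /(_ _ e2)[d' d'0 Hd'] := @maxaff_cont q0 l z.
  exists (Num.min d d'); first by rewrite lt_min d0.
  move=> w Ow; rewrite lt_min => /andP[/(Hd _ Ow) h1 /Hd' h2].
  have -> : h w - psi w - (h z - psi z) = (h w - h z) - (psi w - psi z) by ring.
  by rewrite (le_lt_trans (ler_normB _ _))//; rewrite /psi in h2 *; lra.
have := negligibleU (negligibleU (s_ae S) (maxaff_grad q0 l)) (negligible_level (s_open S) cl).
apply: negligibleS => z [Oz nz]; apply: contrapT => /not_orP[/not_orP[h1 h2] h3]; apply: nz.
have {}h1 : exists g, has_grad h z g /\ N g by apply: contrapT => h'; apply: h1.
have {}h2 : exists2 q, q \in q0 :: l & has_grad psi z q.1 by apply: contrapT => h'; apply: h2.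
split=> // E g g' Hg Hg'; apply: contrapT => ne; apply: h3; split=> //.
  by rewrite E subrr.
exists (g - g'); split; first exact: (has_gradD Hg (has_gradN Hg')).
by move/subr0_eq.
Qed.

Let gradh_out z : good z -> ~ A z -> has_grad om z 0.
Proof.
move=> [Oz [g [Hg _]] [q _ Hq] E] nA.
have zero r : 0 < r -> (forall w, `|w - z| < r -> om w = 0) -> has_grad om z 0.
  move=> r0 Hr; apply: (has_grad_near r0 _ (@has_grad_cst R 0 z)) => w /Hr ->//.
have [lt|gt|eq] := ltgtP (h z) (psi z).
- have [r r0 Hr] := cont_lt_near (has_grad_cont Hg) (has_grad_cont Hq) lt.
  apply: (zero r r0) => w /Hr hw; rewrite /om; case: asboolP => // _.
  by rewrite max_r// subr_le0 ltW.
- have nW : ~ W z by move=> Wz; apply: nA.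
  have nc : ~ closure W z by move=> cW; have := bdW cW nW; rewrite -/psi leNgt gt.
  have : exists2 r : R, 0 < r & forall w, `|w - z| < r -> ~ W w.
    apply: contrapT => H; apply: nc; apply/closureP => r r0; apply: contrapT => H'.
    by apply: H; exists r => // w wz Ww; apply: H'; exists w.
  by move=> [r r0 Hr]; apply: (zero r r0) => w /Hr /om_out.
- have gE := E eq _ _ Hg Hq.
  apply: (@has_grad0_dom om (fun w => h w - psi w)) => //; first by rewrite eq subrr.
  by have := has_gradD Hg (has_gradN Hq); rewrite gE subrr.
Qed.

Let grad_in z g g' : A z -> has_grad h z g -> has_grad psi z g' -> has_grad om z (g - g').
Proof.
move=> Az Hg Hg'; have /openP /(_ _ Az)[r r0 Hr] := oA.
apply: (has_grad_near r0 _ (has_gradD Hg (has_gradN Hg'))) => w /Hr [Ww hw].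
by rewrite /om asboolT// max_l// subr_ge0 ltW.
Qed.

(* First variation along the competitor h - t * (h - psi)^+, truncated to W. *)
Lemma cut_energy (t : R) : 0 <= t <= 1 -> exists (E : set (mpt R)) (gh gp : pt -> pt),
  [/\ measurable E, E `<=` A, mu2.-negligible (A `\` E),
    forall z, E z -> [/\ has_grad h z (gh z), N (gh z) & exists2 q, q \in q0 :: l & gp z = q.1] &
    [/\ bfun E (fun z => sigma (gh z)),
      bfun E (fun z => sigma ((1 - t) *: gh z + t *: gp z)),
      forall d, bfun E (fun z => dotp (gp z - gh z) d),
      forall d, \int[mu2]_(z in E) dotp (gp z - gh z) d = 0 &
      \int[mu2]_(z in E) sigma (gh z) <= \int[mu2]_(z in E) sigma ((1 - t) *: gh z + t *: gp z)]].
Proof.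
move=> t01; have /andP[t0 t1] := t01.
have [B [mB B0 HB]] := good_ae.
pose D : set (mpt R) := Om `\` B.
have mOm : measurable (Om : set (mpt R)) by exact: open_measurable2 (s_open S).
have mD : measurable D by exact: measurableD.
have Dgood z : D z -> good z.
  by move=> [Oz nB]; apply: contrapT => ng; apply: nB; apply: HB.
have DOm : D `<=` Om by move=> z [].
have mA : measurable (A : set (mpt R)) by exact: open_measurable2.
pose E : set (mpt R) := A `&` D.
have mE : measurable E by exact: measurableI.
have EA : E `<=` A by move=> z [].
have ED : E `<=` D by move=> z [].
pose gh := gradf h; pose gp := gradf psi.
have ghE z : D z -> has_grad h z (gh z) /\ N (gh z).
  by move=> /Dgood[_ [g [Hg Ng]] _ _]; rewrite /gh (gradfE Hg).
have gpE z : D z -> has_grad psi z (gp z) /\ exists2 q, q \in q0 :: l & gp z = q.1.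
  by move=> /Dgood[_ _ [q ql Hq] _]; rewrite /gp (gradfE Hq); split=> //; exists q.
have gpN z : D z -> N (gp z) by move=> /gpE[_ [q ql ->]]; exact: slN.
have [M HM] := s_bdd S.
have fD : (mu2 D < +oo)%E.
  by apply: (@leb2_bounded_lty _ _ M) => // z /DOm; exact: HM.
have mgh d : measurable_fun D (fun z : mpt R => dotp (gh z) d).
  apply: (measurable_grad d (s_open S) (setting_contO S)) => // z /ghE[]//.
have mgp d : measurable_fun D (fun z : mpt R => dotp (gp z) d).
  apply: (@measurable_grad R psi setT D gp d openT) => //.
    by apply: continuous_subspaceT; exact: maxaff_cont.
  by move=> z /gpE[].
(* The competitor has gradient [(1 - t) gh + t gp] on [A] and [gh] elsewhere. Both values lie in [N]
   by convexity, so it is admissible. *)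
pose ind z : R := if `[< A z >] then t else 0.
have ind01 z : 0 <= ind z <= 1 by rewrite /ind; case: ifP => _ //; rewrite lexx ler01.
have mind : measurable_fun D (fun z : mpt R => ind z).
  apply: measurable_funTS; apply: measurable_fun_ifT => //.
  by apply: (measurable_fun_bool true); rewrite setTI (_ : _ @^-1` _ = A)//;
    apply/seteqP; split=> z /=; [move/asboolP|move=> Az; apply/asboolP].
pose gv z := (1 - ind z) *: gh z + ind z *: gp z.
have gvN z : D z -> N (gv z).
  by move=> Dz; apply: (s_Nconv S) => //; [exact: (ghE z Dz).2|exact: gpN].
have mgv d : measurable_fun D (fun z : mpt R => dotp (gv z) d).
  rewrite (_ : (fun _ => _) = (fun z : mpt R => (1 - ind z) * dotp (gh z) d + ind z * dotp (gp z) d)).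
    by apply: measurable_funD; apply: measurable_funM => //; apply: measurable_funB.
  by apply/funext => z; rewrite dotpDl !dotpZl.
have [Ms HMs] := s_sbdd S.
have bgh : bfun D (fun z => sigma (gh z)).
  split=> //; last by exists Ms => z /ghE[_ /HMs].
  by apply: (measurable_comp_grad (s_Nclosed S) (s_scont S)) => // z /ghE[].
have bgv : bfun D (fun z => sigma (gv z)).
  split=> //; last by exists Ms => z /gvN /HMs.
  by apply: (measurable_comp_grad (s_Nclosed S) (s_scont S)).
pose v z := h z - t * om z.
have Hgv z : D z -> has_grad v z (gv z).
  move=> Dz; have [Hh _] := ghE z Dz; have [Hp _] := gpE z Dz.
  rewrite /gv /ind; case: asboolP => Az.
    have := has_gradD Hh (has_gradN (has_gradZ t (grad_in Az Hh Hp))).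
    rewrite (_ : gh z + _ = (1 - t) *: gh z + t *: gp z)//.
    by rewrite scalerBr scalerBl scale1r opprB [t *: gp z - _]addrC addrA.
  have := has_gradD Hh (has_gradN (has_gradZ t (gradh_out (Dgood z Dz) Az))).
  by rewrite scaler0 oppr0 subr0 scale1r scale0r.
have [Ko Ko0 HKo] := om_lip.
have vmin : (energy sigma Om h <= energy sigma Om v)%E.
  apply: (s_min S).
  - have [K K0 HK] := s_lip S.
    apply: (@lipschitz_onP _ _ (K + Ko)) => x y Ox Oy.
    have := HK x y Ox Oy; have := HKo x y => h1 h2.
    have -> : v x - v y = (h x - h y) - t * (om x - om y) by rewrite /v; ring.
    rewrite (le_trans (ler_normB _ _))// mulrDl lerD// normrM ger0_norm//.
    by apply: le_trans h1; rewrite ler_piMl.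
  - exists B; split=> // z [Oz nz]; apply: contrapT => nB; apply: nz.
    by exists (gv z); split; [apply: Hgv|apply: gvN].
  - move=> z [_ nOz]; rewrite /v om_out ?mulr0 ?subr0//.
    by move=> /WsubOm.
have en u : energy sigma Om u = (\int[mu2]_(z in D) (sigma (gradf u z))%:E)%E.
  apply: (@eq_integral_null _ _ _ mu2 Om D B) => // z nB.
  rewrite !patchE; have [Oz|nOz] := boolP (z \in Om).
    by rewrite (_ : z \in D)// inE; split=> //; exact: set_mem.
  by rewrite (_ : z \in D = false)//; apply/negbTE; rewrite notin_setE => -[/mem_set]; rewrite (negbTE nOz).
have gvE z : D z -> gradf v z = gv z by move=> /Hgv /gradfE.
have IDle : \int[mu2]_(z in D) sigma (gh z) <= \int[mu2]_(z in D) sigma (gv z).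
  have : (\int[mu2]_(z in D) (sigma (gh z))%:E <= \int[mu2]_(z in D) (sigma (gv z))%:E)%E.
    rewrite -en (le_trans vmin)// en le_eqVlt; apply/orP; left; apply/eqP.
    by apply: eq_integral => z /set_mem /gvE ->.
  rewrite -(fineK (integrable_fin_num mD (bfun_integrable bgh))).
  by rewrite -(fineK (integrable_fin_num mD (bfun_integrable bgv))) lee_fin.
have DE : D = E `|` (D `\` A).
  apply/seteqP; split=> z; last by move=> [[]//|[]].
  by have [Az|nAz] := pselect (A z); [left|right].
have mDA : measurable (D `\` A) by exact: measurableD.
have disj : [disjoint E & D `\` A].
  by apply/disj_setPS => z [[Az _] [_ nAz]].
have gvA z : A z -> gv z = (1 - t) *: gh z + t *: gp z by move=> Az; rewrite /gv /ind asboolT.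
have bE : bfun E (fun z => sigma (gv z)) by exact: bfunS bgv mE ED.
have bgE d : bfun E (fun z => dotp (gp z - gh z) d).
  split; [exact: mE| | |].
  - by apply: le_lt_trans fD; apply: le_measure; rewrite ?inE.
  - rewrite (_ : (fun _ => _) = (fun z : mpt R => dotp (gp z) d - dotp (gh z) d)).
      by apply: measurable_funB; apply: measurable_funS ED _.
    by apply/funext => z; rewrite dotpBl.
  - have [K K0 HK] := s_lip S; have [K2 K20 HK2] := maxaff_lip q0 l.
    have HKO x y : Om x -> Om y -> `|h x - h y| <= K * `|x - y|.
      by move=> Ox Oy; apply: HK; exact: subset_closure.
    exists ((K2 + K) * `|d|) => z /ED Dz; have [Hh _] := ghE z Dz; have [Hp _] := gpE z Dz.
    have h1 d' := grad_dir_le d' (s_open S) HKO (DOm _ Dz) Hh.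
    have h2 d' := grad_dir_le d' openT (fun x y _ _ => HK2 x y) I Hp.
    have := h1 d; have := h1 (- d); have := h2 d; have := h2 (- d).
    rewrite !dotpNr !normrN dotpBl mulrDl ler_norml => ? ? ? ?.
    by apply/andP; split; lra.
exists E, gh, gp; split; [exact: mE|exact: EA| | |].
- apply: (@negligibleS _ _ _ _ B); last by exists B; split.
  move=> z [Az nE]; apply: contrapT => nB; apply: nE; split=> //; split=> //.
  by case: Az => /WsubOm.
- by move=> z /ED Dz; have [? ?] := ghE z Dz; have [_ ?] := gpE z Dz.
- split; [| |exact: bgE| |].
  + exact: bfunS bgh mE ED.
  + have [? ? mf ?] := bE; split=> //.
      by apply: eq_measurable_fun mf => z /set_mem /EA /gvA ->.
    by exists Ms => z Ez; rewrite -gvA; [exact/HMs/gvN/ED|exact: EA].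
  + move=> d; have M0 : 0 <= `|M| by [].
    have omM z : `|M| < `|z| -> om z = 0.
      move=> Mz; apply: om_out => /WsubOm /HM zM; have := ler_norm M.
      by move=> h'; have := lt_le_trans Mz zM; rewrite ltNge h'.
    (* The bound comes from the Lipschitz constant and the point [(|M| + 1, 0)], where [om] vanishes
       because [Om] does not reach it. *)
    have omC z : `|om z| <= Ko * (2 * `|M| + 1).
      have [zM|zM] := leP `|z| `|M|; last first.
        by rewrite omM// normr0 mulr_ge0// addr_ge0// mulr_ge0.
      have := HKo z (`|M| + 1, 0).
      have nv : `|(`|M| + 1, 0) : pt| = `|M| + 1.
        by rewrite normE /= normr0 max_l// ger0_norm// addr_ge0.
      rewrite (omM (`|M| + 1, 0)) ?nv ?ltrDl// subr0 => h1; apply: (le_trans h1).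
      rewrite ler_wpM2l//; have := ler_normB z (`|M| + 1, 0); rewrite nv; lra.
    have Hom z : E z -> has_grad om z (gh z - gp z).
      by move=> [Az Dz]; apply: grad_in => //; [have [] := ghE z Dz|have [] := gpE z Dz].
    have Hout : mu2.-negligible [set z | ~ E z /\ ~ has_grad om z 0].
      exists B; split=> // z [nE nH]; apply: contrapT => nB; apply: nH.
      have [Oz|nOz] := pselect (Om z).
        have Dz : D z by [].
        by apply: gradh_out (Dgood z Dz) _ => Az; apply: nE.
      have nc : ~ closure W z by move=> /WOm.
      have : exists2 r : R, 0 < r & forall w, `|w - z| < r -> ~ W w.
        apply: contrapT => H; apply: nc; apply/closureP => r r0; apply: contrapT => H'.
        by apply: H; exists r => // w wz Ww; apply: H'; exists w.
      move=> [r r0 Hr]; apply: (has_grad_near r0 _ (@has_grad_cst R 0 z)) => w /Hr nW.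
      by rewrite om_out.
    have := @grad_int0 R om Ko _ _ E _ (- d) Ko0 M0 HKo omC omM Hom Hout.
    move=> <-; apply: eq_Rintegral => z _; rewrite dotpNr -dotpNl opprB//.
  + have := IDle; rewrite DE !Rintegral_setU//; last 2 first.
    * by rewrite -DE; exact: bfun_integrable.
    * by rewrite -DE; exact: bfun_integrable.
    have -> : \int[mu2]_(z in D `\` A) sigma (gv z) = \int[mu2]_(z in D `\` A) sigma (gh z).
      apply: eq_Rintegral => z /set_mem[_ nA].
      by rewrite /gv /ind asboolF// subr0 scale1r scale0r addr0.
    rewrite lerD2r => /le_trans; apply; rewrite le_eqVlt; apply/orP; left; apply/eqP.
    by apply: eq_Rintegral => z /set_mem /EA /gvA ->.
Qed.

(* D x p is the gain in energy density, up to the null Lagrangian g0. *)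
Lemma cut_contra (U : set pt) (t a c : R) (g0 : pt)
  (D := fun x p => sigma ((1 - t) *: x + t *: p) - sigma x - dotp g0 (p - x)) :
  0 <= t <= 1 -> open U -> U !=set0 -> U `<=` A -> 0 <= a -> 0 < c ->
  (forall z x q, A z -> has_grad h z x -> N x -> q \in q0 :: l -> D x q.1 <= a) ->
  (forall z x q, U z -> has_grad h z x -> N x -> q \in q0 :: l -> D x q.1 <= - c) ->
  a * fine (mu2 A) < c * fine (mu2 U) -> False.
Proof.
move=> t01 oU U0 UA a0 c0 Da Dc ac.
have arith (x y u m m' : R) : 0 <= x + y -> x <= - u -> y <= m -> m <= m' -> m' < u -> False by lra.
have [E [gh [gp [mE EA AE EP [b1 b2 b3 I0 Ile]]]]] := cut_energy t01.
have mU : measurable (U : set (mpt R)) by exact: open_measurable2.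
have mA : measurable (A : set (mpt R)) by exact: open_measurable2.
have [M HM] := s_bdd S.
have fA : (mu2 A < +oo)%E.
  by apply: (@leb2_bounded_lty _ _ M) => // z [/WsubOm /HM].
have fE : (mu2 E < +oo)%E by case: b1.
pose f z := sigma ((1 - t) *: gh z + t *: gp z) - sigma (gh z) - dotp (gp z - gh z) g0.
have bf : bfun E f by apply: bfunB => //; exact: bfunB.
have If : 0 <= \int[mu2]_(z in E) f z.
  have := @RintegralB _ _ _ mu2 E (fun z => sigma ((1 - t) *: gh z + t *: gp z) - sigma (gh z))
    (fun z => dotp (gp z - gh z) g0) mE (bfun_integrable (bfunB b2 b1)) (bfun_integrable (b3 g0)).
  have := @RintegralB _ _ _ mu2 E (fun z => sigma ((1 - t) *: gh z + t *: gp z))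
    (fun z => sigma (gh z)) mE (bfun_integrable b2) (bfun_integrable b1).
  by move=> I2; rewrite I0 subr0 I2 /f => ->; rewrite subr_ge0.
have EU : E = (E `&` U) `|` (E `\` U).
  apply/seteqP; split=> z; last by move=> [[]|[]].
  by have [Uz|nUz] := pselect (U z); [left|right].
have mEU : measurable (E `&` U) by exact: measurableI.
have mED : measurable (E `\` U) by exact: measurableD.
have disj : [disjoint E `&` U & E `\` U] by apply/disj_setPS => z [[_ Uz] [_]].
have i1 : \int[mu2]_(z in E `&` U) f z <= - c * fine (mu2 (E `&` U)).
  apply: Rintegral_le_cst; first by apply: bfunS bf mEU _ => z [].
  move=> z [Ez Uz]; have [Hh Nh [q ql gq]] := EP z Ez.
  by rewrite /f gq dotpC; exact: Dc Uz Hh Nh ql.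
have i2 : \int[mu2]_(z in E `\` U) f z <= a * fine (mu2 (E `\` U)).
  apply: Rintegral_le_cst; first by apply: bfunS bf mED _ => z [].
  move=> z [Ez _]; have [Hh Nh [q ql gq]] := EP z Ez.
  by rewrite /f gq dotpC; exact: Da (EA _ Ez) Hh Nh ql.
have m1 : fine (mu2 (E `\` U)) <= fine (mu2 A).
  have EUA : E `\` U `<=` A by move=> z [/EA].
  have le1 : (mu2 (E `\` U) <= mu2 A)%E by apply: le_measure; rewrite ?inE.
  have f2 : mu2 A \is a fin_num by rewrite ge0_fin_numE.
  have f1 : mu2 (E `\` U) \is a fin_num.
    by rewrite ge0_fin_numE; [exact: le_lt_trans le1 fA|exact: measure_ge0].
  exact: fine_le.
(* [E] exhausts [A] up to a null set, so the gain is collected on the full measure of [U]. *)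
have m2 : mu2 (E `&` U) = mu2 U.
  have [B [mB B0 HB]] := AE.
  apply/le_anti/andP; split; first by apply: le_measure; rewrite ?inE// => z [].
  apply: (@le_trans _ _ (mu2 ((E `&` U) `|` B))).
    apply: le_measure; rewrite ?inE//; first exact: measurableU.
    move=> z Uz; have [Ez|nE] := pselect (E z); first by left.
    by right; apply: HB; split=> //; exact: UA.
  have h2 := @measureU2 _ _ _ (leb2 (R:=R)) _ _ mEU mB.
  have h3 : (mu2 (E `&` U) + mu2 B <= mu2 (E `&` U))%E by rewrite B0 adde0.
  exact: (le_trans h2 h3).
move: If; rewrite EU Rintegral_setU//; last by rewrite -EU; exact: bfun_integrable.
rewrite m2 mulNr in i1 => If'; apply: (arith _ _ _ _ _ If' i1 i2 _ ac).
by rewrite ler_wpM2l.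
Qed.

End Cut.

End Competitors.

(** * Touching from above *)

Section Touching.
Variable R : realType.
Notation pt := (R * R)%type.
Local Notation mu2 := (@leb2 R).
Implicit Types (z w g d p : pt).

Lemma maxaff_ge q0 l q z : q \in q0 :: l -> affv q z <= maxaff q0 l z.
Proof.
elim: l => [|q' l IH]; first by rewrite inE => /eqP->.
rewrite !inE /= orbCA => /orP[/eqP->|h]; first by rewrite le_max lexx.
by rewrite le_max IH ?orbT// inE.
Qed.

Lemma maxaff_lt q0 l z (c : R) : (forall q, q \in q0 :: l -> affv q z < c) -> maxaff q0 l z < c.
Proof.
elim: l => [|q' l IH] H /=; first by apply: H; rewrite mem_head.
rewrite gt_max H ?inE ?eqxx ?orbT//=; apply: IH => q; rewrite inE => /orP[|] h; apply: H.
  by rewrite inE h.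
by rewrite !inE h !orbT.
Qed.

Lemma open_half g (c : R) : open [set z | dotp g z < c].
Proof.
apply/openP => z /= gz.
have c1 : 0 < 2 * `|g| + 1 by rewrite ltr_wpDl// mulr_ge0.
exists ((c - dotp g z) / (2 * `|g| + 1)); first by rewrite divr_gt0// subr_gt0.
move=> w; rewrite ltr_pdivlMr// => h.
have := dotp_le g (w - z); rewrite dotpBr ler_norml => /andP[_].
have := normr_ge0 (w - z); nra.
Qed.

Lemma closed_half g (c : R) : closed [set z | dotp g z <= c].
Proof.
rewrite (_ : [set z | _] = ~` [set z | dotp (- g) z < - c]); first exact/open_closedC/open_half.
by apply/seteqP; split=> z /=; rewrite dotpNl ltrN2 => h; [apply/negP|move/negP : h]; rewrite -leNgt.
Qed.

Lemma grad_norm_le (u : pt -> R) (U : set pt) (K : R) z g : open U ->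
  (forall x y, U x -> U y -> `|u x - u y| <= K * `|x - y|) -> U z -> has_grad u z g -> `|g| <= K.
Proof.
move=> oU uK Uz Hg; have H d := grad_dir_le d oU uK Uz Hg.
have n1 : `|(1, 0) : pt| = 1 by rewrite normE /= normr0 normr1 max_l.
have n2 : `|(0, 1) : pt| = 1 by rewrite normE /= normr0 normr1 max_r.
have := H (1, 0); have := H (- (1, 0)); have := H (0, 1); have := H (- (0, 1)).
rewrite !normrN !n1 !n2 !dotpNr /dotp /= !mulr0 !mulr1 !addr0 !add0r => h1 h2 h3 h4.
by apply/norm_leP; rewrite !ler_norml; split; apply/andP; split; lra.
Qed.

Lemma open_ball_norm z (r : R) : open [set w : pt | `|w - z| < r].
Proof.
apply/openP => w /= wz; exists (r - `|w - z|); first by rewrite subr_gt0.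
by move=> v vw; have := ler_distD w v z; lra.
Qed.

Lemma closed_ball_norm z (r : R) : closed [set w : pt | `|w - z| <= r].
Proof.
apply/closedP => w H /=; apply/ler_addgt0Pr => e /H[v /= vz vw].
by have := ler_distD v w z; rewrite [`|w - v|]distrC; lra.
Qed.

Lemma ball_measure_gt0 z (r : R) : 0 < r -> 0 < fine (mu2 [set w : pt | `|w - z| < r]).
Proof.
move=> r0; have oB := @open_ball_norm z r.
have B0 : [set w : pt | `|w - z| < r] !=set0 by exists z; rewrite /= subrr normr0.
apply: fine_gt0; rewrite (leb2_open_gt0 oB B0) /=.
apply: (@leb2_bounded_lty _ _ (`|z| + r)); first exact: open_measurable2.
by move=> w /= zr; have := ler_normD z (w - z); rewrite addrC subrK; lra.
Qed.

Section InSetting.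
Variables (Om F N Good : set pt) (sigma h : pt -> R).
Hypothesis S : setting Om F N Good sigma h.

Lemma setting_lipO : exists2 K, 0 <= K & forall x y, Om x -> Om y -> `|h x - h y| <= K * `|x - y|.
Proof.
by have [K K0 H] := s_lip S; exists K => // x y Ox Oy; apply: H; exact: subset_closure.
Qed.

Lemma setting_contz z : Om z -> {for z, continuous h}.
Proof. exact: within_open_cont (s_open S) (setting_contO S). Qed.

(** Subtracting the linear function with slope [(b / |nu|^2) nu] reduces the claim to [mono_dir]:
    the remaining gradient has nonnegative product with [nu] almost everywhere. *)
Lemma setting_mono nu (b : R) z (T : R) : nu <> 0 -> (forall x, N x -> b <= dotp nu x) -> 0 <= T ->
  (forall t, 0 <= t <= T -> Om (z + t *: nu)) -> h z + T * b <= h (z + T *: nu).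
Proof.
move=> nu0 Nb T0 seg.
have nn : dotp nu nu != 0.
  rewrite -enorm_sqr expf_eq0 /= enorm_eq0; exact/eqP.
pose g := (b / dotp nu nu) *: nu.
have gnu : dotp g nu = b by rewrite dotpZl divfK.
have [K K0 HK] := setting_lipO.
pose k z := h z - dotp g z.
have := @mono_dir R k Om (K + 2 * `|g|) nu z T (s_open S) _ _ _ T0 seg.
rewrite /k dotpDr dotpZr gnu => H.
suff : h z - dotp g z <= h (z + T *: nu) - (dotp g z + T * b) by lra.
apply: H.
- by rewrite addr_ge0// mulr_ge0.
- move=> x y Ox Oy; have := HK x y Ox Oy; have := dotp_le g (x - y); rewrite dotpBr => h1 h2.
  have -> : h x - dotp g x - (h y - dotp g y) = (h x - h y) - (dotp g x - dotp g y) by ring.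
  by rewrite (le_trans (ler_normB _ _))// mulrDl lerD.
- apply: negligibleS (s_ae S) => x [Ox nx]; split=> // -[g' [Hg' Ng']]; apply: nx.
  exists (g' - g); split; last by rewrite dotpBl gnu dotpC subr_ge0; exact: Nb.
  have := has_gradD Hg' (has_gradN (has_grad_aff g 0 x)).
  by under eq_fun do rewrite addr0.
Qed.

Lemma strict_gap p : Good p -> exists2 g0, (forall x, N x -> sigma p + dotp g0 (x - p) <= sigma x) &
  exists2 c : R, 0 < c & forall z x, Om z -> has_grad h z x -> N x -> ~ Good x ->
    sigma p + dotp g0 (x - p) + c <= sigma x.
Proof.
move=> Gp; have [g0 [H1 H2]] := s_strict S Gp; exists g0 => //.
have [K K0 HK] := setting_lipO.
pose X : set pt := [set x | [/\ N x, ~ Good x & `|x| <= K]].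
have cX : compact X.
  apply: (@closed_bounded_compact _ _ K); last by move=> z [].
  rewrite (_ : X = N `&` ~` Good `&` [set x | `|x| <= K]); last first.
    by apply/seteqP; split=> x; [move=> []|move=> [[]]].
  apply: closedI; last exact: closed_norm_le.
  by apply: closedI; [exact: s_Nclosed S|apply: open_closedC; exact: s_Gopen S].
have XN : X `<=` N by move=> x [].
pose e x := sigma x - sigma p - dotp g0 (x - p).
have ce : {within X, continuous e}.
  apply/within_continuousP => x Xx eps e0.
  have e2 : 0 < eps / 2 by rewrite divr_gt0.
  have c1 : 0 < 2 * `|g0| + 1 by rewrite ltr_wpDl// mulr_ge0.
  have /within_continuousP /(_ x (XN _ Xx) _ e2)[d d0 Hd] := s_scont S.
  exists (Num.min d (eps / 2 / (2 * `|g0| + 1))); first by rewrite lt_min d0 divr_gt0.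
  move=> w Xw; rewrite lt_min ltr_pdivlMr// => /andP[/(Hd _ (XN _ Xw)) h1 h2].
  have -> : e w - e x = (sigma w - sigma x) - dotp g0 (w - x).
    by rewrite /e !dotpBr; ring.
  have := dotp_le g0 (w - x); have n0 := normr_ge0 (w - x) => h3.
  by rewrite (le_lt_trans (ler_normB _ _))//; nra.
have [X0|X0] := pselect (X !=set0); last first.
  exists 1 => // z x Oz Hx Nx nGx; case: X0; exists x; split=> //.
  exact: grad_norm_le (s_open S) HK Oz Hx.
have [m mX Hm] := compact_EVT_min X0 cX ce.
have [Nm nGm _] := set_mem mX.
exists (e m); first by have := H2 m Nm nGm; rewrite /e; lra.
move=> z x Oz Hx Nx nGx.
have Xx : X x by split=> //; exact: grad_norm_le (s_open S) HK Oz Hx.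
by have := Hm x (mem_set Xx); rewrite {2}/e; lra.
Qed.

(** Otherwise replace [h] by the plane wherever it is higher in [W]. Relative to the supporting
    plane of [sigma] at [p] nothing is lost anywhere, and a fixed amount is gained near [z1]. Only
    [z1], not [W], has to lie in [F], which later allows regions that reach far outside [F]. *)
Lemma affine_cmp p (c : R) (W : set pt) z1 : Good p -> open W -> closure W `<=` Om ->
  (forall z, closure W z -> ~ W z -> h z <= dotp p z + c) -> W z1 -> F z1 -> h z1 <= dotp p z1 + c.
Proof.
move=> Gp oW WOm bd Wz Fz; rewrite leNgt; apply/negP => hz.
have [g0 H1 [e e0 H2]] := strict_gap Gp.
have Oz := s_FOm S Fz.
have [r r0 Hr] := cont_lt_near (has_grad_cont (@has_grad_aff R p c z1)) (setting_contz Oz) hz.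
have /openP /(_ _ Wz)[r1 r10 Hr1] := oW.
have /openP /(_ _ Fz)[r2 r20 Hr2] := s_Fopen S.
pose r3 := Num.min r (Num.min r1 r2).
have r30 : 0 < r3 by rewrite !lt_min r0 r10.
have U0 : [set w : pt | `|w - z1| < r3] !=set0 by exists z1; rewrite /= subrr normr0.
have UA w : `|w - z1| < r3 -> [/\ W w, F w & dotp p w + c < h w].
  by rewrite !lt_min => /and3P[/Hr ? /Hr1 ? /Hr2 ?].
apply: (@cut_contra R Om F N Good sigma h S W (p, c) [::] oW WOm _ _
  [set w : pt | `|w - z1| < r3] 1 0 e g0) => //.
- by move=> q; rewrite inE => /eqP-> /=; exact: (s_GN S Gp).
- by rewrite lexx ler01.
- exact: open_ball_norm.
- by move=> w /UA[].
- move=> z x q _ _ Nx; rewrite inE => /eqP-> /=.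
  rewrite subrr scale0r add0r scale1r; have := H1 x Nx; rewrite !dotpBr; lra.
- move=> z x q /UA[_ Fz' _] Hx Nx; rewrite inE => /eqP-> /=.
  rewrite subrr scale0r add0r scale1r.
  have := H2 z x (s_FOm S Fz') Hx Nx (s_frozen S Fz' Hx Nx); rewrite !dotpBr; lra.
- by rewrite mul0r mulr_gt0//; exact: ball_measure_gt0.
Qed.

(** If [p] violates a half-plane containing [N], then [setting_mono] forces [h] to grow along its
    normal faster than the paraboloid allows at small distances. *)
Lemma touch_N z1 p (C r : R) : Om z1 -> 0 < r -> 0 <= C ->
  (forall z, `|z - z1| < r -> h z <= h z1 + dotp p (z - z1) + C * `|z - z1| ^+ 2) -> N p.
Proof.
move=> Oz r0 C0 H; apply: contrapT => /(s_Nhalf S)[nu [b [nu0 pb Nb]]].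
have /openP /(_ _ Oz)[r1 r10 Hr1] := s_open S.
have n0 : 0 < `|nu| by rewrite normr_gt0; apply/eqP.
pose A := C * `|nu| ^+ 2 + 1.
have A0 : 0 < A by rewrite ltr_wpDl// mulr_ge0// sqr_ge0.
pose m := Num.min (Num.min r r1 / `|nu|) ((b - dotp nu p) / A).
have m0 : 0 < m by rewrite !lt_min !divr_gt0 ?lt_min ?r0 ?r10// subr_gt0.
pose t := m / 2.
have t0 : 0 < t by rewrite divr_gt0.
have tm : t < m by rewrite /t; lra.
have tn : t * `|nu| < Num.min r r1.
  by rewrite -ltr_pdivlMr//; apply: (lt_le_trans tm); rewrite /m ge_min lexx.
have tA : t * A < b - dotp nu p.
  by rewrite -ltr_pdivlMr//; apply: (lt_le_trans tm); rewrite /m ge_min lexx orbT.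
have seg s : 0 <= s <= t -> Om (z1 + s *: nu).
  move=> /andP[s0 st]; apply: Hr1; rewrite addrC addKr normrZ ger0_norm//.
  apply: (@le_lt_trans _ _ (t * `|nu|)); first by rewrite ler_wpM2r.
  by apply: (lt_le_trans tn); rewrite ge_min lexx orbT.
have Nb' x : N x -> b <= dotp nu x by exact: Nb.
have := setting_mono nu0 Nb' (ltW t0) seg.
have E : `|z1 + t *: nu - z1| = t * `|nu| by rewrite addrC addKr normrZ gtr0_norm.
have := H (z1 + t *: nu); rewrite E.
have -> : z1 + t *: nu - z1 = t *: nu by rewrite addrC addKr.
rewrite dotpZr [dotp p nu]dotpC => h1 h2.
have tr : t * `|nu| < r by apply: (lt_le_trans tn); rewrite ge_min lexx.
have {}h1 := h1 tr.
suff : C * (t * `|nu|) ^+ 2 < t * (b - dotp nu p) by lra.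
rewrite exprMn mulrCA expr2 -mulrA ltr_pM2l//; apply: le_lt_trans tA.
by rewrite /A; nra.
Qed.

(** A plane of slope [p] need not separate from [h] at the boundary of a ball. The cut is therefore
    made by a pyramid with slopes [p + (±L, ±L)]; for small [L] these slopes cost at most half of
    the gap provided by [strict_gap]. *)
Lemma touch_notGood z1 p (C r : R) : F z1 -> 0 < r -> 0 <= C ->
  (forall z, `|z - z1| < r -> h z <= h z1 + dotp p (z - z1) + C * `|z - z1| ^+ 2) -> ~ Good p.
Proof.
move=> Fz r0 C0 H Gp.
have [g0 H1 [c c0 H2]] := strict_gap Gp.
have Np : N p by exact: (s_GN S Gp).
have /openP /(_ _ Fz)[rF rF0 HrF] := s_Fopen S.
have /openP /(_ _ Gp)[rG rG0 HrG] := s_Gopen S.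
have c4 : 0 < c / 4 by rewrite divr_gt0.
have /within_continuousP /(_ p Np _ c4)[rs rs0 Hrs] := s_scont S.
pose A := 2 * `|g0| + 1.
have A0 : 0 < A by rewrite ltr_wpDl// mulr_ge0.
pose m := Num.min (Num.min rG rs) (c / 4 / A).
have m0 : 0 < m by rewrite !lt_min rG0 rs0 divr_gt0.
pose L := m / 2.
have L0 : 0 < L by rewrite divr_gt0.
have Lm : L < m by rewrite /L; lra.
have sl p' : `|p' - p| <= L -> N p' /\ sigma p' - sigma p - dotp g0 (p' - p) <= c / 2.
  move=> pL; have pm := le_lt_trans pL Lm; move: (pm); rewrite /m !lt_min => /andP[/andP[pG ps] pA].
  have Np' : N p' by apply/(s_GN S)/HrG.
  split=> //; have := Hrs p' Np' ps; rewrite ltr_norml => /andP[_ h1].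
  rewrite ltr_pdivlMr// in pA.
  have := dotp_le g0 (p' - p); rewrite ler_norml => /andP[h2 _].
  have := normr_ge0 (p' - p); rewrite /A in pA; nra.
(* On a sphere of this radius the quadratic term is at most [L r1 / 4]. The pyramid rises there by
   at least [L r1], which exceeds this even after lowering its apex by [kap = L r1 / 2]. *)
pose r1 := Num.min (Num.min r rF) (L / (4 * (C + 1))) / 2.
have C1 : 0 < C + 1 by rewrite ltr_wpDl.
have mm0 : 0 < Num.min (Num.min r rF) (L / (4 * (C + 1))).
  by rewrite !lt_min r0 rF0 divr_gt0// mulr_gt0.
have r10 : 0 < r1 by rewrite divr_gt0.
have r1m : r1 < Num.min (Num.min r rF) (L / (4 * (C + 1))) by rewrite /r1; lra.
move: (r1m); rewrite !lt_min => /andP[/andP[r1r r1F] r1L].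
have r1C : C * r1 <= L / 4.
  rewrite ltr_pdivlMr in r1L; last by rewrite mulr_gt0.
  by nra.
pose W := [set w : pt | `|w - z1| < r1].
have oW : open W by exact: open_ball_norm.
have cW z : closure W z -> `|z - z1| <= r1.
  move=> Wz; have : closure [set w : pt | `|w - z1| <= r1] z.
    by apply: closure_subset Wz => w /ltW.
  by move/closed_ball_norm.
pose kap := L * r1 / 2.
have kap0 : 0 < kap by rewrite divr_gt0// mulr_gt0.
pose q (s t : R) : pt * R := (p + (s * L, t * L), h z1 - kap - dotp (p + (s * L, t * L)) z1).
have qE s t z : affv (q s t) z = h z1 - kap + dotp p (z - z1) + L * (s * (z - z1).1 + t * (z - z1).2).
  by rewrite /affv /q /dotp /=; ring.
pose ql := [:: q 1 (-1); q (-1) 1; q (-1) (-1)].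
have qin q' : q' \in q 1 1 :: ql -> exists s t : R, [/\ q' = q s t, `|s| = 1 & `|t| = 1].
  rewrite !inE => /or4P[]/eqP->; [exists 1, 1|exists 1, (-1)|exists (-1), 1|exists (-1), (-1)];
    by rewrite ?normrN ?normr1.
have qsl q' : q' \in q 1 1 :: ql -> `|q'.1 - p| <= L.
  move=> /qin[s [t [-> s1 t1]]]; rewrite /q /= addrC addKr; apply/norm_leP; rewrite /=.
  split; rewrite normrM ?s1 ?t1 mul1r gtr0_norm//.
have WF z : W z -> F z by move=> Wz; apply: HrF; apply: lt_trans r1F.
have U0 : exists2 r2 : R, 0 < r2 & forall w, `|w - z1| < r2 -> W w /\ maxaff (q 1 1) ql w < h w.
  have lt1 : maxaff (q 1 1) ql z1 < h z1.
    apply: maxaff_lt => q' /qin[s [t [-> _ _]]]; rewrite qE subrr dotp0r /=.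
    by rewrite !mulr0 !addr0 mulr0 addr0; lra.
  have [r2 r20 Hr2] := cont_lt_near (@maxaff_cont R (q 1 1) ql z1) (setting_contz (s_FOm S Fz)) lt1.
  exists (Num.min r1 r2); first by rewrite lt_min r10.
  by move=> w; rewrite lt_min => /andP[? /Hr2].
have [r2 r20 Hr2] := U0.
apply: (@cut_contra R Om F N Good sigma h S W (q 1 1) ql oW _ _ _
  [set w : pt | `|w - z1| < r2] 1 0 (c / 2) g0) => //.
- by move=> z /cW zr; apply: (s_FOm S); apply: HrF; apply: le_lt_trans r1F.
- by move=> q' /qsl /sl[].
- move=> z /cW zr /negP; rewrite -leNgt => zr'.
  have E : `|z - z1| = r1 by apply/le_anti; rewrite zr zr'.
  have hz : h z <= h z1 + dotp p (z - z1) + L * r1 / 4.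
    have := H z; rewrite E => /(_ r1r) h1; apply: (le_trans h1); rewrite lerD2l.
    by rewrite expr2; nra.
  have abs1 (x : R) : exists2 s : R, (s = 1) \/ (s = -1) & s * x = `|x|.
    have [x0|x0] := leP 0 x; first by exists 1; [left|rewrite mul1r ger0_norm].
    by exists (-1); [right|rewrite mulN1r ltr0_norm].
  have [s s1 sE] := abs1 (z - z1).1; have [t t1 tE] := abs1 (z - z1).2.
  have qst : q s t \in q 1 1 :: ql.
    by rewrite !inE; case: s1 => ->; case: t1 => ->; rewrite eqxx ?orbT.
  apply: le_trans (maxaff_ge z qst); rewrite qE sE tE.
  have : r1 <= `|(z - z1).1| + `|(z - z1).2|.
    rewrite -E normE ge_max; apply/andP; split; [by rewrite lerDl|by rewrite lerDr].
  by rewrite /kap; nra.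
- by rewrite lexx ler01.
- exact: open_ball_norm.
- by exists z1; rewrite /= subrr normr0.
- by rewrite divr_gt0.
- move=> z x q' [Wz _] Hx Nx /qsl /sl[_ h2].
  have := H2 z x (s_FOm S (WF _ Wz)) Hx Nx (s_frozen S (WF _ Wz) Hx Nx).
  rewrite subrr scale0r add0r scale1r; move: h2; rewrite !dotpBr; lra.
- move=> z x q' /Hr2[Wz _] Hx Nx /qsl /sl[_ h2].
  have := H2 z x (s_FOm S (WF _ Wz)) Hx Nx (s_frozen S (WF _ Wz) Hx Nx).
  rewrite subrr scale0r add0r scale1r; move: h2; rewrite !dotpBr; lra.
- by rewrite mul0r mulr_gt0 ?divr_gt0//; exact: ball_measure_gt0.
Qed.

End InSetting.
End Touching.

(** * Contact with a slope on an open edge *)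

Section EdgeTouching.
Variable R : realType.
Notation pt := (R * R)%type.
Local Notation mu2 := (@leb2 R).
Implicit Types (z w g d p tau iota : pt).

Lemma compact_ray z0 nu (T : R) : compact [set z : pt | exists2 t, 0 <= t <= T & z = z0 + t *: nu].
Proof.
rewrite (_ : [set z | _] = (fun t : R => z0 + t *: nu) @` `[0, T]%classic).
  apply: continuous_compact; last exact: segment_compact.
  apply: continuous_subspaceT => t; apply: cvgD; first exact: cvg_cst.
  by apply: cvgZr_tmp; exact: cvg_id.
apply/seteqP; split=> z.
  by move=> [t t0 ->]; exists t => //=; rewrite in_itv.
by move=> [t /=]; rewrite in_itv /= => t0 <-; exists t.
Qed.

(** [dualx] and [dualy] form the basis dual to [(tau, iota)]: the numbers [dotp tau z] and
    [dotp iota z] are the coordinates of [z] in it. *)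
Definition dualx tau iota : pt := (iota.2 / crossp tau iota, - iota.1 / crossp tau iota).
Definition dualy tau iota : pt := (- tau.2 / crossp tau iota, tau.1 / crossp tau iota).

Lemma dual_dec tau iota z : crossp tau iota != 0 ->
  z = dotp tau z *: dualx tau iota + dotp iota z *: dualy tau iota.
Proof.
move=> D0; rewrite [z]surjective_pairing /dualx /dualy; congr pair;
  rewrite /= /GRing.scale /= /dotp /=; rewrite /crossp in D0 *; field; exact: D0.
Qed.

Lemma dot_dual tau iota : crossp tau iota != 0 ->
  [/\ dotp tau (dualx tau iota) = 1, dotp tau (dualy tau iota) = 0,
      dotp iota (dualx tau iota) = 0 & dotp iota (dualy tau iota) = 1].
Proof.
by move=> D0; rewrite /dualx /dualy /dotp /= /crossp in D0 *; split; field; exact: D0.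
Qed.

Lemma dualy_neq0 tau iota : crossp tau iota != 0 -> dualy tau iota <> 0.
Proof.
move=> D0 E; have [_ _ _] := dot_dual D0; rewrite E dotp0r => /eqP.
by rewrite eq_sym oner_eq0.
Qed.

Definition box tau iota z1 (X Y1 Y2 : R) : set pt :=
  [set z | `|dotp tau (z - z1)| < X /\ - Y1 < dotp iota (z - z1) < Y2].

Lemma box_open tau iota z1 X Y1 Y2 : open (box tau iota z1 X Y1 Y2).
Proof.
rewrite (_ : box _ _ _ _ _ _ = [set z | dotp tau z < X + dotp tau z1] `&`
  [set z | dotp (- tau) z < X - dotp tau z1] `&` [set z | dotp (- iota) z < Y1 - dotp iota z1] `&`
  [set z | dotp iota z < Y2 + dotp iota z1]).
  by repeat (apply: openI; last exact: open_half); exact: open_half.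
apply/seteqP; split=> z; rewrite /box /= !dotpBr ?dotpNl ltr_norml.
  by move=> [/andP[? ?] /andP[? ?]]; repeat split; lra.
by move=> [[[? ?] ?] ?]; split; apply/andP; split; lra.
Qed.

Lemma box_closure tau iota z1 X Y1 Y2 z : closure (box tau iota z1 X Y1 Y2) z ->
  `|dotp tau (z - z1)| <= X /\ - Y1 <= dotp iota (z - z1) <= Y2.
Proof.
pose C := [set z | dotp tau z <= X + dotp tau z1] `&`
  [set z | dotp (- tau) z <= X - dotp tau z1] `&` [set z | dotp (- iota) z <= Y1 - dotp iota z1] `&`
  [set z | dotp iota z <= Y2 + dotp iota z1].
have cC : closed C by repeat (apply: closedI; last exact: closed_half); exact: closed_half.
move=> bz; have : C z.
  apply: cC; apply: closure_subset bz => w; rewrite /box /C /= !dotpBr ?dotpNl ltr_norml.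
  by move=> [/andP[? ?] /andP[? ?]]; repeat split; lra.
rewrite /C /= !dotpBr ?dotpNl ler_norml.
by move=> [[[? ?] ?] ?]; split; apply/andP; split; lra.
Qed.

Section InSetting.
Variables (Om F N Good : set pt) (sigma h : pt -> R).
Hypothesis S : setting Om F N Good sigma h.

(** As [p] minimizes the product with [v] over [N], the function [k] does not decrease along [v]: in
    the lower part of the box it is bounded by its values on the axis through [z1]. At the far end
    of the ray it is strictly negative, and by continuity it stays so on the whole bottom of a thin
    enough box. *)
Lemma box_setup z1 p tau iota (Y r : R) (k := fun z => h z - h z1 - dotp p (z - z1))
    (u := dualx tau iota) (v := dualy tau iota) : crossp tau iota != 0 -> 0 < r ->
  (forall x, N x -> dotp v p <= dotp v x) -> 0 <= Y ->
  (forall t, 0 <= t <= Y -> Om (z1 - t *: v)) -> h (z1 - Y *: v) < h z1 - Y * dotp v p ->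
  exists X0 t0 : R, [/\ 0 < X0, 0 < t0 & forall z, `|dotp tau (z - z1)| <= X0 ->
    - Y <= dotp iota (z - z1) <= X0 ->
    [/\ Om z, dotp iota (z - z1) <= 0 -> k z <= k (z1 + dotp tau (z - z1) *: u),
      dotp iota (z - z1) = - Y -> k z < - t0, 0 <= dotp iota (z - z1) -> `|z - z1| < r &
      `|dotp tau (z - z1) *: u| < r]].
Proof.
move=> D0 r0 Nv Y0 seg hY.
pose K : set pt := [set z | exists2 t, 0 <= t <= Y & z = z1 + t *: (- v)].
have KOm : K `<=` Om by move=> z [t /seg + ->]; rewrite scalerN.
have [r1 r10 Hr1] := tube (@compact_ray z1 (- v) Y) (s_open S) KOm.
pose zb := z1 - Y *: v.
have Ozb : Om zb by apply: seg; rewrite Y0 lexx.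
have zbE : zb - z1 = - (Y *: v) by rewrite /zb addrC addKr.
have kb : k zb < 0.
  by rewrite /k zbE dotpNr dotpZr [dotp p v]dotpC; rewrite -/zb in hY; lra.
pose t0 := - k zb / 2.
have t00 : 0 < t0 by rewrite /t0; lra.
have lt1 : h zb < affv (p, h z1 - dotp p z1 - t0) zb.
  by rewrite /affv /=; have : k zb < - t0 by [rewrite /t0; lra|]; rewrite /k dotpBr; lra.
have [r2 r20 Hr2] := cont_lt_near (setting_contz S Ozb)
  (has_grad_cont (@has_grad_aff R p (h z1 - dotp p z1 - t0) zb)) lt1.
pose m := Num.min r (Num.min r1 r2).
have m0 : 0 < m by rewrite !lt_min r0 r10.
pose A := `|u| + `|v| + 1.
have A0 : 0 < A by rewrite ltr_wpDl// addr_ge0.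
pose X0 := m / A.
have X00 : 0 < X0 by rewrite divr_gt0.
have XA : X0 * A = m by rewrite divfK// gt_eqF.
have Xu x : `|x| <= X0 -> `|x *: u| < m.
  move=> xX; rewrite normrZ -XA; apply: (@le_lt_trans _ _ (X0 * `|u|)).
    by rewrite ler_wpM2r.
  by rewrite ltr_pM2l// /A -addrA ltrDl ltr_wpDl.
exists X0, t0; split=> // z xX /andP[y1 y2].
set x := dotp tau (z - z1) in xX *; set y := dotp iota (z - z1) in y1 y2 *.
have zE : z = z1 + x *: u + y *: v.
  by rewrite -addrA -(dual_dec (z - z1) D0) addrC subrK.
have zE' : z - z1 = x *: u + y *: v by rewrite -(dual_dec (z - z1) D0).
have zm : 0 <= y -> `|z - z1| < m.
  move=> y0; rewrite zE' (le_lt_trans (ler_normD _ _))//.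
  rewrite -XA !normrZ (ger0_norm y0) /A.
  have : `|x| * `|u| <= X0 * `|u| by rewrite ler_wpM2r.
  have : y * `|v| <= X0 * `|v| by rewrite ler_wpM2r.
  by rewrite !mulrDr; lra.
have Kz s : - Y <= s <= 0 -> Om (z1 + x *: u + s *: v).
  move=> /andP[s1 s2]; apply: (Hr1 (z1 + s *: v)).
    by exists (- s); [apply/andP; split; lra|rewrite scalerN scaleNr opprK].
  rewrite [z1 + _ + _]addrAC [_ + x *: u]addrC addrK; apply: (lt_le_trans (Xu x xX)).
  by rewrite /m ge_min [Num.min r1 r2 <= _]ge_min lexx orbT.
have Oz : Om z.
  have [yn|yp] := leP y 0; first by rewrite zE; apply: Kz; rewrite y1.
  apply: (Hr1 z1).
    by exists 0; [rewrite lexx|rewrite scale0r addr0].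
  apply: (lt_le_trans (zm (ltW yp))).
  by rewrite /m ge_min [Num.min r1 r2 <= _]ge_min lexx orbT.
split=> //.
- move=> yn; have yn' : 0 <= - y by lra.
  have sg t : 0 <= t <= - y -> Om (z + t *: v).
    move=> /andP[t1 t2]; rewrite zE -addrA -scalerDl; apply: Kz.
    by clear - S t1 t2 y1 yn; apply/andP; split; lra.
  have := setting_mono S (dualy_neq0 D0) Nv yn' sg.
  rewrite /k; have -> : z + (- y) *: v = z1 + x *: u by rewrite {1}zE scaleNr addrK.
  have -> : z1 + x *: u - z1 = x *: u by rewrite addrC addKr.
  by rewrite zE' dotpDr !dotpZr [dotp p v]dotpC; lra.
- move=> yY; have := Hr2 z; rewrite /affv /k /= dotpBr => h1.
  suff : h z < dotp p z + (h z1 - dotp p z1 - t0) by lra.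
  apply: h1; rewrite zE yY /zb scaleNr [z1 + _ + _]addrAC [_ + x *: u]addrC addrK.
  apply: (lt_le_trans (Xu x xX)).
  by rewrite /m ge_min [Num.min r1 r2 <= _]ge_min lexx !orbT.
- by move=> /zm h1; apply: (lt_le_trans h1); rewrite /m ge_min lexx.
- by apply: (lt_le_trans (Xu x xX)); rewrite /m ge_min lexx.
Qed.

(** The slope [p] is moved into [Good] by [d * iota], and the plane with this slope, lowered by
    [kap], is compared with [h] on the box. Strict concavity in the [tau] coordinate handles the
    lateral sides, the slack of the ray handles the bottom, and a short upper arm handles the top.
    At [z1] the plane is below [h], against [affine_cmp]. *)
Lemma touch_edge z1 p tau iota (Y r e M d0 : R) (v := dualy tau iota) :
  crossp tau iota != 0 -> 0 < r -> 0 < e -> 0 < M -> 0 < d0 -> F z1 ->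
  (forall x, N x -> dotp v p <= dotp v x) -> 0 <= Y ->
  (forall t, 0 <= t <= Y -> Om (z1 - t *: v)) -> h (z1 - Y *: v) < h z1 - Y * dotp v p ->
  (forall d : R, 0 < d < d0 -> Good (p + d *: iota)) ->
  (forall z, `|z - z1| < r -> h z <= h z1 + dotp p (z - z1)
     - e * dotp tau (z - z1) ^+ 2 + M * dotp iota (z - z1) ^+ 2) -> False.
Proof.
move=> D0 r0 e0 M0 d00 Fz Nv Y0 seg hY Gd H.
have [X [t0 [X0 t00 B]]] := box_setup D0 r0 Nv Y0 seg hY.
have [du1 du2 du3 du4] := dot_dual D0.
pose iM := M^-1; have iM0 : 0 < iM by rewrite invr_gt0.
have MiM : M * iM = 1 by rewrite divff// gt_eqF.
pose A := Y + iM + 1; have A0 : 0 < A by rewrite ltr_wpDl// addr_ge0// ltW.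
pose m := Num.min (Num.min 1 d0) (Num.min X (Num.min (e * X ^+ 2) t0) / A).
have eX : 0 < e * X ^+ 2 by rewrite mulr_gt0// exprn_gt0.
have m0 : 0 < m by rewrite !lt_min ltr01 d00 divr_gt0// !lt_min X0 eX.
pose d := m / 2.
have dp : 0 < d by rewrite divr_gt0.
have dm : d < m by rewrite /d; lra.
move: (dm); rewrite /m !lt_min ltr_pdivlMr// !lt_min => /andP[/andP[d1 dd0] /and3P[dX deX dt]].
(* The height [yt = d / (2 M)] minimizes [M y^2 - d y], with value [- d^2 / (4 M)]; [kap] is half of
   that room. *)
pose kap := d ^+ 2 * iM / 8; pose yt := d * iM / 2.
have yt0 : 0 < yt by rewrite divr_gt0// mulr_gt0.
have kap0 : 0 < kap by rewrite divr_gt0// mulr_gt0// exprn_gt0.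
have d2 : d ^+ 2 * iM <= d * iM by rewrite ler_pM2r// expr2 ler_piMr// ltW.
have dY : 0 <= d * Y by rewrite mulr_ge0// ltW.
have di : 0 < d * iM by rewrite mulr_gt0.
have dAE : d * A = d * Y + d * iM + d by rewrite /A; ring.
have Myt : M * yt ^+ 2 = d ^+ 2 * iM / 4.
  have -> : M * yt ^+ 2 = (M * iM) * (d ^+ 2 * iM) / 4 by rewrite /yt; field.
  by rewrite MiM mul1r.
have dyt : d * yt = d ^+ 2 * iM / 2 by rewrite /yt expr2; ring.
have kapE : kap = d ^+ 2 * iM / 8 by [].
have kap_le : kap <= d * iM / 8 by rewrite /kap; clear - S d2; lra.
have Yp : 0 < Y.
  rewrite lt_neqAle Y0 andbT eq_sym; apply/eqP => E; move: hY.
  by rewrite E scale0r subr0 mul0r subr0 ltxx.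
pose W := box tau iota z1 X Y yt.
have ytX : yt <= X by rewrite /yt; clear - S dX dAE dY di dp; lra.
have WB z : closure W z -> [/\ `|dotp tau (z - z1)| <= X, - Y <= dotp iota (z - z1) <= X &
    dotp iota (z - z1) <= yt].
  by move=> /box_closure[h1 /andP[h2 h3]]; split=> //; rewrite h2 (le_trans h3).
have WOm : closure W `<=` Om by move=> z /WB[h1 h2 _]; have [] := B z h1 h2.
have Wz1 : W z1 by rewrite /W /box /= subrr !dotp0r normr0 oppr_lt0 yt0 X0 Yp.
pose p' := p + d *: iota.
have Gp' : Good p' by apply: Gd; rewrite dp.
have := @affine_cmp R Om F N Good sigma h S p' (h z1 - kap - dotp p' z1) W z1 Gp'
  (@box_open _ _ _ _ _ _) WOm _ Wz1 Fz.
suff bd z : closure W z -> ~ W z -> h z <= dotp p' z + (h z1 - kap - dotp p' z1).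
  by move=> /(_ bd) hz; clear - S kap0 hz; lra.
move=> cz nz; have [xX yY yyt] := WB z cz; have [Oz B1 B2 B3 B4] := B z xX yY.
have -> : dotp p' z + (h z1 - kap - dotp p' z1) =
    h z1 + dotp p (z - z1) + d * dotp iota (z - z1) - kap.
  by rewrite /p' !dotpDl !dotpZl !dotpBr; ring.
set x := dotp tau (z - z1) in xX B1 B4 *; set y := dotp iota (z - z1) in yY yyt B1 B2 B3 *.
move/andP : yY => [y1 y2].
have kx : h (z1 + x *: dualx tau iota) - h z1 - dotp p (x *: dualx tau iota) <= - e * x ^+ 2.
  have := H (z1 + x *: dualx tau iota); rewrite [z1 + _ - z1]addrC addKr => /(_ B4).
  rewrite [dotp tau _]dotpZr [dotp iota _]dotpZr du1 du3 mulr1 mulr0 expr0n /= mulr0 addr0.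
  by clear - S; lra.
have dy1 : - (d * Y) <= d * y by rewrite -mulrN ler_pM2l.
have [xlt|xeq] := ltP `|x| X; last first.
  have x2 : x ^+ 2 = X ^+ 2.
    by rewrite -real_normK ?num_real// (le_anti (_ : X <= `|x| <= X))// xeq xX.
  have [yn|yp] := leP y 0.
    have := B1 yn; rewrite [z1 + _ - z1]addrC addKr => h1; rewrite x2 in kx.
    by clear - S h1 kx deX dAE dy1 kap_le di dp; lra.
  have := H z (B3 (ltW yp)); rewrite -/x -/y x2.
  have y2l : y ^+ 2 <= yt ^+ 2 by rewrite lerXn2r// nnegrE ltW.
  have : M * y ^+ 2 <= M * yt ^+ 2 by rewrite ler_pM2l.
  have : 0 < d * y by rewrite mulr_gt0.
  by clear - S Myt d2 deX dAE dY dp kap_le di; lra.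
have [ylt|yeq] := ltP y yt; last first.
  have yE : y = yt by apply/le_anti; rewrite yyt yeq.
  have yp : 0 <= y by rewrite yE ltW.
  have := H z (B3 yp); rewrite -/x -/y yE.
  have : 0 <= e * x ^+ 2 by rewrite mulr_ge0 ?sqr_ge0// ltW.
  by clear - S Myt dyt kapE kap0; lra.
have [ygt|yeq] := ltP (- Y) y.
  by exfalso; apply: nz; rewrite /W /box /= -/x -/y xlt ygt ylt.
have yE : y = - Y by apply/le_anti; rewrite y1 yeq.
by have := B2 yE; cbv beta; clear - S dy1 dt dAE dp di kap_le dY; lra.
Qed.

(** The one-sided derivative of [sigma] at [s] in the direction [d] is minus infinity. *)
Definition steep (s d : pt) := forall C : R, exists2 t0 : R, 0 < t0 &
  forall t, 0 < t < t0 -> sigma (s + t *: d) <= sigma s - C * t.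

(** Here [h] has no strict concavity along the edge, so one plane does not suffice. The two slopes
    [s + d iota ± m tau] give a roof that rises by [m |x|] towards the lateral sides of the box.
    Moving only a fraction [t] of the way to it exploits the steepness of [sigma] at [s]. *)
Lemma flat_edge z1 s tau iota (Y r m0 : R) (v := dualy tau iota) :
  crossp tau iota != 0 -> 0 < r -> 0 < m0 -> Om z1 -> N s ->
  (forall x, N x -> dotp v s <= dotp v x) -> 0 <= Y ->
  (forall t, 0 <= t <= Y -> Om (z1 - t *: v)) -> h (z1 - Y *: v) < h z1 - Y * dotp v s ->
  (forall d m : R, 0 < d < m0 -> `|m| < m0 ->
     N (s + (d *: iota + m *: tau)) /\ steep s (d *: iota + m *: tau)) ->
  (forall z, `|z - z1| < r -> h z = h z1 + dotp s (z - z1)) -> False.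
Proof.
move=> D0 r0 m00 Oz1 Ns Nv Y0 seg hY Hst H.
have [X [t0 [X0 t00 B]]] := box_setup D0 r0 Nv Y0 seg hY.
have [du1 du2 du3 du4] := dot_dual D0.
pose m := m0 / 2.
have mp : 0 < m by rewrite divr_gt0.
have mm : `|m| < m0 by rewrite gtr0_norm// /m; lra.
have mm' : `|- m| < m0 by rewrite normrN.
have A0 : 0 < Y + X by rewrite ltr_wpDl.
have mX : 0 < m * X by rewrite mulr_gt0.
pose mn := Num.min m0 (Num.min (m * X) t0 / (Y + X)).
have mn0 : 0 < mn by rewrite !lt_min m00 divr_gt0// lt_min mX.
pose d := mn / 2.
have dp : 0 < d by rewrite divr_gt0.
have dm : d < mn by rewrite /d; lra.
move: (dm); rewrite /mn lt_min ltr_pdivlMr// lt_min => /and3P[dm0 dmX dt].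
pose kap := d * X / 2.
have dX : 0 < d * X by rewrite mulr_gt0.
have dY0 : 0 <= d * Y by rewrite mulr_ge0// ltW.
have kap0 : 0 < kap by rewrite divr_gt0.
rewrite mulrDr in dmX dt.
have Yp : 0 < Y.
  rewrite lt_neqAle Y0 andbT eq_sym; apply/eqP => E; move: hY.
  by rewrite E scale0r subr0 mul0r subr0 ltxx.
pose W := box tau iota z1 X Y X.
have WOm : closure W `<=` Om by move=> z /box_closure[h1 h2]; have [] := B z h1 h2.
have Wz1 : W z1 by rewrite /W /box /= subrr !dotp0r normr0 oppr_lt0 X0 Yp.
pose pp (a : R) := s + (d *: iota + a *: tau).
pose q a : pt * R := (pp a, h z1 - kap - dotp (pp a) z1).
have qE a z : affv (q a) z = h z1 - kap + dotp s (z - z1) + d * dotp iota (z - z1) + a * dotp tau (z - z1).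
  by rewrite /affv /q /pp /= !dotpDl !dotpZl !dotpBr; ring.
have dd : 0 < d < m0 by rewrite dp.
have [N1 st1] := Hst d m dd mm; have [N2 st2] := Hst d (- m) dd mm'.
have qin q' : q' \in q m :: [:: q (- m)] -> q' = q m \/ q' = q (- m).
  by rewrite !inE => /orP[/eqP->|/eqP->]; [left|right].
pose A := [set z | W z /\ maxaff (q m) [:: q (- m)] z < h z].
have lt1 : maxaff (q m) [:: q (- m)] z1 < h z1.
  apply: maxaff_lt => q' /qin[]->; rewrite qE subrr !dotp0r !mulr0 !addr0; clear - S kap0; lra.
have [r1 r10 Hr1] := cont_lt_near (@maxaff_cont R (q m) [:: q (- m)] z1) (setting_contz S Oz1) lt1.
have /openP /(_ _ Wz1)[r2 r20 Hr2] := @box_open tau iota z1 X Y X.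
pose r3 := Num.min r (Num.min r1 r2).
have r30 : 0 < r3 by rewrite !lt_min r0 r10.
pose U := [set w : pt | `|w - z1| < r3].
have UA : U `<=` A by move=> w; rewrite /U /= !lt_min => /and3P[_ /Hr1 ? /Hr2 ?].
have Us z x : U z -> has_grad h z x -> x = s.
  move=> Uz Hx; apply: (has_grad_unique Hx).
  have zr : `|z - z1| < r by move: Uz; rewrite /U /= !lt_min => /and3P[].
  have rz : 0 < r - `|z - z1| by rewrite subr_gt0.
  apply: (has_grad_near rz _ (@has_grad_aff R s (h z1 - dotp s z1) z)) => w wz.
  rewrite (H w) ?dotpBr /=; first by ring.
  by have := ler_distD z w z1; clear - S wz; lra.
have [Ms HMs] := s_sbdd S.
have Ms0 : 0 <= Ms by apply: le_trans (HMs s Ns).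
have Upos : 0 < fine (mu2 U) by exact: ball_measure_gt0.
have A0' : 0 <= fine (mu2 A) by apply: fine_ge0.
(* On [U] the gradient is [s] and the gain is [C t]. On the rest of [A] convexity and the bound [Ms]
   limit the loss to [2 Ms t]. This [C] makes the total gain exceed the total loss by [t]. *)
pose C := (2 * Ms * fine (mu2 A) + 1) / fine (mu2 U).
have C0 : 0 < C by rewrite divr_gt0// ltr_wpDl// !mulr_ge0.
have CU : C * fine (mu2 U) = 2 * Ms * fine (mu2 A) + 1 by rewrite divfK// gt_eqF.
have [ta ta0 Hta] := st1 C; have [tb tb0 Htb] := st2 C.
pose tm := Num.min 1 (Num.min ta tb).
have tm0 : 0 < tm by rewrite !lt_min ltr01 ta0.
pose t := tm / 2.
have tp : 0 < t by rewrite divr_gt0.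
have : t < tm by rewrite /t; clear - S tm0; lra.
rewrite /tm !lt_min => /and3P[t1 tta ttb].
have comb (p x : pt) : (1 - t) *: x + t *: p = x + t *: (p - x).
  by rewrite scalerBl scale1r scalerBr addrAC addrA.
apply: (@cut_contra R Om F N Good sigma h S W (q m) [:: q (- m)] (@box_open _ _ _ _ _ _) WOm _ _
  U t (2 * Ms * t) (C * t) 0) => //.
- by move=> q' /qin[]->.
- move=> z cz nz; have [xX yY] := box_closure cz; have [Oz B1 B2 B3 B4] := B z xX yY.
  set x := dotp tau (z - z1) in xX B1 B4; set y := dotp iota (z - z1) in yY B1 B2 B3.
  have absx : exists2 a, a \in [:: m; - m] & a * x = m * `|x|.
    have [x0|x0] := leP 0 x; first by exists m; rewrite ?mem_head// ger0_norm.
    by exists (- m); rewrite ?inE ?eqxx ?orbT// ltr0_norm// mulrN mulNr.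
  have [a ain aE] := absx.
  have qa : q a \in q m :: [:: q (- m)].
    by move: ain; rewrite !inE => /orP[/eqP->|/eqP->]; rewrite eqxx ?orbT.
  apply: le_trans (maxaff_ge z qa); rewrite qE -/x -/y aE.
  have kx : h (z1 + x *: dualx tau iota) - h z1 - dotp s (x *: dualx tau iota) = 0.
    by rewrite H [z1 + _ - z1]addrC addKr//; ring.
  have kle : h z - h z1 - dotp s (z - z1) <= 0.
    have [yn|yp] := leP y 0; last by rewrite (H z (B3 (ltW yp))); clear - S; lra.
    by have := B1 yn; rewrite [z1 + _ - z1]addrC addKr kx.
  move/andP : yY => [y1 y2].
  have dy1 : - (d * Y) <= d * y by rewrite -mulrN ler_pM2l.
  have mx0 : 0 <= m * `|x| by rewrite mulr_ge0// ltW.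
  have [xlt|xeq] := ltP `|x| X; last first.
    have : m * X <= m * `|x| by rewrite ler_pM2l.
    by rewrite /kap; clear - S kle dmX dy1 dX; lra.
  have [ylt|yeq] := ltP y X; last first.
    have : d * X <= d * y by rewrite ler_pM2l.
    by rewrite /kap; clear - S kle mx0 dX; lra.
  have [ygt|yeq] := ltP (- Y) y.
    by exfalso; apply: nz; rewrite /W /box /= -/x -/y xlt ygt ylt.
  have yE : y = - Y by apply/le_anti; rewrite y1 yeq.
  by have := B2 yE; rewrite /kap; clear - S dy1 mx0 dt dX; lra.
- by rewrite (ltW tp) ltW.
- exact: open_ball_norm.
- by exists z1; rewrite /U /= subrr normr0.
- by rewrite !mulr_ge0// ltW.
- by rewrite mulr_gt0.
- move=> z x q' _ Hx Nx q'in; rewrite dotp0l subr0.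
  have Nq : N q'.1 by case: (qin _ q'in) => ->.
  have t01 : 0 <= t <= 1 by rewrite (ltW tp) ltW.
  have := s_sconv S Nx Nq t01; have := HMs _ Nx; have := HMs _ Nq.
  rewrite !ler_norml => /andP[_ h1] /andP[h2 _] h3.
  have h4 : t * (sigma q'.1 - sigma x) <= t * (2 * Ms) by rewrite ler_pM2l//; clear - S h1 h2; lra.
  by clear - S h3 h4; lra.
- move=> z x q' Uz Hx Nx q'in; rewrite dotp0l subr0 (Us z x Uz Hx) comb.
  case: (qin _ q'in) => ->; rewrite /q /pp /= [s + _ - s]addrC addKr.
    by have := Hta t; rewrite tp tta => /(_ isT); clear - S; lra.
  by have := Htb t; rewrite tp ttb => /(_ isT); clear - S; lra.
- have -> : C * t * fine (mu2 U) = t * (C * fine (mu2 U)) by ring.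
  rewrite CU; have -> : 2 * Ms * t * fine (mu2 A) = t * (2 * Ms * fine (mu2 A)) by ring.
  by rewrite ltr_pM2l// ltrDl.
Qed.

End InSetting.
End EdgeTouching.

(** * Rigidity from touching slopes *)

Section TouchRigidity.
Variable R : realType.
Notation pt := (R * R)%type.
Implicit Types (z w g d p tau iota u v : pt).

Lemma max_attained (K : set pt) (f : pt -> R) (M : R) z0 : closed K -> (forall z, K z -> `|z| <= M) ->
  K z0 -> (forall z, K z -> {for z, continuous f}) -> exists2 z1, K z1 & forall z, K z -> f z <= f z1.
Proof.
move=> cK bK Kz0 fc; have [|z1 K1 H] := @compact_EVT_max _ _ f K (ex_intro _ z0 Kz0)
  (closed_bounded_compact cK bK).
  by apply: continuous_in_subspaceT => z; rewrite inE; exact: fc.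
by exists z1; [rewrite inE in K1|move=> z Kz; apply: H; rewrite inE].
Qed.

Lemma dotp_cont_shift g z0 z : {for z, continuous (fun w => dotp g (w - z0))}.
Proof.
have -> : (fun w => dotp g (w - z0)) = (fun w => dotp g w + (- dotp g z0)).
  by apply/funext => w; rewrite dotpBr.
exact: has_grad_cont (@has_grad_aff R g (- dotp g z0) z).
Qed.

Definition perp d : pt := (- d.2, d.1).

Lemma perp_sqr d w : dotp d d * dotp w w = dotp d w ^+ 2 + dotp (perp d) w ^+ 2.
Proof. rewrite /perp /dotp /=; ring. Qed.

Lemma crossp_perp d : crossp d (perp d) = dotp d d.
Proof. rewrite /crossp /perp /dotp /=; ring. Qed.

(* Second order expansion of the norm, with no quadratic term in the radial direction. *)
Lemma enorm_expand b w : b != 0 -> `|dotp b w| <= dotp b b / 2 ->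
  enorm (b + w) <= enorm b + dotp b w / enorm b + dotp (perp b) w ^+ 2 / enorm b ^+ 3.
Proof.
move=> b0 bw.
have r0 : 0 < enorm b by rewrite lt_neqAle eq_sym enorm_eq0 b0 enorm_ge0.
set r := enorm b in r0 *; set X := dotp b w in bw *; set Y := dotp (perp b) w.
have rr : dotp b b = r ^+ 2 by rewrite enorm_sqr.
have h1 := perp_sqr b w; rewrite rr -/X -/Y in h1 bw.
have rx : r / 2 <= r + X / r.
  have : - (r / 2) <= X / r.
    rewrite ler_pdivlMr//; move: bw; rewrite ler_norml => /andP[+ _]; nra.
  lra.
set x := X / r in rx *; have XE : X = r * x by rewrite /x mulrC divfK// gt_eqF.
set y := Y / r; have YE : Y = r * y by rewrite /y mulrC divfK// gt_eqF.
have h2 : dotp w w = x ^+ 2 + y ^+ 2.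
  by apply: (mulfI (lt0r_neq0 (exprn_gt0 2 r0))); rewrite h1 XE YE; ring.
have -> : Y ^+ 2 / r ^+ 3 = y ^+ 2 / r.
  by rewrite YE; field; rewrite gt_eqF.
set q := y ^+ 2 / r; have q0 : 0 <= q by rewrite divr_ge0 ?sqr_ge0// ltW.
have qr : q * r = y ^+ 2 by rewrite /q divfK// gt_eqF.
have B0 : 0 <= r + x + q by lra.
rewrite -(ger0_norm B0) -sqrtr_sqr; apply: ler_wsqrtr.
rewrite dotpDl !dotpDr [dotp w b]dotpC -/X h2 rr XE.
nra.
Qed.

(* The two ways in which the slopes of the paraboloids touching k from above are restricted;
   the radius r0 and the bound eta0 localize the condition near z0 and the slope 0. *)
Definition touch_axes (k : pt -> R) z0 tau iota (r0 eta0 : R) :=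
  forall z1 p (C r : R), `|z1 - z0| < r0 -> 0 < r -> 0 <= C -> `|p| < eta0 ->
  (forall z, `|z - z1| < r -> k z <= k z1 + dotp p (z - z1) + C * `|z - z1| ^+ 2) ->
  crossp p tau = 0 \/ crossp p iota = 0.

Definition no_strong_touch (k : pt -> R) z0 (r0 eta0 : R) :=
  forall z1 p iota (e M r : R), `|z1 - z0| < r0 -> 0 < r -> 0 < e -> 0 < M -> `|p| < eta0 ->
  crossp p iota != 0 ->
  (forall z, `|z - z1| < r -> k z <= k z1 + dotp p (z - z1)
     - e * dotp p (z - z1) ^+ 2 + M * dotp iota (z - z1) ^+ 2) -> False.

(** If the Lipschitz bound failed between [z2'] and [z2], a cone with vertex [z2], bent down by a
    small quadratic term, would touch [k] from above at an interior point other than [z2]. A cone is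
    flat in the radial direction, so the bend makes the contact strictly concave along its own
    slope, which [no_strong_touch] forbids. *)
Lemma small_lipschitz k z0 (r0 eta0 eta : R) : 0 < r0 -> 0 < eta -> eta <= eta0 ->
  (forall z, `|z - z0| < r0 -> {for z, continuous k}) ->
  no_strong_touch k z0 r0 eta0 -> has_grad k z0 0 -> k z0 = 0 ->
  exists2 rho : R, 0 < rho & forall z w, `|z - z0| < rho -> `|w - z0| < rho ->
    `|k z - k w| <= eta * `|z - w|.
Proof.
move=> r00 eta00 etale kc H2 kd k0.
wlog suff main : / forall eta, 0 < eta -> eta <= eta0 -> exists2 rho : R, 0 < rho &
    forall z w, `|z - z0| < rho -> `|w - z0| < rho -> k z - k w <= eta * enorm (z - w).
  have e2 : 0 < eta / 2 by rewrite divr_gt0.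
  have [|rho rho0 Hr] := main _ e2; first by lra.
  exists rho => // z w Bz Bw; have h1 := Hr z w Bz Bw; have h2 := Hr w z Bw Bz.
  have h3 := enorm_le (z - w); rewrite -(opprB z w) enormN in h2.
  have h4 : eta / 2 * enorm (z - w) <= eta * `|z - w| by nra.
  by rewrite ler_norml; apply/andP; split; lra.
move=> {eta eta00 etale} eta eta00 etale.
have e8 : 0 < eta / 16 by rewrite divr_gt0.
have /has_gradP /(_ _ e8)[d d0 Hd] := kd.
pose rho := Num.min r0 d / 2.
have rho0 : 0 < rho by rewrite divr_gt0// lt_min r00.
have rr : rho < r0 /\ rho < d.
  apply/andP; rewrite -lt_min /rho ltr_pdivrMr//; have : 0 < Num.min r0 d by rewrite lt_min r00.
  lra.
have [rr0 rd] := rr.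
have small z : `|z - z0| <= rho -> `|k z| <= eta / 16 * `|z - z0|.
  by move=> zr; have := Hd z (le_lt_trans zr rd); rewrite k0 dotp0l !subr0.
exists (rho / 2); first by rewrite divr_gt0.
move=> z2' z2 + Bz2; rewrite leNgt => Bz2'; apply/negP => gt1.
(* Points of the ball have Euclidean distance at most [4 rho] from [z2], so the quadratic term takes
   away at most a quarter of the cone. *)
pose e := eta / (16 * rho).
have e0 : 0 < e by rewrite divr_gt0// mulr_gt0.
have er : e * rho = eta / 16 by rewrite /e; field; rewrite gt_eqF.
pose phi z := eta * enorm (z - z2) - e * dotp (z - z2) (z - z2).
pose K := [set z : pt | `|z - z0| <= rho].
have Kz2' : K z2' by rewrite /K /=; lra.
have Kz2 : `|z2 - z0| <= rho by lra.
have [|||z1 K1 H1] := @max_attained K (fun z => k z - phi z) (rho + `|z0|) z2' _ _ Kz2'.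
- exact: closed_ball_norm.
- by move=> z Kz; have := ler_normD (z - z0) z0; rewrite subrK; rewrite /K /= in Kz; lra.
- move=> z Kz; apply: continuousB.
    by apply: kc; apply: le_lt_trans Kz rr0.
  have c1 : {for z, continuous (fun w => dotp (w - z2) (w - z2))}.
    have -> : (fun w => dotp (w - z2) (w - z2)) =
        (fun w => dotp (1, 0) (w - z2) ^+ 2 + dotp (0, 1) (w - z2) ^+ 2).
      by apply/funext => w; rewrite /dotp /=; ring.
    by apply: continuousD; apply: continuousM; exact: dotp_cont_shift.
  apply: continuousB; (apply: continuousM; first exact: cst_continuous); last exact: c1.
  exact: continuous_comp c1 (@sqrt_continuous R _).
have mx : 0 < k z1 - k z2 - phi z1.
  have := H1 z2' Kz2'.
  suff : 0 < k z2' - k z2 - phi z2' by lra.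
  rewrite /phi; have : 0 <= e * dotp (z2' - z2) (z2' - z2).
    by apply: mulr_ge0; [exact: ltW|rewrite -enorm_sqr; exact: sqr_ge0].
  lra.
set b := z1 - z2.
have b0 : b != 0.
  apply/eqP => E; move: mx; rewrite /phi -/b E -enorm_sqr (eqP (_ : enorm 0 == 0)) ?enorm_eq0//.
  by move/eqP : E; rewrite subr_eq0 => /eqP->; rewrite expr0n /= !mulr0 !subrr ltxx.
have r1 : 0 < enorm b by rewrite lt_neqAle eq_sym enorm_eq0 b0 enorm_ge0.
have br : enorm b <= 4 * rho.
  apply: (le_trans (enorm_le _)); have : `|b| <= `|z1 - z0| + `|z2 - z0|.
    by rewrite [`|z2 - z0|]distrC; exact: ler_distD.
  by rewrite /K /= in K1; lra.
have phib : 3 / 4 * eta * enorm b <= phi z1.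
  have : e * enorm b <= e * (4 * rho) by rewrite ler_pM2l.
  rewrite /phi -/b -enorm_sqr; nra.
have K1' : `|z1 - z0| < rho.
  rewrite lt_neqAle K1 andbT; apply/eqP => E.
  have := small z1 K1; have := small z2 Kz2; rewrite !ler_norml => /andP[s1 _] /andP[_ s2].
  have := ler_distD z2 z1 z0; rewrite -/b E => s3; have s4 := enorm_ge b.
  nra.
have [r2 r20 Hr2] : exists2 r2 : R, 0 < r2 & forall w : pt, `|w - z1| < r2 ->
    `|w - z0| <= rho /\ `|dotp b (w - z1)| <= dotp b b / 2.
  have bb : 0 < dotp b b by rewrite -enorm_sqr exprn_gt0.
  have cb0 : 0 < 2 * `|b| + 1 by rewrite ltr_wpDl// mulr_ge0.
  exists (Num.min (rho - `|z1 - z0|) (dotp b b / 2 / (2 * `|b| + 1))).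
    by rewrite lt_min subr_gt0 K1' !divr_gt0.
  move=> w; rewrite lt_min => /andP[h1]; rewrite ltr_pdivlMr// => h2; split.
    by have := ler_distD z1 w z0; lra.
  apply: (le_trans (dotp_le _ _)).
  by have := normr_ge0 (w - z1); nra.
pose r := enorm b.
pose c := eta / r - 2 * e.
have cr : c * r = eta - 2 * e * r.
  by rewrite /c mulrBl divfK// gt_eqF.
have c0 : 0 < c.
  rewrite -(pmulr_lgt0 _ r1) cr; have : e * r <= e * (4 * rho) by rewrite ler_pM2l.
  lra.
have rn0 : r != 0 by rewrite gt_eqF.
(* The slope of [phi] at [z1] is [c b], with [c] obtained by differentiating cone and quadratic
   term. The factor [1 / (r^2 c^2)] expresses the concavity through the slope, and [eta / r^3] is
   the tangential curvature of the cone. *)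
apply: (H2 z1 (c *: b) (perp b) (e / (r ^+ 2 * c ^+ 2)) (eta / r ^+ 3) r2) => //.
- exact: lt_trans K1' rr0.
- by rewrite divr_gt0// mulr_gt0// exprn_gt0.
- by rewrite divr_gt0// exprn_gt0.
- rewrite normrZ (gtr0_norm c0); have := enorm_ge b; rewrite -/r => h1.
  have : c * `|b| <= c * r by rewrite ler_pM2l.
  have er0 : 0 < e * r by rewrite mulr_gt0.
  by move: er0 cr etale; clear; lra.
- have -> : crossp (c *: b) (perp b) = c * r ^+ 2.
    rewrite /r enorm_sqr -crossp_perp /crossp /= /GRing.scale /=; ring.
  by rewrite mulf_neq0 ?expf_neq0// gt_eqF.
move=> z /Hr2[Kz zb]; have := H1 z Kz.
have := enorm_expand b0 zb.
rewrite /phi -/b -/r; set w := z - z1.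
have -> : z - z2 = b + w by rewrite /b /w [RHS]addrC addrA subrK.
move=> he hk.
have hsq : dotp (b + w) (b + w) = dotp b b + 2 * dotp b w + dotp w w.
  by clearbody b w; rewrite /dotp /=; ring.
have hw : dotp w w = (dotp b w ^+ 2 + dotp (perp b) w ^+ 2) / r ^+ 2.
  by rewrite -perp_sqr -(enorm_sqr b) -/r; field.
rewrite hsq hw in hk.
have he' : eta * enorm (b + w) <= eta * (r + dotp b w / r + dotp (perp b) w ^+ 2 / r ^+ 3).
  by rewrite ler_pM2l.
have -> : e / (r ^+ 2 * c ^+ 2) * dotp (c *: b) w ^+ 2 = e * (dotp b w ^+ 2 / r ^+ 2).
  by rewrite dotpZl; field; rewrite rn0 gt_eqF.
have -> : dotp (c *: b) w = eta * (dotp b w / r) - 2 * e * dotp b w.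
  by rewrite dotpZl /c; ring.
have -> : eta / r ^+ 3 * dotp (perp b) w ^+ 2 = eta * (dotp (perp b) w ^+ 2 / r ^+ 3) by ring.
have : 0 <= e * (dotp (perp b) w ^+ 2 / r ^+ 2) by apply: mulr_ge0; [exact: ltW|rewrite divr_ge0 ?sqr_ge0].
have : (dotp b w ^+ 2 + dotp (perp b) w ^+ 2) / r ^+ 2 =
  dotp b w ^+ 2 / r ^+ 2 + dotp (perp b) w ^+ 2 / r ^+ 2 by ring.
move: hk he'.
move: (dotp b w / r) (dotp (perp b) w ^+ 2 / r ^+ 3) (dotp (perp b) w ^+ 2 / r ^+ 2)
  (dotp b w ^+ 2 / r ^+ 2) (_ / r ^+ 2) (dotp b w) (dotp b b) => a1 a2 a3 a4 a5 a6 a7.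
move=> hk he'' a5E h0; rewrite a5E in hk.
by move: hk he'' h0; clear; lra.
Qed.

Lemma convex_norm_le (a b : pt) (t m : R) : 0 <= t <= 1 -> `|a| <= m -> `|b| <= m ->
  `|(1 - t) *: a + t *: b| <= m.
Proof.
move=> /andP[t0 t1] am bm; apply: (le_trans (ler_normD _ _)).
rewrite !normrZ (ger0_norm t0) ger0_norm ?subr_ge0//.
have h1 : t * `|b| <= t * m by rewrite ler_wpM2l.
have h2 : (1 - t) * `|a| <= (1 - t) * m by rewrite ler_wpM2l// subr_ge0.
lra.
Qed.

Section Chord.
Variables (k : pt -> R) (z0 tau iota u v : pt) (r0 eta0 eta rho : R).
Hypothesis tu : dotp tau u = 1.
Hypothesis tv : dotp tau v = 0.
Hypothesis iu : dotp iota u = 0.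
Hypothesis iv : dotp iota v = 1.
Hypothesis dec : forall z, z = dotp tau z *: u + dotp iota z *: v.
Hypothesis D0 : crossp tau iota != 0.
Hypothesis rho_le : rho <= r0.
Hypothesis eta_gt0 : 0 < eta.
Hypothesis eta_small : 4 * eta * (`|u| * `|tau| + `|v| * `|iota|) < eta0.
Hypothesis k_cont : forall z, `|z - z0| < r0 -> {for z, continuous k}.
Hypothesis k_axes : touch_axes k z0 tau iota r0 eta0.
Hypothesis k_strong : no_strong_touch k z0 r0 eta0.
Hypothesis k_lip : forall z w, `|z - z0| < rho -> `|w - z0| < rho -> `|k z - k w| <= eta * `|z - w|.

Let u_gt0 : 0 < `|u|.
Proof. by rewrite normr_gt0; apply/eqP => E; move/eqP: tu; rewrite E dotp0r eq_sym oner_eq0. Qed.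

Let v_gt0 : 0 < `|v|.
Proof. by rewrite normr_gt0; apply/eqP => E; move/eqP: iv; rewrite E dotp0r eq_sym oner_eq0. Qed.

(** By [touch_axes] a small slope with nonzero [tau] component must be a multiple of [tau]; strict
    concavity along it is then excluded by [no_strong_touch]. *)
Let no_touch z1 (a b e M r : R) : `|z1 - z0| < r0 -> 0 < r -> 0 < e -> 0 < M -> a != 0 ->
  `|a| <= 2 * eta * `|u| -> `|b| <= 4 * eta * `|v| ->
  (forall z, `|z - z1| < r -> k z <= k z1 + dotp (a *: tau + b *: iota) (z - z1)
    - e * dotp tau (z - z1) ^+ 2 + M * dotp iota (z - z1) ^+ 2) -> False.
Proof.
move=> z1r rp ep Mp a0 ab bb H; set p := a *: tau + b *: iota in H.
have pe : `|p| < eta0.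
  apply: le_lt_trans eta_small; apply: (le_trans (ler_normD _ _)); rewrite !normrZ.
  have : `|a| * `|tau| <= 2 * eta * `|u| * `|tau| by rewrite ler_wpM2r.
  have : `|b| * `|iota| <= 4 * eta * `|v| * `|iota| by rewrite ler_wpM2r.
  have : 0 <= eta * `|u| * `|tau| by rewrite !mulr_ge0// ltW.
  lra.
have b0 : b = 0.
  have C0 : 0 <= M * (2 * `|iota|) ^+ 2 by rewrite mulr_ge0 ?sqr_ge0// ltW.
  have [z zr||] := k_axes z1r rp C0 pe.
  - have := H z zr; have := dotp_le iota (z - z1).
    move: (dotp tau _) (dotp iota _) => x y yb.
    have : 0 <= e * x ^+ 2 by rewrite mulr_ge0 ?sqr_ge0// ltW.
    have : M * y ^+ 2 <= M * (2 * `|iota|) ^+ 2 * `|z - z1| ^+ 2.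
      by rewrite -mulrA ler_pM2l// -exprMn -(real_normK (num_real y)) lerXn2r ?nnegrE// !mulr_ge0.
    lra.
  - have -> : crossp p tau = - (b * crossp tau iota).
      by rewrite /p /crossp /= /GRing.scale /=; ring.
    by move/eqP; rewrite oppr_eq0 mulf_eq0 (negPf D0) orbF => /eqP.
  - have -> : crossp p iota = a * crossp tau iota.
      by rewrite /p /crossp /= /GRing.scale /=; ring.
    by move/eqP; rewrite mulf_eq0 (negPf D0) (negPf a0).
have pE : p = a *: tau by rewrite /p b0 scale0r addr0.
apply: (k_strong z1r rp (_ : 0 < e / a ^+ 2) Mp pe (_ : crossp p iota != 0)).
- by rewrite divr_gt0// exprn_even_gt0.
- rewrite pE (_ : crossp _ _ = a * crossp tau iota) ?mulf_neq0//.
  by rewrite /crossp /= /GRing.scale /=; ring.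
- move=> z /H; rewrite pE; congr (_ <= _ - _ + _); rewrite !dotpZl; field.
  exact: a0.
Qed.

Ltac light := clear - tu tv iu iv dec D0 rho_le eta_gt0 eta_small k_cont k_axes k_strong k_lip
  u_gt0 v_gt0 no_touch.

(** Convexity along [u]. On a thin box around the segment, [k] minus a function that follows the
    chord, is slightly concave in [u] and strongly convex in [v] has no interior maximum by
    [no_touch]. Hence the maximum sits at an end of the segment, which gives the chord inequality up
    to [del]. *)
Lemma chord_le za (l t : R) : 0 <= l -> `|za - z0| < rho -> `|za + l *: u - z0| < rho ->
  0 <= t <= 1 -> k (za + (t * l) *: u) <= (1 - t) * k za + t * k (za + l *: u).
Proof.
rewrite le_eqVlt => /predU1P[<-|l0] Ba Bb /andP[t0 t1].
  by rewrite mulr0 scale0r addr0; lra.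
set zb := za + l *: u in Bb *.
apply/ler_addgt0Pr => del del0.
pose mu := Num.max `|za - z0| `|zb - z0|.
have mu_lt : mu < rho by rewrite gt_max Ba.
have seg (x : R) : 0 <= x <= l -> `|za + x *: u - z0| <= mu.
  move=> /andP[x0 xl].
  have -> : za + x *: u - z0 = (1 - x / l) *: (za - z0) + (x / l) *: (zb - z0).
    have -> : zb - z0 = (za - z0) + l *: u by rewrite /zb addrAC.
    rewrite [(x / l) *: (_ + l *: u)]scalerDr addrA -scalerDl subrK scale1r scalerA divfK ?gt_eqF//.
    by rewrite addrAC.
  apply: convex_norm_le; [|by rewrite /mu le_max lexx|by rewrite /mu le_max lexx orbT].
  by apply/andP; split; [rewrite divr_ge0// ltW|rewrite ler_pdivrMr// mul1r].
pose th0 := (k zb - k za) / l.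
have th0l : th0 * l = k zb - k za by rewrite /th0 divfK// gt_eqF.
have th0b : `|th0| <= eta * `|u|.
  rewrite /th0 normrM normfV (gtr0_norm l0) ler_pdivrMr//.
  have := k_lip Bb Ba; have -> : zb - za = l *: u by rewrite /zb addrC addKr.
  by rewrite normrZ (gtr0_norm l0) mulrA mulrAC.
have eu : 0 < eta * `|u| by rewrite mulr_gt0.
(* The chord slope is replaced by a nearby nonzero one, since [no_touch] says nothing about slopes
   without [tau] component. *)
have [th [th_neq0 thb thl]] : exists th : R, [/\ th != 0, `|th| <= eta * `|u| &
    `|th - th0| * l <= del / 4].
  have d4 : 0 < del / 4 by rewrite divr_gt0.
  have [E|ne] := eqVneq th0 0; last by exists th0; rewrite subrr normr0 mul0r (ltW d4).
  have mp : 0 < Num.min (eta * `|u|) (del / 4 / l) by rewrite lt_min eu divr_gt0.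
  exists (Num.min (eta * `|u|) (del / 4 / l)); rewrite gt_eqF// E subr0 gtr0_norm//; split=> //.
    by rewrite ge_min lexx.
  by rewrite -ler_pdivlMr// ge_min lexx orbT.
have th1 : 0 < `|th| by rewrite normr_gt0.
have l2 : 0 < l ^+ 2 by rewrite exprn_gt0.
pose e := Num.min (`|th| / (4 * l)) (del / 4 / l ^+ 2).
have e0 : 0 < e by rewrite lt_min !divr_gt0// mulr_gt0.
have el : e * l <= `|th| / 4.
  apply: (@le_trans _ _ (`|th| / (4 * l) * l)); first by rewrite ler_pM2r// ge_min lexx.
  by rewrite le_eqVlt; apply/orP; left; apply/eqP; field; rewrite gt_eqF.
have ell : e * l ^+ 2 <= del / 4 by rewrite -ler_pdivlMr// ge_min lexx orbT.
pose A := eta * `|v|.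
have AE : A = eta * `|v| by [].
have A0 : 0 < A by rewrite mulr_gt0.
have gap : 0 < rho - mu by rewrite subr_gt0.
pose Y := Num.min (del / 4 / A) ((rho - mu) / 2 / `|v|).
have Y0 : 0 < Y by rewrite lt_min !divr_gt0.
have AY : A * Y <= del / 4 by rewrite mulrC -ler_pdivlMr// ge_min lexx.
have Yv : Y * `|v| <= (rho - mu) / 2 by rewrite -ler_pdivlMr// ge_min lexx orbT.
(* At [|y| = Y] the penalty is [M Y^2 = 2 A Y], more than the change [A Y] that the Lipschitz bound
   permits, so no maximum lies on the long sides. *)
pose M := 2 * A / Y.
have M0 : 0 < M by rewrite divr_gt0// mulr_gt0.
have MY : M * Y = 2 * A by rewrite /M divfK// gt_eqF.
clearbody M A.
pose phi z := th * dotp tau (z - za) - e * dotp tau (z - za) ^+ 2 + M * dotp iota (z - za) ^+ 2.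
pose K := [set z | (0 <= dotp tau (z - za) <= l) /\ `|dotp iota (z - za)| <= Y].
have Kball (x y : R) : 0 <= x <= l -> `|y| <= Y -> `|za + x *: u + y *: v - z0| < rho.
  move=> xl yY; rewrite addrAC; apply: (le_lt_trans (ler_normD _ _)); rewrite normrZ.
  have := seg x xl; have : `|y| * `|v| <= Y * `|v| by rewrite ler_wpM2r.
  by move: Yv gap; light; lra.
have coord (x y : R) : dotp tau (za + x *: u + y *: v - za) = x /\ dotp iota (za + x *: u + y *: v - za) = y.
  rewrite -[za + _ + _]addrA [za + _]addrC addrK !dotpDr !dotpZr tu tv iu iv.
  by split; ring.
have Kdec z : K z -> exists x y : R, [/\ z = za + x *: u + y *: v, 0 <= x <= l & `|y| <= Y].
  move=> [h1 h2]; exists (dotp tau (z - za)), (dotp iota (z - za)); split=> //.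
  by rewrite -addrA -dec addrC subrK.
have Kin (x y : R) : 0 <= x <= l -> `|y| <= Y -> K (za + x *: u + y *: v).
  by rewrite /K /=; have [-> ->] := coord x y.
have KB z : K z -> `|z - z0| < rho by move=> /Kdec[x [y [-> ? ?]]]; exact: Kball.
have phiE (x y : R) : phi (za + x *: u + y *: v) = th * x - e * x ^+ 2 + M * y ^+ 2.
  by rewrite /phi; have [-> ->] := coord x y.
have cK : closed K.
  have -> : K = [set z | dotp (- tau) z <= - dotp tau za] `&` [set z | dotp tau z <= l + dotp tau za]
    `&` [set z | dotp (- iota) z <= Y - dotp iota za] `&` [set z | dotp iota z <= Y + dotp iota za].
    apply/seteqP; split=> z; rewrite /K /= !dotpBr !dotpNl ler_norml.
      by light; move=> [/andP[? ?] /andP[? ?]]; repeat split; lra.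
    by light; move=> [[[? ?] ?] ?]; split; apply/andP; split; lra.
  by repeat (apply: closedI; last exact: closed_half); exact: closed_half.
have l00 : 0 <= (0 : R) <= l by apply/andP; split; [exact: lexx|exact: ltW].
have ll0 : 0 <= l <= l by apply/andP; split; [exact: ltW|exact: lexx].
have Y00 : `|0 : R| <= Y by rewrite normr0 ltW.
have [|z KZ|z1 K1 H1] := @max_attained K (fun z => k z - phi z) (rho + `|z0|) _ cK _ (Kin 0 0 l00 Y00).
- by move=> z /KB zr; have := ler_normD (z - z0) z0; rewrite subrK; move: zr; light; lra.
- apply: continuousB; first by apply: k_cont; apply: lt_le_trans (KB z KZ) rho_le.
  apply: continuousD; last first.
    by apply: continuousM; [exact: cst_continuous|apply: continuousM; exact: dotp_cont_shift].
  apply: continuousB; (apply: continuousM; first exact: cst_continuous).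
    exact: dotp_cont_shift.
  by apply: continuousM; exact: dotp_cont_shift.
have [x1 [y1 [z1E x1l y1Y]]] := Kdec z1 K1.
have lipy (x y y' : R) : 0 <= x <= l -> `|y| <= Y -> `|y'| <= Y ->
    k (za + x *: u + y *: v) <= k (za + x *: u + y' *: v) + A * `|y - y'|.
  move=> xl yY yY'; have := k_lip (Kball x y xl yY) (Kball x y' xl yY').
  have -> : za + x *: u + y *: v - (za + x *: u + y' *: v) = (y - y') *: v.
    by rewrite opprD addrACA subrr add0r scalerBl.
  by rewrite normrZ ler_norml AE => /andP[_]; light; lra.
suff key : k z1 - phi z1 <= Num.max (k za) (k zb - th * l) + del / 2.
  have tl : 0 <= t * l <= l.
    by apply/andP; split; [rewrite mulr_ge0// ltW|rewrite ler_piMl// ltW].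
  have := H1 _ (Kin (t * l) 0 tl Y00).
  rewrite phiE scale0r addr0 expr0n /= mulr0 addr0 => h1.
  have h2 : 0 <= e * (t * l) ^+ 2 by rewrite mulr_ge0 ?sqr_ge0// ltW.
  have [d1 d2] : - (del / 4) <= (th - th0) * l /\ (th - th0) * l <= del / 4.
    by apply/andP; rewrite -ler_norml normrM (gtr0_norm l0).
  move: key; rewrite -lerBlDr le_max => /orP[] h3.
    have : t * ((th - th0) * l) <= 1 * (del / 4).
      by apply: (le_trans (_ : _ <= t * (del / 4))); [rewrite ler_wpM2l|rewrite ler_wpM2r// divr_ge0// ltW].
    have : t * (th0 * l) = t * (k zb - k za) by rewrite th0l.
    by move: h1 h2 h3 d2 del0; light; lra.
  have : (1 - t) * (- ((th - th0) * l)) <= 1 * (del / 4).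
    apply: (le_trans (_ : _ <= (1 - t) * (del / 4))); first by rewrite ler_wpM2l ?subr_ge0//; move: d1; light; lra.
    by rewrite ler_wpM2r ?divr_ge0 ?(ltW del0)//; move: t0; light; lra.
  have : (1 - t) * (th0 * l) = (1 - t) * (k zb - k za) by rewrite th0l.
  by move: h1 h2 h3 ell del0; light; lra.
have y1n : `|y1| < Y.
  rewrite lt_neqAle y1Y andbT; apply/eqP => E.
  have := H1 _ (Kin x1 0 x1l Y00); rewrite z1E !phiE.
  have := lipy x1 y1 0 x1l y1Y Y00; rewrite subr0 E expr0n /= mulr0.
  have -> : M * y1 ^+ 2 = 2 * (A * Y) by rewrite -(real_normK (num_real y1)) E mulrA -MY; ring.
  have : 0 < A * Y by rewrite mulr_gt0.
  by light; lra.
have ends (x : R) : 0 <= x <= l -> k (za + x *: u + y1 *: v) - phi (za + x *: u + y1 *: v) <=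
    k (za + x *: u) - th * x + e * x ^+ 2 + del / 4.
  move=> xl; rewrite phiE; have := lipy x y1 0 xl y1Y Y00.
  rewrite subr0 scale0r addr0.
  have : 0 <= M * y1 ^+ 2 by rewrite mulr_ge0 ?sqr_ge0// ltW.
  have : A * `|y1| <= A * Y by rewrite ler_pM2l.
  by move: AY; light; lra.
have [x10|x10] := eqVneq x1 0.
  have := ends 0 l00; rewrite z1E x10 scale0r addr0 expr0n /= !mulr0 subr0 addr0.
  have : k za <= Num.max (k za) (k zb - th * l) by rewrite le_max lexx.
  by move: del0; light; lra.
have [x1L|x1L] := eqVneq x1 l.
  have := ends l ll0; rewrite z1E x1L -/zb.
  have : k zb - th * l <= Num.max (k za) (k zb - th * l) by rewrite le_max lexx orbT.
  by move: ell del0; light; lra.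
exfalso; move/andP : x1l => [x1a x1b].
have {}x1a : 0 < x1 by rewrite lt_neqAle eq_sym x10.
have {}x1b : x1 < l by rewrite lt_neqAle x1L.
have [z1x z1y] : dotp tau (z1 - za) = x1 /\ dotp iota (z1 - za) = y1 by rewrite z1E; exact: coord.
pose r := Num.min (Num.min x1 (l - x1) / (2 * `|tau| + 1)) ((Y - `|y1|) / (2 * `|iota| + 1)).
have t10 : 0 < 2 * `|tau| + 1 by rewrite ltr_wpDl// mulr_ge0.
have i10 : 0 < 2 * `|iota| + 1 by rewrite ltr_wpDl// mulr_ge0.
have rp : 0 < r by rewrite lt_min !divr_gt0 ?lt_min ?x1a ?subr_gt0.
have e1 : e * x1 <= `|th| / 4.
  by apply: le_trans el; rewrite ler_pM2l// ltW.
have ex0 : 0 < e * x1 by rewrite mulr_gt0.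
apply: (@no_touch z1 (th - 2 * e * x1) (2 * M * y1) e M r) => //.
- exact: lt_le_trans (KB z1 K1) rho_le.
- apply/eqP => E; have : `|th| = 2 * e * x1 by rewrite (subr0_eq E) gtr0_norm// !mulr_gt0.
  by move: e1 th1; light; lra.
- apply: (le_trans (ler_normB _ _)); rewrite (@gtr0_norm _ (2 * e * x1)) ?mulr_gt0 ?pmulr_rgt0//.
  by move: thb e1 th1; light; lra.
- rewrite normrM gtr0_norm ?mulr_gt0//.
  have : M * `|y1| <= M * Y by rewrite ler_pM2l.
  by rewrite MY AE; light; lra.
move=> z; rewrite lt_min !ltr_pdivlMr// lt_min => /andP[/andP[h1 h2] h3].
have hx := dotp_le tau (z - z1); have hy := dotp_le iota (z - z1).
have zz : 0 <= `|z - z1| by [].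
have zx : dotp tau (z - za) = x1 + dotp tau (z - z1) by rewrite -z1x !dotpBr; ring.
have zy : dotp iota (z - za) = y1 + dotp iota (z - z1) by rewrite -z1y !dotpBr; ring.
have Kz : K z.
  rewrite /K /= zx zy; split.
    by move: hx h1 h2 zz; rewrite ler_norml; light; move=> /andP[? ?] *; apply/andP; split; lra.
  by apply: (le_trans (ler_normD _ _)); move: hy h3 zz; light; lra.
have := H1 z Kz; rewrite /phi z1x z1y zx zy dotpDl !dotpZl.
move: (dotp tau _) (dotp iota _) => x y.
by light; lra.
Qed.

End Chord.

Lemma grad0_slope (k : pt -> R) z0 w (a be : R) : 0 < a -> has_grad k z0 0 -> k z0 = 0 ->
  (forall x, `|x| <= a -> k (z0 + x *: w) = be * x) -> be = 0.
Proof.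
move=> a0 /has_gradP kd k0 H; apply/eqP; apply/negPn/negP => bn.
have b0 : 0 < `|be| by rewrite normr_gt0.
have w0 : 0 < `|w| + 1 by rewrite ltr_wpDl.
have [d d0 Hd] := kd _ (divr_gt0 b0 w0).
pose x := Num.min a (d / (`|w| + 1) / 2).
have x0 : 0 < x by rewrite lt_min a0 !divr_gt0.
have xd : x * (`|w| + 1) < d.
  have : x * (`|w| + 1) <= d / 2 by rewrite -ler_pdivlMr// mulrAC ge_min lexx orbT.
  lra.
have Hx : k (z0 + x *: w) = be * x by apply: H; rewrite gtr0_norm// ge_min lexx.
have zw : z0 + x *: w - z0 = x *: w by rewrite addrC addKr.
have := Hd (z0 + x *: w); rewrite zw normrZ (gtr0_norm x0) => /(_ _).
rewrite k0 dotp0l !subr0 Hx.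
have xw : x * `|w| < x * (`|w| + 1) by rewrite ltr_pM2l// ltrDl.
move=> /(_ (lt_trans xw xd)); rewrite normrM (gtr0_norm x0) mulrAC ler_pdivlMr// -!mulrA.
by rewrite ler_pM2l// leNgt xw.
Qed.

Definition negf (k : pt -> R) z : R := - k z.

(** The chord inequality for [k] and for its negative. *)
Lemma chord_eq k z0 tau iota u v (r0 eta0 eta rho : R) :
  dotp tau u = 1 -> dotp tau v = 0 -> dotp iota u = 0 -> dotp iota v = 1 ->
  (forall z, z = dotp tau z *: u + dotp iota z *: v) -> crossp tau iota != 0 -> rho <= r0 ->
  0 < eta -> 4 * eta * (`|u| * `|tau| + `|v| * `|iota|) < eta0 ->
  (forall z, `|z - z0| < r0 -> {for z, continuous k}) ->
  touch_axes k z0 tau iota r0 eta0 -> no_strong_touch k z0 r0 eta0 ->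
  touch_axes (negf k) z0 tau iota r0 eta0 -> no_strong_touch (negf k) z0 r0 eta0 ->
  (forall z w, `|z - z0| < rho -> `|w - z0| < rho -> `|k z - k w| <= eta * `|z - w|) ->
  forall zm (a x : R), 0 < a -> `|x| <= a ->
  `|zm - a *: u - z0| < rho -> `|zm + a *: u - z0| < rho ->
  2 * a * k (zm + x *: u) = (a - x) * k (zm - a *: u) + (a + x) * k (zm + a *: u).
Proof.
move=> tu tv iu iv dec D0 rr e0 es kc kx ks nkx nks kl zm a x a0 xa Ba Bb.
have nkc z : `|z - z0| < r0 -> {for z, continuous (negf k)}.
  by move=> /kc; exact: continuousN.
have nkl z w : `|z - z0| < rho -> `|w - z0| < rho -> `|negf k z - negf k w| <= eta * `|z - w|.
  by move=> Bz Bw; rewrite /negf -opprD normrN; exact: kl.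
have a2 : 0 <= 2 * a by rewrite mulr_ge0// ltW.
have t01 : 0 <= (a + x) / (2 * a) <= 1.
  move: xa; rewrite ler_norml => /andP[x1 x2]; apply/andP; split.
    by rewrite divr_ge0//; lra.
  by rewrite ler_pdivrMr ?mulr_gt0//; lra.
have zb : zm - a *: u + (2 * a) *: u = zm + a *: u.
  by rewrite -addrA -scaleNr -scalerDl; congr (_ + _ *: _); ring.
have zx : zm - a *: u + ((a + x) / (2 * a) * (2 * a)) *: u = zm + x *: u.
  rewrite divfK ?gt_eqF ?mulr_gt0// -addrA -scaleNr -scalerDl.
  by congr (_ + _ *: _); ring.
have Bb' : `|zm - a *: u + (2 * a) *: u - z0| < rho by rewrite zb.
have := chord_le tu tv iu iv dec D0 rr e0 es kc kx ks kl a2 Ba Bb' t01.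
have := chord_le tu tv iu iv dec D0 rr e0 es nkc nkx nks nkl a2 Ba Bb' t01.
rewrite zx zb /negf; set t := (a + x) / (2 * a).
have ta : t * (2 * a) = a + x by rewrite /t divfK// gt_eqF// mulr_gt0.
have -> : x = t * (2 * a) - a by rewrite ta; ring.
move: (k _) (k _) (k _) => k1 k2 k3 h1 h2.
have -> : k3 = (1 - t) * k2 + t * k1 by apply/le_anti/andP; split; lra.
ring.
Qed.

(** Both coordinates can play the role of [tau], so [k] is affine along each of the dual directions
    and therefore bilinear near [z0]. Value and gradient at [z0] remove all terms but the product,
    and the product has gradients off both axes. *)
Lemma touch_rigid (k : pt -> R) z0 tau iota (r0 eta0 : R) : crossp tau iota != 0 ->
  0 < r0 -> 0 < eta0 -> (forall z, `|z - z0| < r0 -> {for z, continuous k}) ->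
  touch_axes k z0 tau iota r0 eta0 -> no_strong_touch k z0 r0 eta0 ->
  touch_axes (negf k) z0 tau iota r0 eta0 -> no_strong_touch (negf k) z0 r0 eta0 ->
  has_grad k z0 0 -> k z0 = 0 -> exists2 r : R, 0 < r & forall z, `|z - z0| < r -> k z = 0.
Proof.
move=> D0 r00 eta00 kc kx ks nkx nks kd k0.
have [tu tv iu iv] := dot_dual D0.
set u := dualx tau iota in tu iu; set v := dualy tau iota in tv iv.
have dec z : z = dotp tau z *: u + dotp iota z *: v by exact: dual_dec.
have D0' : crossp iota tau != 0.
  by rewrite (_ : crossp _ _ = - crossp tau iota) ?oppr_eq0// /crossp; ring.
pose SS := `|u| * `|tau| + `|v| * `|iota|.
have SS0 : 0 <= SS by rewrite addr_ge0// mulr_ge0.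
have SS1 : 0 < 4 * SS + 1 by rewrite ltr_wpDl// mulr_ge0.
pose eta := eta0 / (4 * SS + 1).
have eta_gt0 : 0 < eta by rewrite divr_gt0.
have etaE : eta * (4 * SS + 1) = eta0 by rewrite divfK// gt_eqF.
have etas : 4 * eta * SS < eta0 by lra.
have etaS : 0 <= eta * SS by rewrite mulr_ge0// ltW.
have etale : eta <= eta0 by lra.
have [rho1 rho10 kl1] := small_lipschitz r00 eta_gt0 etale kc ks kd k0.
pose rho := Num.min rho1 r0.
have rho0 : 0 < rho by rewrite lt_min rho10.
have rr : rho <= r0 by rewrite ge_min lexx orbT.
have kl z w : `|z - z0| < rho -> `|w - z0| < rho -> `|k z - k w| <= eta * `|z - w|.
  by rewrite !lt_min => /andP[h1 _] /andP[h2 _]; exact: kl1.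
have uv0 : 0 < `|u| + `|v| + 1 by rewrite ltr_wpDl// addr_ge0.
pose a := rho / (`|u| + `|v| + 1).
have a0 : 0 < a by rewrite divr_gt0.
have aE : a * (`|u| + `|v| + 1) = rho by rewrite divfK// gt_eqF.
clearbody a.
have inb (x y : R) : `|x| <= a -> `|y| <= a -> `|z0 + x *: u + y *: v - z0| < rho.
  move=> xa ya; have -> : z0 + x *: u + y *: v - z0 = x *: u + y *: v.
    by rewrite -[z0 + _ + _]addrA [z0 + _]addrC addrK.
  apply: (le_lt_trans (ler_normD _ _)); rewrite !normrZ -aE.
  have : `|x| * `|u| <= a * `|u| by rewrite ler_wpM2r.
  have : `|y| * `|v| <= a * `|v| by rewrite ler_wpM2r.
  lra.
pose f (x y : R) := k (z0 + x *: u + y *: v).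
have aa : `|a| <= a by rewrite gtr0_norm.
have naa : `|- a| <= a by rewrite normrN.
have fx (x y : R) : `|x| <= a -> `|y| <= a -> 2 * a * f x y = (a - x) * f (- a) y + (a + x) * f a y.
  move=> xa ya.
  have sw (x' : R) : z0 + x' *: u + y *: v = z0 + y *: v + x' *: u by rewrite addrAC.
  have := @chord_eq k z0 tau iota u v r0 eta0 eta rho tu tv iu iv dec D0 rr eta_gt0 etas kc kx ks nkx nks kl
    (z0 + y *: v) a x a0 xa.
  rewrite -!scaleNr -!sw => h; apply: h; exact: inb.
have fy (x y : R) : `|x| <= a -> `|y| <= a -> 2 * a * f x y = (a - y) * f x (- a) + (a + y) * f x a.
  move=> xa ya.
  have dec' z : z = dotp iota z *: v + dotp tau z *: u by rewrite addrC.
  have etas' : 4 * eta * (`|v| * `|iota| + `|u| * `|tau|) < eta0 by rewrite [X in _ * X]addrC.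
  have kx' : touch_axes k z0 iota tau r0 eta0.
    by move=> z1 p C r h1 h2 h3 h4 h5; case: (kx z1 p C r h1 h2 h3 h4 h5); [right|left].
  have nkx' : touch_axes (negf k) z0 iota tau r0 eta0.
    by move=> z1 p C r h1 h2 h3 h4 h5; case: (nkx z1 p C r h1 h2 h3 h4 h5); [right|left].
  have := @chord_eq k z0 iota tau v u r0 eta0 eta rho iv iu tv tu dec' D0' rr eta_gt0 etas' kc kx' ks nkx' nks kl
    (z0 + x *: u) a y a0 ya.
  by rewrite -!scaleNr => h; apply: h; exact: inb.
pose al := (f (- a) (- a) + f (- a) a + f a (- a) + f a a) / 4.
pose be := (f a (- a) + f a a - f (- a) (- a) - f (- a) a) / (4 * a).
pose ga := (f (- a) a + f a a - f (- a) (- a) - f a (- a)) / (4 * a).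
pose de := (f (- a) (- a) - f (- a) a - f a (- a) + f a a) / (4 * a ^+ 2).
have fE (x y : R) : `|x| <= a -> `|y| <= a -> f x y = al + be * x + ga * y + de * (x * y).
  move=> xa ya; have a4 : 4 * a ^+ 2 != 0 by rewrite mulf_neq0// expf_neq0// gt_eqF.
  apply: (mulfI a4).
  have -> : 4 * a ^+ 2 * f x y = 2 * a * (2 * a * f x y) by ring.
  have h1 := fy (- a) y naa ya; have h2 := fy a y aa ya.
  rewrite (fx x y xa ya).
  have -> : 2 * a * ((a - x) * f (- a) y + (a + x) * f a y) =
    (a - x) * (2 * a * f (- a) y) + (a + x) * (2 * a * f a y) by ring.
  by rewrite h1 h2 /al /be /ga /de; field; rewrite gt_eqF.
have n0 : `|0 : R| <= a by rewrite normr0 ltW.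
have f0 : f 0 0 = 0 by rewrite /f !scale0r !addr0.
have al0 : al = 0 by have := fE 0 0 n0 n0; rewrite f0; clear; lra.
have be0 : be = 0.
  apply: (grad0_slope a0 kd k0 (w := u)) => x xa.
  by have := fE x 0 xa n0; rewrite /f scale0r addr0 al0; clear; lra.
have ga0 : ga = 0.
  apply: (grad0_slope a0 kd k0 (w := v)) => y ya.
  by have := fE 0 y n0 ya; rewrite /f scale0r addr0 al0; clear; lra.
have {}fE (x y : R) : `|x| <= a -> `|y| <= a -> f x y = de * (x * y).
  by move=> xa ya; rewrite fE// al0 be0 ga0; ring.
clearbody de.
have t10 : 0 < 2 * `|tau| + 1 by rewrite ltr_wpDl// mulr_ge0.
have i10 : 0 < 2 * `|iota| + 1 by rewrite ltr_wpDl// mulr_ge0.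
pose r := Num.min (a / 2 / (2 * `|tau| + 1)) (a / 2 / (2 * `|iota| + 1)).
have rp : 0 < r by rewrite lt_min !divr_gt0.
have small w : `|w| < r -> `|dotp tau w| < a / 2 /\ `|dotp iota w| < a / 2.
  rewrite lt_min !ltr_pdivlMr// => /andP[h1 h2].
  have hx := dotp_le tau w; have hy := dotp_le iota w; have := normr_ge0 w.
  by move: h1 h2 hx hy; clear => *; split; lra.
suff de0 : de = 0.
  exists r => // z /small[h1 h2]; have a2 : a / 2 <= a by clear - a0; lra.
  have := fE _ _ (ltW (lt_le_trans h1 a2)) (ltW (lt_le_trans h2 a2)).
  by rewrite /f -addrA -dec [z0 + _]addrC subrK de0 mul0r.
apply/eqP; apply/negPn/negP => dn.
have d0 : 0 < `|de| by rewrite normr_gt0.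
pose T := `|de| * (`|tau| + `|iota|) + 1.
have T0 : 0 < T by rewrite ltr_wpDl// mulr_ge0// addr_ge0.
(* At the point with coordinates [(x1, x1)] the gradient of [de x y] is [de x1 (tau + iota)], on
   neither axis. Small [x1] brings it below [eta0], and the remainder [de x y] around that point is
   bounded by a paraboloid. *)
pose x1 := Num.min (a / 2) (eta0 / T).
have x10 : 0 < x1 by rewrite lt_min !divr_gt0.
have x1a : x1 <= a / 2 by rewrite ge_min lexx.
have x1T : x1 * T <= eta0 by rewrite -ler_pdivlMr// ge_min lexx orbT.
have x1a' : `|x1| <= a by rewrite gtr0_norm//; clear - x1a a0; lra.
pose z1 := z0 + x1 *: u + x1 *: v.
have z1r : `|z1 - z0| < r0 by apply: lt_le_trans (inb x1 x1 x1a' x1a') rr.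
pose p := (de * x1) *: (tau + iota).
have pe : `|p| < eta0.
  apply: lt_le_trans x1T; rewrite /p normrZ normrM (gtr0_norm x10) mulrAC mulrC.
  rewrite ltr_pM2l//; apply: (le_lt_trans (_ : _ <= `|de| * (`|tau| + `|iota|))).
    by rewrite ler_pM2l// ler_normD.
  by rewrite /T ltrDl.
have C0 : 0 <= `|de| * ((2 * `|tau|) * (2 * `|iota|)) by rewrite !mulr_ge0.
have [z zr||] := kx z1 p _ r z1r rp C0 pe.
- have [h1 h2] := small _ zr; have h3 := dotp_le tau (z - z1); have h4 := dotp_le iota (z - z1).
  have zE : z = z0 + (x1 + dotp tau (z - z1)) *: u + (x1 + dotp iota (z - z1)) *: v.
    have vE (a1 b1 c1 d1 e1 : pt) : a1 + (b1 + d1) + (c1 + e1) = a1 + b1 + c1 + (d1 + e1).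
      by rewrite [RHS]addrACA -[a1 + b1 + d1]addrA.
    by rewrite (scalerDl u x1) (scalerDl v x1) vE -/z1 -dec addrC subrK.
  have -> : k z = de * ((x1 + dotp tau (z - z1)) * (x1 + dotp iota (z - z1))).
    rewrite -fE ?/f -?zE//; apply: (le_trans (ler_normD _ _)); rewrite (gtr0_norm x10).
      by clear - x1a h1; lra.
    by clear - x1a h2; lra.
  have -> : k z1 = de * (x1 * x1) by exact: (fE x1 x1).
  rewrite /p dotpZl dotpDl.
  have h5 : `|de * (dotp tau (z - z1) * dotp iota (z - z1))| <=
      `|de| * ((2 * `|tau|) * (2 * `|iota|)) * `|z - z1| ^+ 2.
    rewrite normrM -[leRHS]mulrA ler_pM2l// normrM.
    have -> : 2 * `|tau| * (2 * `|iota|) * `|z - z1| ^+ 2 =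
      (2 * `|tau| * `|z - z1|) * (2 * `|iota| * `|z - z1|) by ring.
    exact: ler_pM.
  by have := le_trans (ler_norm _) h5; clear; lra.
- have -> : crossp p tau = de * x1 * crossp iota tau.
    by rewrite /p /crossp /= /GRing.scale /=; ring.
  by move/eqP; rewrite !mulf_eq0 (negPf dn) (negPf D0') gt_eqF.
- have -> : crossp p iota = de * x1 * crossp tau iota.
    by rewrite /p /crossp /= /GRing.scale /=; ring.
  by move/eqP; rewrite !mulf_eq0 (negPf dn) (negPf D0) gt_eqF.
Qed.

End TouchRigidity.

(** * Reflection and local affinity *)

Section Reflection.
Variable R : realType.
Notation pt := (R * R)%type.
Local Notation mu2 := (@leb2 R).
Implicit Types (z w g d p s tau iota : pt) (A N Good : set pt) (E : seq (pt * R)).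

Definition negs A : set pt := [set x | A (- x)].

Lemma negfK (h : pt -> R) : negf (negf h) = h.
Proof. by apply/funext => x; rewrite /negf opprK. Qed.

Lemma has_grad_negf (u : pt -> R) z g : has_grad (negf u) z g <-> has_grad u z (- g).
Proof.
split=> H; last by rewrite -[g]opprK; exact: has_gradN.
by rewrite -[u]negfK; exact: has_gradN.
Qed.

Lemma gradf_negf (u : pt -> R) z : gradf (negf u) z = - gradf u z.
Proof.
have [[g Hg]|ng] := pselect (exists g, has_grad u z g).
  rewrite (gradfE Hg); apply: gradfE; apply/has_grad_negf; by rewrite opprK.
have d0 (v : pt -> R) : (forall g, ~ has_grad v z g) -> gradf v z = 0.
  by rewrite /gradf => nv; case: xgetP => // g _ /= /nv.
rewrite !d0 ?oppr0// => g H; apply: ng; [by exists g|].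
by exists (- g); apply/has_grad_negf.
Qed.

Lemma closed_negs A : closed A -> closed (negs A).
Proof.
move=> /closedP cA; apply/closedP => z H; apply: cA => r /H[w nw wz].
by exists (- w) => //; rewrite -opprD normrN.
Qed.

Lemma open_negs A : open A -> open (negs A).
Proof.
move=> /openP oA; apply/openP => z /oA[r r0 H]; exists r => // w wz.
by apply: H; rewrite -opprD normrN.
Qed.

Lemma energy_negf (sigma : pt -> R) Om (u : pt -> R) :
  energy (fun x => sigma (- x)) Om (negf u) = energy sigma Om u.
Proof. by rewrite /energy; under eq_fun do rewrite gradf_negf opprK. Qed.

(** Reflection turns contact from below into contact from above, so every touching lemma applies to
    both sides. *)
Lemma setting_neg Om F N Good (sigma h : pt -> R) : setting Om F N Good sigma h ->
  setting Om F (negs N) (negs Good) (fun x => sigma (- x)) (negf h).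
Proof.
move=> S.
have aeE u : [set z | Om z /\ ~ exists g, has_grad (negf u) z g /\ negs N g] =
    [set z | Om z /\ ~ exists g, has_grad u z g /\ N g].
  apply/seteqP; split=> z [Oz ng]; split=> // -[g [Hg Ng]]; apply: ng; exists (- g); split.
  - by apply/has_grad_negf; rewrite opprK.
  - by rewrite /negs /= opprK.
  - exact/has_grad_negf.
  - exact: Ng.
split.
- exact: s_open S.
- exact: s_bdd S.
- exact: s_Fopen S.
- exact: s_FOm S.
- exact: closed_negs (s_Nclosed S).
- by move=> x y t Nx Ny t01; rewrite /negs /= opprD -!scalerN; exact: (s_Nconv S).
- move=> p /(s_Nhalf S)[nu [b [nu0 pb Nb]]]; exists (- nu), b; split.
  + by move=> /eqP; rewrite oppr_eq0 => /eqP.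
  + by rewrite dotpNl -dotpNr.
  + by move=> x /Nb; rewrite dotpNl -dotpNr.
- exact: open_negs (s_Gopen S).
- by move=> x; exact: (s_GN S).
- by move=> x y t Nx Ny t01; rewrite opprD -!scalerN; exact: (s_sconv S).
- apply/within_continuousP => z Nz e e0.
  have /within_continuousP /(_ _ Nz e e0)[d d0 H] := s_scont S.
  by exists d => // w Nw wz; apply: H => //; rewrite -opprD normrN.
- by have [M HM] := s_sbdd S; exists M => x; exact: HM.
- move=> p /(s_strict S)[g0 [H1 H2]]; exists (- g0); split=> x Nx.
    by have := H1 _ Nx; rewrite dotpNl -dotpNr opprB opprK [p + _]addrC.
  by move=> Gx; have := H2 _ Nx Gx; rewrite dotpNl -dotpNr opprB opprK [p + _]addrC.
- have [K K0 HK] := s_lip S; exists K => // x y Ox Oy.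
  by rewrite /negf -opprD normrN; exact: HK.
- by rewrite aeE; exact: s_ae S.
- by move=> z x Fz /has_grad_negf; exact: (s_frozen S).
- move=> u [K Ku] au bu; rewrite energy_negf -[u]negfK energy_negf.
  apply: (s_min S).
  + by exists K => x y Ox Oy; rewrite /negf -opprD normrN; exact: Ku.
  + by rewrite -aeE negfK.
  + by move=> z /bu; rewrite /negf => ->; rewrite opprK.
Qed.

Definition supports N E := forall e, e \in E -> e.1 <> 0 /\ forall x, N x -> e.2 <= dotp e.1 x.

Definition inward Good nu p := forall w, 0 < dotp nu w ->
  exists2 d0 : R, 0 < d0 & forall d : R, 0 < d < d0 -> Good (p + d *: w).

(* Near s the set N minus Good is contained in at most two lines through s, directed by tau and
   iota, and it is contained in edges of N through s. *)
Definition frozen_germ N Good E s tau iota (eta0 : R) := forall p, N p -> ~ Good p ->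
  `|p - s| < eta0 -> p <> s ->
  (crossp (p - s) tau = 0 \/ crossp (p - s) iota = 0) /\
  exists2 e, e \in E & [/\ dotp e.1 s = e.2, dotp e.1 p = e.2 & inward Good e.1 p].

(** The constant is kept because the product of [- e.1] with [- x] equals that of [e.1] with [x]. *)
Definition nege (e : pt * R) : pt * R := (- e.1, e.2).

Lemma supports_neg N E : supports N E -> supports (negs N) (map nege E).
Proof.
move=> H _ /mapP[e /H[e0 He] ->]; split=> /=.
  by move=> /eqP; rewrite oppr_eq0 => /eqP.
by move=> x /He; rewrite dotpNl -dotpNr.
Qed.

Lemma frozen_germ_neg N Good E s tau iota (eta0 : R) : frozen_germ N Good E s tau iota eta0 ->
  frozen_germ (negs N) (negs Good) (map nege E) (- s) tau iota eta0.
Proof.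
move=> H p Np Gp ps pns.
have [||c [e eE [e1 e2 e3]]] := H (- p) Np Gp.
- by rewrite -opprD normrN -[s]opprK.
- by move=> E'; apply: pns; rewrite -E' opprK.
have cE d : crossp (- p - s) d = - crossp (p - - s) d.
  by rewrite /crossp /=; ring.
split.
  by rewrite !cE in c; case: c => /eqP; rewrite oppr_eq0 => /eqP; [left|right].
exists (nege e); first exact: map_f.
rewrite /nege /= !dotpNl -!dotpNr opprK; split=> // w; rewrite dotpNl -dotpNr => /e3[d0 d00 Hd].
by exists d0 => // d /Hd; rewrite /negs /= opprD -scalerN.
Qed.

(** Failure of tightness, witnessed by a finite piece of the ray inside [Om]. The strict inequality
    makes it an open condition in [z], which the contact arguments need. *)
Definition slack (Om : set pt) (h : pt -> R) (e : pt * R) z := exists2 Y : R, 0 <= Y /\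
  (forall t : R, 0 <= t <= Y -> Om (z - t *: e.1)) & h (z - Y *: e.1) < h z - Y * e.2.

Lemma slack_near Om F N Good sigma h e z : setting Om F N Good sigma h -> slack Om h e z ->
  exists2 r : R, 0 < r & forall w, `|w - z| < r -> slack Om h e w.
Proof.
move=> S [Y [Y0 seg] hY].
have Oz : Om z by have := seg 0; rewrite scale0r subr0; apply; rewrite lexx.
have Oy : Om (z - Y *: e.1) by apply: seg; rewrite Y0 lexx.
pose K : set pt := [set w | exists2 t, 0 <= t <= Y & w = z + t *: (- e.1)].
have KOm : K `<=` Om by move=> w [t /seg + ->]; rewrite scalerN.
have [r1 r10 Hr1] := tube (@compact_ray _ z (- e.1) Y) (s_open S) KOm.
pose m := (h z - Y * e.2 - h (z - Y *: e.1)) / 2.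
have m0 : 0 < m by rewrite divr_gt0// subr_gt0.
have /continuousP_norm /(_ _ m0)[r2 r20 Hr2] := setting_contz S Oz.
have /continuousP_norm /(_ _ m0)[r3 r30 Hr3] := setting_contz S Oy.
exists (Num.min r1 (Num.min r2 r3)); first by rewrite !lt_min r10 r20.
move=> w; rewrite !lt_min => /and3P[w1 w2 w3].
exists Y.
  split=> // t t0; apply: (Hr1 (z - t *: e.1)).
    by exists t => //; rewrite scalerN.
  by rewrite opprB addrA subrK.
have := Hr2 w w2; have := Hr3 (w - Y *: e.1).
rewrite opprB addrA subrK => /(_ w3); rewrite !ltr_norml /m => /andP[_ h1] /andP[h2 _].
lra.
Qed.

Section Rigid.
Variables (Om F N Good : set pt) (sigma h : pt -> R).
Hypothesis S : setting Om F N Good sigma h.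
Variables (z0 s tau iota : pt) (r0 eta0 : R) (E : seq (pt * R)).
Hypothesis NE : supports N E.
Hypothesis germ : frozen_germ N Good E s tau iota eta0.
Hypothesis BF : forall z, `|z - z0| < r0 -> F z.
Hypothesis Bslack : forall z e, `|z - z0| < r0 -> e \in E -> dotp e.1 s = e.2 -> slack Om h e z.
Let k z := h z - h z0 - dotp s (z - z0).

Let touch_frozen z1 p (C r : R) : `|z1 - z0| < r0 -> 0 < r -> 0 <= C ->
  (forall z, `|z - z1| < r -> k z <= k z1 + dotp p (z - z1) + C * `|z - z1| ^+ 2) ->
  N (s + p) /\ ~ Good (s + p).
Proof.
move=> z1r rp C0 H; have Fz := BF z1r.
have H' z : `|z - z1| < r -> h z <= h z1 + dotp (s + p) (z - z1) + C * `|z - z1| ^+ 2.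
  by move=> /H; rewrite /k dotpDl !(dotpBr s); lra.
split; first exact: (touch_N S (s_FOm S Fz) rp C0 H').
exact: (touch_notGood S Fz rp C0 H').
Qed.

Lemma setting_touch_axes : touch_axes k z0 tau iota r0 eta0.
Proof.
move=> z1 p C r z1r rp C0 pe H; have [Np Gp] := touch_frozen z1r rp C0 H.
have [->|p0] := eqVneq p 0; first by left; rewrite /crossp /= !mul0r subrr.
have [||] := germ Np Gp; rewrite ?[s + p - s]addrC ?addKr//.
by move=> /eqP; rewrite -subr_eq0 addrC addKr (negPf p0).
Qed.

(** Since the slope [s + p] is frozen, it lies with [s] on an edge of N, so [p] is parallel to that
    edge. The ray of this edge is slack at [z1], and [touch_edge] applies with [tau := p]. *)
Lemma setting_no_strong_touch : no_strong_touch k z0 r0 eta0.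
Proof.
move=> z1 p io e M r z1r rp e0 M0 pe cr H.
have C0 : 0 <= M * (2 * `|io|) ^+ 2 by rewrite mulr_ge0 ?sqr_ge0// ltW.
have [Np Gp] : N (s + p) /\ ~ Good (s + p).
  apply: (touch_frozen z1r rp C0) => z zr; have := H z zr; have := dotp_le io (z - z1).
  move: (dotp p _) (dotp io _) => x y yb.
  have : 0 <= e * x ^+ 2 by rewrite mulr_ge0 ?sqr_ge0// ltW.
  have : M * y ^+ 2 <= M * (2 * `|io|) ^+ 2 * `|z - z1| ^+ 2.
    by rewrite -mulrA ler_pM2l// -exprMn -(real_normK (num_real y)) lerXn2r ?nnegrE// !mulr_ge0.
  lra.
have sp : s + p - s = p by rewrite addrC addKr.
have [||_ [[nu b] eE /= [es ep inw]]] := germ Np Gp; rewrite ?sp//.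
  by move=> /eqP; rewrite -subr_eq0 sp => /eqP p0; move: cr; rewrite p0 /crossp /= !mul0r subrr eqxx.
have [nu0 Nnu] := NE eE; rewrite /= in nu0 Nnu.
have np : dotp nu p = 0 by move: ep; rewrite dotpDr es; lra.
have nio : dotp nu io != 0.
  apply/eqP => ni; apply: nu0; apply/eqP; rewrite -(inj_eq (addrI 0)) !add0r.
  have e1 : crossp p io * nu.1 = 0.
    have -> : crossp p io * nu.1 = dotp nu p * io.2 - dotp nu io * p.2 by rewrite /crossp /dotp; ring.
    by rewrite np ni !mul0r subrr.
  have e2 : crossp p io * nu.2 = 0.
    have -> : crossp p io * nu.2 = dotp nu io * p.1 - dotp nu p * io.1 by rewrite /crossp /dotp; ring.
    by rewrite np ni !mul0r subrr.
  move/eqP : e1; move/eqP : e2; rewrite !mulf_eq0 (negPf cr) /= => /eqP e2 /eqP e1.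
  by apply/eqP; rewrite [nu]surjective_pairing e1 e2.
(* Only the square of the [io] coordinate enters the hypothesis, so [io] may be replaced by its
   negative to point inwards. *)
wlog nio0 : io cr H C0 nio / 0 < dotp nu io.
  move=> W; have [n0|n0] := ltP 0 (dotp nu io); first exact: (W io).
  apply: (W (- io)).
  - by rewrite (_ : crossp _ _ = - crossp p io) ?oppr_eq0// /crossp /=; ring.
  - by move=> z /H; rewrite dotpNl sqrrN.
  - by rewrite normrN.
  - by rewrite dotpNr oppr_eq0.
  - by rewrite dotpNr oppr_gt0 lt_neqAle nio.
(* The dual direction is a positive multiple of the edge normal; hence the ray of [touch_edge] is
   the slack ray, with length rescaled from [Y] to [Y / q]. *)
have vE : dualy p io = (dotp nu io)^-1 *: nu.
  have [_ d2 _ d4] := dot_dual cr.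
  have ndec := dual_dec nu cr; rewrite [dotp p nu]dotpC np scale0r add0r [dotp io nu]dotpC in ndec.
  by rewrite {2}ndec scalerA mulVf// scale1r.
set q := (dotp nu io)^-1 in vE; have q0 : 0 < q by rewrite invr_gt0.
have [Y [Y0 seg] hY] := Bslack z1r eE es; rewrite /= in seg hY.
have qY : Y / q * q = Y by rewrite divfK// gt_eqF.
have [d0 d00 Gd] := inw io nio0.
apply: (@touch_edge R Om F N Good sigma h S z1 (s + p) p io (Y / q) r e M d0 cr rp e0 M0 d00 (BF z1r)).
- move=> x Nx; rewrite vE !dotpZl ep; rewrite ler_pM2l//; exact: Nnu.
- by rewrite divr_ge0// ltW.
- move=> t /andP[t0 t1]; rewrite vE scalerA; apply: seg; rewrite mulr_ge0 ?(ltW q0)//=.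
  by rewrite -ler_pdivlMr.
- by rewrite vE scalerA dotpZl mulrA qY ep.
- exact: Gd.
- by move=> z /H; rewrite /k dotpDl !(dotpBr s); lra.
Qed.

End Rigid.

(** [touch_rigid] for [h] minus its tangent plane at [z0]; the two restrictions on contact come from
    the setting for [h] and from the reflected setting for [-h]. *)
Lemma rigid_at Om F N Good sigma h z0 s tau iota (eta0 : R) E :
  setting Om F N Good sigma h -> supports N E -> frozen_germ N Good E s tau iota eta0 ->
  crossp tau iota != 0 -> 0 < eta0 -> F z0 -> has_grad h z0 s ->
  (forall e, e \in E -> slack Om h e z0 /\ slack Om (negf h) (nege e) z0) ->
  exists2 r : R, 0 < r & forall z, `|z - z0| < r -> h z = h z0 + dotp s (z - z0).
Proof.
move=> S NE germ D0 eta00 Fz Hs sl; have S' := setting_neg S.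
have /openP /(_ _ Fz)[rF rF0 HF] := s_Fopen S.
have [rs rs0 Hsl] : exists2 r : R, 0 < r & forall w e, `|w - z0| < r -> e \in E ->
    slack Om h e w /\ slack Om (negf h) (nege e) w.
  elim: E sl {NE germ} => [|e E IH] sl; first by exists 1.
  have [r1 r10 H1] := IH (fun e' e'E => sl e' (@mem_behead _ (e :: E) e' e'E)).
  have [s1 s2] := sl e (mem_head _ _).
  have [r2 r20 H2] := slack_near S s1; have [r3 r30 H3] := slack_near S' s2.
  exists (Num.min r1 (Num.min r2 r3)); first by rewrite !lt_min r10 r20.
  move=> w e'; rewrite !lt_min => /and3P[w1 w2 w3]; rewrite inE => /predU1P[->|]; last exact: H1.
  by split; [exact: H2|exact: H3].
pose r0 := Num.min rF rs.
have r00 : 0 < r0 by rewrite lt_min rF0.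
have BF z : `|z - z0| < r0 -> F z by rewrite lt_min => /andP[/HF].
have Bs1 z e : `|z - z0| < r0 -> e \in E -> dotp e.1 s = e.2 -> slack Om h e z.
  by rewrite lt_min => /andP[_ zr] eE _; have [] := Hsl _ _ zr eE.
have Bs2 z e : `|z - z0| < r0 -> e \in map nege E -> dotp e.1 (- s) = e.2 -> slack Om (negf h) e z.
  rewrite lt_min => /andP[_ zr] /mapP[e' eE ->] _; by have [] := Hsl _ _ zr eE.
pose k z := h z - h z0 - dotp s (z - z0).
have nkE : negf k = (fun z => negf h z - negf h z0 - dotp (- s) (z - z0)).
  by apply/funext => z; rewrite /negf /k dotpNl; ring.
have kc z : `|z - z0| < r0 -> {for z, continuous k}.
  move=> /BF/(s_FOm S) Oz; apply: continuousB; last exact: dotp_cont_shift.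
  apply: continuousB; last exact: cst_continuous.
  exact: (setting_contz S Oz).
have kx := setting_touch_axes S germ BF.
have ks := setting_no_strong_touch S NE germ BF Bs1.
have nkx := setting_touch_axes S' (frozen_germ_neg germ) BF.
have nks := setting_no_strong_touch S' (supports_neg NE) (frozen_germ_neg germ) BF Bs2.
rewrite -nkE in nkx nks.
have kd : has_grad k z0 0.
  have := has_gradD Hs (@has_grad_aff R (- s) (dotp s z0 - h z0) z0).
  rewrite subrr; apply: has_grad_near ltr01 _ => w _.
  by rewrite /k dotpNl dotpBr; ring.
have k0 : k z0 = 0 by rewrite /k subrr sub0r subrr dotp0r oppr0.
have [r rp Hr] := touch_rigid D0 r00 eta00 kc kx ks nkx nks kd k0.
by exists r => // z /Hr; rewrite /k; lra.
Qed.

End Reflection.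

(** * Tight rays *)

Ltac vring := rewrite [LHS]surjective_pairing [RHS]surjective_pairing; congr pair;
  rewrite /= /GRing.scale /=; ring.

Section TightRays.
Variable R : realType.
Notation pt := (R * R)%type.
Local Notation mu2 := (@leb2 R).
Implicit Types (z w g d p tau iota nu : pt) (E : seq (pt * R)) (Bd : seq (pt * pt)).

(* Each boundary segment is normal to an edge of N, and h is affine along it with the slope
   of a corner on that edge. *)
Record natural_boundary (Om : set pt) (h : pt -> R) E Bd : Prop := NaturalBoundary {
  nb_cover : forall z, closure Om z -> ~ Om z -> exists2 ab, ab \in Bd & seg ab.1 ab.2 z;
  nb_out : forall z ab, ab \in Bd -> seg ab.1 ab.2 z -> closure Om z /\ ~ Om z;
  nb_meet : forall z ab ab', ab \in Bd -> ab' \in Bd -> ab <> ab' ->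
    seg ab.1 ab.2 z -> seg ab'.1 ab'.2 z -> z = ab.1 \/ z = ab.2;
  nb_dir : forall ab, ab \in Bd -> exists e (l : R), [/\ e \in E, l != 0, ab.2 - ab.1 = l *: e.1 &
    forall t, 0 <= t <= 1 -> h (affc ab.1 ab.2 t) = h ab.1 + t * l * e.2] }.

Lemma natural_boundary_neg Om h E Bd : natural_boundary Om h E Bd ->
  natural_boundary Om (negf h) (map (@nege R) E) Bd.
Proof.
move=> B; split; [exact: nb_cover B|exact: nb_out B|exact: nb_meet B|].
move=> ab /(nb_dir B)[e [l [eE l0 abE H]]]; exists (nege e), (- l); split.
- exact: map_f.
- by rewrite oppr_eq0.
- by rewrite /nege /= scalerN scaleNr opprK.
- by move=> t /H; rewrite /negf /= => ->; rewrite opprD mulrN mulNr.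
Qed.

Lemma crosspDl g g' z : crossp (g + g') z = crossp g z + crossp g' z.
Proof. rewrite /crossp /=; ring. Qed.
Lemma crosspZl (t : R) g z : crossp (t *: g) z = t * crossp g z.
Proof. rewrite /crossp /= /GRing.scale /=; ring. Qed.
Lemma crosspZr (t : R) g z : crossp g (t *: z) = t * crossp g z.
Proof. rewrite /crossp /= /GRing.scale /=; ring. Qed.
Lemma crosspp g : crossp g g = 0.
Proof. rewrite /crossp; ring. Qed.

Lemma compact_seg a b : compact (seg a b : set pt).
Proof.
rewrite (_ : seg a b = [set z : pt | exists2 t, 0 <= t <= 1 & z = a + t *: (b - a)]).
  exact: compact_ray.
apply/seteqP; split=> z.
  by move=> [t [t0 ->]]; exists t => //; rewrite affcE.
by move=> [t t0 ->]; exists t; rewrite affcE.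
Qed.

(** The line through [z0] in the direction [nu] misses every endpoint of a boundary segment. This
    excludes finitely many lines for [z0]. *)
Definition off_ends Bd nu z0 :=
  forall ab, ab \in Bd -> crossp nu (z0 - ab.1) != 0 /\ crossp nu (z0 - ab.2) != 0.

Section InSetting.
Variables (Om F N Good : set pt) (sigma h : pt -> R) (E : seq (pt * R)) (Bd : seq (pt * pt)).
Hypothesis S : setting Om F N Good sigma h.
Hypothesis NE : supports N E.
Hypothesis B : natural_boundary Om h E Bd.

Lemma exit_time nu z0 : Om z0 -> nu <> 0 -> exists T : R, [/\ 0 < T, closure Om (z0 - T *: nu),
  ~ Om (z0 - T *: nu) & forall t, 0 <= t < T -> Om (z0 - t *: nu)].
Proof.
move=> Oz nu0; have [M HM] := s_bdd S.
have n0 : 0 < `|nu| by rewrite normr_gt0; apply/eqP.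
have M0 : 0 <= M by apply: le_trans (HM _ Oz).
pose L := (2 * M + 1) / `|nu|.
have L0 : 0 < L by rewrite divr_gt0// ltr_wpDl// mulr_ge0.
have LE : L * `|nu| = 2 * M + 1 by rewrite divfK// gt_eqF.
have nO : ~ Om (z0 - L *: nu).
  move=> /HM h1; have h2 := HM _ Oz.
  have := ler_normD (z0 - L *: nu) (- z0); rewrite normrN addrAC subrr add0r normrN normrZ.
  by rewrite gtr0_norm// LE; lra.
have [t [/andP[t0 t1] ct nt Ht]] := seg_exit (s_open S) Oz nO.
have aE s' : affc z0 (z0 - L *: nu) s' = z0 - (s' * L) *: nu.
  by rewrite affcE addrAC subrr add0r scalerN scalerA.
rewrite aE in ct nt.
have tp : 0 < t.
  by rewrite lt_neqAle t0 andbT; apply/eqP => E0; apply: nt; rewrite -E0 mul0r scale0r subr0.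
exists (t * L); split=> //; first by rewrite mulr_gt0.
move=> s' /andP[s0 s1]; have := Ht (s' / L); rewrite aE divfK ?gt_eqF//; apply.
by rewrite divr_ge0 ?(ltW L0)//= ltr_pdivrMr.
Qed.

(** The ray leaves [Om] through the relative interior of one boundary segment, transversally. On the
    parallelogram spanned by ray and segment, monotonicity along [nu'] bounds [h] from above by its
    values on the ray, and monotonicity along [nu] bounds it from below by its values on the
    segment. Both sets of values are extremal, so the bounds coincide. *)
Lemma tight_affine e z0 : e \in E -> Om z0 -> ~ slack Om h e z0 -> off_ends Bd e.1 z0 ->
  exists e' (be : R), [/\ e' \in E, 0 < be, crossp e.1 e'.1 != 0 &
    forall t u, 0 <= t <= be -> 0 <= u <= be -> Om (z0 - t *: e.1 - u *: e'.1) /\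
      h (z0 - t *: e.1 - u *: e'.1) = h z0 - t * e.2 - u * e'.2].
Proof.
case: e => nu b /= eE Oz nsl ne; have [/= nu0 Nnu] := NE eE.
have [T [T0 cT nT HT]] := exit_time Oz nu0.
have tight t : 0 <= t < T -> h (z0 - t *: nu) = h z0 - t * b.
  move=> /andP[t0 tT]; have sgm s' : 0 <= s' <= t -> Om (z0 - s' *: nu).
    by move=> /andP[s0 s1]; apply: HT; rewrite s0 (le_lt_trans s1).
  apply/le_anti/andP; split; last first.
    rewrite leNgt; apply/negP => hlt; apply: nsl; exists t => //.
  have := @setting_mono _ _ _ _ _ _ _ S nu b (z0 - t *: nu) t nu0 Nnu t0.
  rewrite subrK => h1; have : h (z0 - t *: nu) + t * b <= h z0; last by lra.
  apply: h1 => s' /andP[s0 s1]; have -> : z0 - t *: nu + s' *: nu = z0 - (t - s') *: nu by vring.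
  by apply: sgm; apply/andP; split; lra.
have [K K0 HK] := s_lip S.
set z' := z0 - T *: nu in cT nT.
have [[a b'] abB zi] := nb_cover B cT nT.
have [/= nea neb] := ne _ abB; have [[nu' c'] [l [/= e'E l0 abE Hab]]] := nb_dir B abB.
have [/= nu'0 Nnu'] := NE e'E.
case: (zi) => /= t1 [/andP[t10 t11] z'E].
have crT c : crossp nu (z' - c) = crossp nu (z0 - c).
  by rewrite /z' /crossp /= /GRing.scale /=; ring.
have z'a : z' - a = t1 *: (b' - a) by rewrite z'E affcE addrC addKr.
have crn : crossp nu nu' != 0.
  apply/eqP => c0; move/eqP : nea; apply; rewrite -crT z'a abE !crosspZr c0 !mulr0 //.
have t10' : 0 < t1.
  rewrite lt_neqAle t10 andbT; apply/eqP => t1E; move/eqP : nea; apply.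
  by rewrite -crT z'a -t1E scale0r /crossp /= !mulr0 subrr.
have t11' : t1 < 1.
  rewrite lt_neqAle t11 andbT; apply/eqP => t1E; move/eqP : neb; apply.
  by rewrite -crT z'E t1E affc1 subrr /crossp /= !mulr0 subrr.
have z'ne : z' <> a /\ z' <> b'.
  split=> zE; [move/eqP : nea|move/eqP : neb]; apply; by rewrite -crT zE subrr /crossp /= !mulr0 subrr.
have z'j ab : ab \in Bd -> ab <> (a, b') -> ~ seg ab.1 ab.2 z'.
  move=> jB ji zj.
  by have := nb_meet B abB jB (fun e => ji (esym e)) zi zj; move=> /= [|]; apply z'ne.
(* A tube around the ray, its end included, avoids all the other boundary segments. *)
pose W := ~` (\bigcup_(ab in [set ab | ab \in Bd /\ ab <> (a, b')]) seg ab.1 ab.2).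
have oW : open W.
  rewrite /W openC; apply: closed_bigcup => [|ab _].
    by apply: sub_finite_set (finite_seq Bd) => ab [].
  apply: compact_closed; first exact: norm_hausdorff.
  exact: compact_seg.
have inW w : W w <-> forall ab, ab \in Bd -> ab <> (a, b') -> ~ seg ab.1 ab.2 w.
  split=> [nw ab jB ji wj|H [ab [jB ji] wj]]; first by apply: nw; exists ab.
  exact: (H ab jB ji wj).
pose Ky : set pt := [set z | exists2 t, 0 <= t <= T & z = z0 + t *: (- nu)].
have KW : Ky `<=` W.
  move=> w [t /andP[t0 tT] ->]; rewrite scalerN; apply/inW => ab jB ji.
  have [tl|tg] := ltP t T.
    move=> wj; apply: (nb_out B jB wj).2; apply: HT; by rewrite t0.
  by have -> : t = T by [apply/le_anti; rewrite tT|]; exact: z'j.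
have [r r0 Hr] := tube (@compact_ray R z0 (- nu) T) oW KW.
have n0 : 0 < `|nu'| by rewrite normr_gt0; apply/eqP.
(* A move in the direction [nu'] from the ray could leave [Om] only through the segment [[a, b']],
   which is parallel to [nu']. The cross product with [nu'] then yields [t = T]. *)
have par t u : 0 <= t < T -> `|u| * `|nu'| < r -> Om (z0 - t *: nu + u *: nu').
  move=> /andP[t0 tT] ur; apply: contrapT => nO.
  have Ot : Om (z0 - t *: nu) by apply: HT; rewrite t0.
  have [s' [/andP[s0 s1] cs ns _]] := seg_exit (s_open S) Ot nO.
  have aE : affc (z0 - t *: nu) (z0 - t *: nu + u *: nu') s' = z0 - t *: nu + (s' * u) *: nu'.
    by rewrite affcE; vring.
  rewrite aE in cs ns; have [ab jB qj] := nb_cover B cs ns.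
  have [ji|ji] := eqVneq ab (a, b'); last first.
    have : W (z0 - t *: nu + (s' * u) *: nu').
      apply: (Hr (z0 - t *: nu)); first by exists t; [rewrite t0 ltW|rewrite scalerN].
      rewrite addrC addKr normrZ normrM (ger0_norm s0); apply: le_lt_trans ur.
      by rewrite ler_wpM2r// ler_piMl.
    by move=> /inW /(_ ab jB); apply => //; exact/eqP.
  rewrite ji /= in qj; case: qj => t2 [_ qE].
  have : (t2 - t1) *: (b' - a) = (T - t) *: nu + (s' * u) *: nu'.
    have e1 : (t2 - t1) *: (b' - a) = affc a b' t2 - affc a b' t1.
      by rewrite !affcE opprD addrACA subrr add0r -scalerBl.
    by rewrite e1 -qE -z'E /z'; vring.
  move=> /(congr1 (fun v => crossp v nu')); rewrite crosspDl !crosspZl crosspp abE crosspZl crosspp.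
  rewrite !mulr0 addr0 => /esym/eqP; rewrite mulf_eq0 (negPf crn) orbF subr_eq0 => /eqP TE.
  by move: tT; rewrite TE ltxx.
have bottom u : `|u| <= `|l| * Num.min t1 (1 - t1) ->
    closure Om (z' - u *: nu') /\ h (z' - u *: nu') = h z' - u * c'.
  move=> ul; have lp : 0 < `|l| by rewrite normr_gt0.
  have uE : u / l * l = u by rewrite divfK.
  have ul' : `|u / l| <= Num.min t1 (1 - t1).
    by rewrite normrM normfV ler_pdivrMr// mulrC.
  move: ul'; rewrite ler_norml le_min lerNl => /and3P[u1 u2 u3].
  have t01 : 0 <= t1 - u / l <= 1.
    move: u1; rewrite le_min => /andP[u1 u1']; clear - S u1 u1' u2 u3; apply/andP; split; lra.
  have qE : z' - u *: nu' = affc a b' (t1 - u / l).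
    by rewrite z'E !affcE abE !scalerA mulrBl uE scalerBl addrA.
  have hz' : h z' = h a + t1 * l * c' by rewrite z'E Hab// t10.
  split; last by rewrite qE (Hab _ t01) hz' mulrBl uE; ring.
  by apply: (nb_out B abB _).1; rewrite qE; exists (t1 - u / l).
have lp : 0 < `|l| * Num.min t1 (1 - t1).
  by rewrite mulr_gt0 ?normr_gt0// lt_min t10' subr_gt0.
have rn : 0 < r / `|nu'| by rewrite divr_gt0.
(* Three restrictions: stay before the exit, stay in the tube, and keep the foot on the boundary
   segment. *)
pose be := Num.min (T / 2) (Num.min (r / `|nu'| / 2) (`|l| * Num.min t1 (1 - t1))).
have be0 : 0 < be by rewrite !lt_min lp !divr_gt0.
have beT : be <= T / 2 by rewrite ge_min lexx.
have ber : be <= r / `|nu'| / 2 by rewrite ge_min [Num.min (r / _ / 2) _ <= _]ge_min lexx orbT.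
have bel : be <= `|l| * Num.min t1 (1 - t1).
  by rewrite ge_min [Num.min (r / _ / 2) _ <= _]ge_min lexx !orbT.
clearbody be.
have Oq t u : 0 <= t < T -> - be <= u <= 0 -> Om (z0 - t *: nu + u *: nu').
  move=> tT /andP[u1 u2]; apply: par => //; rewrite -ltr_pdivlMr//.
  apply: (@le_lt_trans _ _ be); last by clear - S ber rn; lra.
  by rewrite ler_norml u1; clear - S u2 be0; lra.
exists (nu', c'), be; split=> // t u /andP[t0 tb] /andP[u0 ub] /=.
have tT : 0 <= t < T by rewrite t0; clear - S tb beT T0; lra.
have Oq0 : Om (z0 - t *: nu - u *: nu').
  by rewrite -[- (u *: nu')]scaleNr; apply: Oq => //; clear - S u0 ub; apply/andP; split; lra.
split=> //.
have upper : h (z0 - t *: nu - u *: nu') + u * c' <= h z0 - t * b.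
  rewrite -(tight t tT); have := @setting_mono _ _ _ _ _ _ _ S nu' c' (z0 - t *: nu - u *: nu') u nu'0 Nnu' u0.
  rewrite subrK; apply => s' /andP[s0 s1]; rewrite -addrA -[- (u *: nu')]scaleNr -scalerDl; apply: Oq => //.
  by clear - S ub s0 s1; apply/andP; split; lra.
apply/le_anti/andP; split; first by clear - S upper; lra.
apply/ler_addgt0Pr => ep ep0.
have k1 : 0 < 2 * K * `|nu| + 1 by rewrite ltr_wpDl// !mulr_ge0.
(* Monotonicity is available only along segments inside [Om], so the lower bound starts at time
   [T - de] and the Lipschitz bound up to the boundary absorbs the difference. *)
pose de := Num.min ((T - t) / 2) (ep / (2 * K * `|nu| + 1)).
have Tt : 0 < T - t by case/andP: tT => _ tT; clear - S tT; lra.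
have de0 : 0 < de by rewrite lt_min !divr_gt0.
have deT : de <= (T - t) / 2 by rewrite ge_min lexx.
have deE : de * (2 * K * `|nu| + 1) <= ep by rewrite -ler_pdivlMr// ge_min lexx orbT.
clearbody de; pose t' := T - de.
have t'T : 0 <= t' < T by rewrite /t'; clear - S de0 deT t0 Tt; apply/andP; split; lra.
have ubel : `|u| <= `|l| * Num.min t1 (1 - t1) by rewrite ger0_norm// (le_trans ub).
have [cb hb] := bottom u ubel.
have t't : 0 <= t' - t by rewrite /t'; clear - S deT Tt; lra.
have h1 : h (z0 - t' *: nu - u *: nu') + (t' - t) * b <= h (z0 - t *: nu - u *: nu').
  have := @setting_mono _ _ _ _ _ _ _ S nu b (z0 - t' *: nu - u *: nu') (t' - t) nu0 Nnu t't.
  have mv s' : z0 - t' *: nu - u *: nu' + s' *: nu = z0 - (t' - s') *: nu - u *: nu'.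
    by vring.
  rewrite mv opprB addrCA subrr addr0; apply => s' /andP[s0 s1]; rewrite mv -[- (u *: nu')]scaleNr.
  by apply: Oq; case/andP: t'T => t'0 t'T; clear - S s0 s1 t0 t't t'T u0 ub; apply/andP; split; lra.
have dist w : `|(z' - w) - (z0 - t' *: nu - w)| = de * `|nu|.
  have -> : z' - w - (z0 - t' *: nu - w) = - (de *: nu) by rewrite /z' /t'; vring.
  by rewrite normrN normrZ gtr0_norm.
have cl t2 : 0 <= t2 < T -> closure Om (z0 - t2 *: nu) by move=> /HT; exact: subset_closure.
have h2 : `|h (z' - u *: nu') - h (z0 - t' *: nu - u *: nu')| <= K * (de * `|nu|).
  rewrite -(dist (u *: nu')); apply: HK => //; apply: subset_closure; rewrite -[- (u *: nu')]scaleNr.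
  by apply: Oq => //; clear - S u0 ub; apply/andP; split; lra.
have h3 : `|h z' - h (z0 - t' *: nu)| <= K * (de * `|nu|).
  by rewrite -(dist 0) !subr0; apply: HK => //; exact: cl.
rewrite (tight t' t'T) in h3; rewrite hb in h2.
move: h1 h2 h3; rewrite !ler_norml => h1 /andP[_ h2] /andP[h3 _].
have : (t' - t) * b = t' * b - t * b by ring.
by clear - S h1 h2 h3 deE ep0 de0; lra.
Qed.

End InSetting.
End TightRays.

(** * Monge-Ampère measure and steepness *)

Section Parallelogram.
Variable R : realType.
Notation pt := (R * R)%type.
Local Notation mu2 := (@leb2 R).
Implicit Types (z g e d : pt).

Definition par e d (A B P Q : R) : set pt :=
  [set z | `|dotp e z - A| <= P /\ `|dotp d z - B| <= Q].

Lemma par_closed e d A B P Q : closed (par e d A B P Q).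
Proof.
have -> : par e d A B P Q = [set z | dotp e z <= A + P] `&` [set z | dotp (- e) z <= P - A]
    `&` [set z | dotp d z <= B + Q] `&` [set z | dotp (- d) z <= Q - B].
  apply/seteqP; split=> z; rewrite /par /= !dotpNl !ler_norml.
    by move=> [/andP[? ?] /andP[? ?]]; repeat split; lra.
  by move=> [[[? ?] ?] ?]; split; apply/andP; split; lra.
by repeat (apply: closedI; last exact: closed_half); exact: closed_half.
Qed.

Lemma measurable_par e d A B P Q : measurable (par e d A B P Q : set (mpt R)).
Proof. by apply: closed_measurable2; exact: par_closed. Qed.

(** Shears and coordinate exchanges preserve area and turn the parallelogram into a rectangle; the
    first component of [e] must be nonzero for this, which an exchange arranges. *)
Lemma leb2_par e d A B P Q : crossp e d != 0 -> 0 <= P -> 0 <= Q ->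
  mu2 (par e d A B P Q) = (4 * P * Q / `|crossp e d|)%:E.
Proof.
move=> + P0 Q0; wlog e1 : e d / e.1 != 0.
  move=> W D0; have [e10|] := eqVneq e.1 0; last by move/W; apply.
  have e20 : e.2 != 0 by apply: contraNneq D0 => e20; rewrite /crossp e10 e20 !mul0r subrr.
  have -> : par e d A B P Q = (fun z : pt => (z.2, z.1)) @^-1` par (e.2, e.1) (d.2, d.1) A B P Q.
    have sw (a z : pt) : dotp (a.2, a.1) (z.2, z.1) = dotp a z by rewrite /dotp /=; ring.
    by apply/seteqP; split=> z; rewrite /par /= !sw.
  rewrite leb2_swap; last exact: measurable_par.
  rewrite (W (e.2, e.1) (d.2, d.1))//=.
    by congr (_ / _)%:E; rewrite -normrN /crossp /=; congr `|_|; ring.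
  by apply: contraNneq D0; rewrite /crossp /= => E; apply/eqP; lra.
move=> D0; pose D := crossp e d; rewrite -/D in D0 *.
pose Bx : set (mpt R) := `[A / e.1 - P / `|e.1|, A / e.1 + P / `|e.1|] `*`
  `[B * e.1 / D - Q * `|e.1| / `|D|, B * e.1 / D + Q * `|e.1| / `|D|].
have mB : measurable Bx by apply: measurableX; exact: measurable_itv.
pose B1 := (fun z : pt => (z.1, z.2 + d.1 * e.1 / D * z.1)) @^-1` Bx.
have m1 : measurable (B1 : set (mpt R)).
  by rewrite -[X in measurable X]setTI; exact: measurable_shear.
pose sw (Z : set pt) := (fun z : pt => (z.2, z.1)) @^-1` Z.
have msw (Z : set (mpt R)) : measurable Z -> measurable (sw Z : set (mpt R)).
  move=> mZ; rewrite -[X in measurable X]setTI; suff : measurable_fun setT (fun z : mpt R => ((z.2, z.1) : mpt R)) by exact.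
  by apply/measurable_fun_pairP; split; [exact: measurable_snd|exact: measurable_fst].
pose B2 := (fun z : pt => (z.1, z.2 + e.2 / e.1 * z.1)) @^-1` sw B1.
have m2 : measurable (B2 : set (mpt R)).
  by rewrite -[X in measurable X]setTI; apply: measurable_shear => //; exact: msw.
have D0' : e.1 * d.2 - e.2 * d.1 != 0 by [].
have e1p : 0 < `|e.1| by rewrite normr_gt0.
have Dp : 0 < `|D| by rewrite normr_gt0.
have -> : par e d A B P Q = sw B2.
  have xE z : z.1 + e.2 / e.1 * z.2 = dotp e z / e.1 by rewrite /dotp; field.
  have yE z : z.2 + d.1 * e.1 / D * (z.1 + e.2 / e.1 * z.2) = dotp d z * e.1 / D.
    by rewrite /dotp /D /crossp; field; rewrite e1 D0'.
  have h1 z : (`|dotp e z - A| <= P) = (`|dotp e z / e.1 - A / e.1| <= P / `|e.1|).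
    by rewrite -mulrBl normrM normfV ler_pM2r// invr_gt0.
  have h2 z : (`|dotp d z - B| <= Q) = (`|dotp d z * e.1 / D - B * e.1 / D| <= Q * `|e.1| / `|D|).
    by rewrite -mulrBl -mulrBl !normrM normfV ler_pM2r ?invr_gt0// ler_pM2r.
  have BE p : Bx p <-> `|p.1 - A / e.1| <= P / `|e.1| /\ `|p.2 - B * e.1 / D| <= Q * `|e.1| / `|D|.
    by rewrite /Bx /= !in_itv /= !ler_distl.
  rewrite predeqE => z.
  rewrite -[sw B2 z]/(Bx (z.1 + e.2 / e.1 * z.2, z.2 + d.1 * e.1 / D * (z.1 + e.2 / e.1 * z.2))).
  by rewrite BE /= yE xE -h1 -h2.
rewrite leb2_swap// leb2_shear ?leb2_swap ?leb2_shear//; last exact: msw.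
rewrite leb2_box; last 2 first.
- by rewrite lerD2l ge0_cp// divr_ge0// ltW.
- by rewrite lerD2l ge0_cp// divr_ge0 ?mulr_ge0// ltW.
congr EFin; field; by rewrite !normr_eq0 e1 D0.
Qed.

Lemma seq_cluster (K : set pt) (u : nat -> pt) : compact K -> (forall n, K (u n)) ->
  exists2 x, K x & forall (ep : R) (n : nat), 0 < ep -> exists2 m, (n <= m)%N & `|u m - x| < ep.
Proof.
move=> cK Ku; have [|x [Kx xc]] := cK (u @ \oo) _.
  by exists 0%N => // n _; exact: Ku.
exists x => // ep n ep0.
have [|_ [[m nm <-] xm]] := xc [set w | exists2 m, (n <= m)%N & u m = w] (ball x ep) _ (nbhsx_ballx x ep ep0).
  by exists n => // m nm; exists m.
by exists m => //; move: xm; rewrite -ball_normE /ball_/= distrC.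
Qed.

Section Subgradients.
Variables (N I : set pt) (sigma : pt -> R) (M : R).
Hypothesis sc : {within N, continuous sigma}.
Hypothesis sb : forall x, N x -> `|sigma x| <= M.

Lemma subgrad_limit (x g : pt) : N x ->
  (forall ep : R, 0 < ep -> exists y k, [/\ N y, subgrad N sigma y k, `|y - x| < ep & `|k - g| < ep]) ->
  subgrad N sigma x g.
Proof.
move=> Nx H y Ny; rewrite -[subp y x]/(y - x); apply/ler_addgt0Pr => ep ep0.
have ep2 : 0 < ep / 2 by rewrite divr_gt0.
have /within_continuousP /(_ _ Nx _ ep2)[d d0 Hd] := sc.
pose c := 2 * (`|y - x| + 1) + 2 * `|g| + 2.
have c0 : 0 < c by rewrite ltr_wpDl// addr_ge0// mulr_ge0// addr_ge0.
pose q := Num.min 1 (Num.min d (ep / 2 / c)).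
have q0 : 0 < q by rewrite !lt_min ltr01 d0 !divr_gt0.
have qc : q * c <= ep / 2 by rewrite -ler_pdivlMr// !ge_min lexx !orbT.
have q1 : q <= 1 by rewrite ge_min lexx.
have qd : q <= d by rewrite !ge_min lexx orbT.
clearbody q.
have [x' [g' [Nx' Hg' x1 g1]]] := H q q0.
have := Hg' y Ny; rewrite -[subp y x']/(y - x') => h1.
have := Hd x' Nx' (lt_le_trans x1 qd); rewrite ltr_norml => /andP[h2 _].
have E : dotp g' (y - x') = dotp g (y - x) + dotp (g' - g) (y - x) - dotp g' (x' - x).
  by rewrite /dotp /=; ring.
have := dotp_le (g' - g) (y - x); have := dotp_le g' (x' - x).
rewrite !ler_norml => /andP[_ h3] /andP[h4 _].
have gg : `|g'| <= `|g| + 1 by have := ler_normD (g' - g) g; rewrite subrK; lra.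
have h5 : `|g' - g| * `|y - x| <= q * `|y - x| by rewrite ler_wpM2r// ltW.
have h6 : `|g'| * `|x' - x| <= (`|g| + 1) * q by apply: ler_pM => //; exact: ltW.
rewrite /c in qc; rewrite E in h1; lra.
Qed.

Lemma subgrad_img_closed (K : set pt) : compact K -> K `<=` N -> closed (subgrad_img N sigma K).
Proof.
move=> cK KN; apply/closedP => g H.
have n0 n : 0 < n.+1%:R^-1 :> R by rewrite invr_gt0.
have /choice[w Hw] : forall n, exists w : pt * pt, [/\ K w.1, subgrad N sigma w.1 w.2 & `|w.2 - g| < n.+1%:R^-1].
  by move=> n; have [k [x Kx Hx] kg] := H _ (n0 n); exists (x, k).
have Kw n : K (w n).1 by have [] := Hw n.
have [x Kx xc] := seq_cluster cK Kw.
exists x => //; apply: subgrad_limit => [|ep ep0]; first exact: KN.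
have [n Hn] : exists n, n.+1%:R^-1 < ep.
  exists (Num.bound ep^-1); rewrite invf_plt ?posrE//.
  by apply: lt_trans (archi_boundP _) _; rewrite ?invr_ge0 ?ltW// ltr_nat.
have [m nm xm] := xc ep n ep0; have [h1 h2 h3] := Hw m.
exists (w m).1, (w m).2; split=> //; first exact: KN.
apply: lt_trans h3 (le_lt_trans _ Hn); rewrite lef_pV2 ?posrE// ler_nat ltnS//.
Qed.

Hypothesis oI : open I.
Hypothesis IN : I `<=` N.
Hypothesis MA : forall K, compact K -> K `<=` I -> (mu2 K <= mu2 (subgrad_img N sigma K))%E.

(** The Monge-Ampère lower bound on small closed discs around [p] forces a subgradient at some point
    of each disc. These subgradients are bounded, and a cluster point is a subgradient at [p]. *)
Lemma subgrad_nonempty p : I p -> exists g, subgrad N sigma p g.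
Proof.
move=> Ip; have /openP /(_ _ Ip)[r r0 Hr] := oI.
have n0 n : 0 < n.+1%:R^-1 :> R by rewrite invr_gt0.
pose q n : R := Num.min (r / 4) n.+1%:R^-1.
have q0 n : 0 < q n by rewrite lt_min n0 divr_gt0.
have q4 n : q n <= r / 4 by rewrite ge_min lexx.
have /choice[w Hw] : forall n, exists w : pt * pt, [/\ subgrad N sigma w.1 w.2, `|w.1 - p| <= q n &
    `|w.2| <= 8 * M / r].
  move=> n; pose K := [set z : pt | `|z - p| <= q n].
  have KI : K `<=` I by move=> z; rewrite /K /= => zq; apply: Hr; have := q4 n; lra.
  have cK : compact K.
    apply: (@closed_bounded_compact _ _ (q n + `|p|)); first exact: closed_ball_norm.
    by move=> z; rewrite /K /= => zq; have := ler_normD (z - p) p; rewrite subrK; lra.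
  have mpos : (0 < mu2 K)%E.
    apply: (@lt_le_trans _ _ (mu2 [set z : pt | `|z - p| < q n])).
      apply: leb2_open_gt0; first exact: open_ball_norm.
      by exists p; rewrite /= subrr normr0.
    apply: le_measure; rewrite ?inE.
    - by apply: open_measurable2; exact: open_ball_norm.
    - by apply: closed_measurable2; exact: closed_ball_norm.
    - by move=> z; exact: ltW.
  have /set0P[g [x Kx gx]] : subgrad_img N sigma K != set0.
    apply/eqP => E; have := lt_le_trans mpos (MA cK KI).
    have m0 : mu2 set0 = 0%E by exact: measure0.
    by rewrite E m0 ltxx.
  exists (x, g); split=> //=.
  have Nx : N x by exact/IN/KI.
  (* Steps of length [r / 4] stay in the disc of radius [r], where [sigma] varies by at most [2 M];
     this bounds the subgradient. *)
  have B v : `|v| <= r / 4 -> dotp g v <= 2 * M.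
    move=> vr; have Nxv : N (x + v).
      apply/IN/Hr; have := ler_normD (x - p) v; rewrite addrAC.
      by rewrite /K /= in Kx; have := q4 n; lra.
    have := gx _ Nxv; rewrite -[subp _ x]/(x + v - x) [x + v - x]addrC addKr.
    have := sb Nx; have := sb Nxv; rewrite !ler_norml => /andP[? ?] /andP[? ?]; lra.
  have r4 : 0 <= r / 4 by rewrite divr_ge0// ltW.
  have B1 t : `|t| <= r / 4 -> dotp g (t, 0) <= 2 * M.
    by move=> tr; apply: B; apply/norm_leP; rewrite /= normr0.
  have B2 t : `|t| <= r / 4 -> dotp g (0, t) <= 2 * M.
    by move=> tr; apply: B; apply/norm_leP; rewrite /= normr0.
  have a1 : `|r / 4| <= r / 4 by rewrite ger0_norm.
  have a2 : `|- (r / 4)| <= r / 4 by rewrite normrN.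
  have := B1 _ a1; have := B1 _ a2; have := B2 _ a1; have := B2 _ a2.
  rewrite /dotp /= !mulr0 !addr0 !add0r => h1 h2 h3 h4.
  have rq : 8 * M / r * r = 8 * M by rewrite divfK// gt_eqF.
  have c1 t : t * (r / 4) <= 2 * M -> t <= 8 * M / r.
    by move=> hx; rewrite -(ler_pM2r r0) rq; lra.
  have u1 : g.1 <= 8 * M / r by exact: c1.
  have u2 : - g.1 <= 8 * M / r by apply: c1; rewrite mulNr -mulrN.
  have u3 : g.2 <= 8 * M / r by exact: c1.
  have u4 : - g.2 <= 8 * M / r by apply: c1; rewrite mulNr -mulrN.
  by apply/norm_leP; rewrite !ler_norml u1 u3 !andbT lerNl u2 lerNl u4.
have cB : compact [set z : pt | `|z| <= 8 * M / r].
  by apply: (@closed_bounded_compact _ _ (8 * M / r)); [exact: closed_norm_le|].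
have Bw n : [set z : pt | `|z| <= 8 * M / r] (w n).2 by have [] := Hw n.
have [g _ gc] := seq_cluster cB Bw.
exists g; apply: subgrad_limit => [|ep ep0]; first exact: IN.
have [n Hn] : exists n, n.+1%:R^-1 < ep.
  exists (Num.bound ep^-1); rewrite invf_plt ?posrE//.
  by apply: lt_trans (archi_boundP _) _; rewrite ?invr_ge0 ?ltW// ltr_nat.
have [m nm gm] := gc ep n ep0; have [h1 h2 h3] := Hw m.
exists (w m).1, (w m).2; split=> //.
  by apply: IN; apply: Hr; have := q4 m; lra.
apply: le_lt_trans h2 (le_lt_trans _ Hn); rewrite ge_min; apply/orP; right.
by rewrite lef_pV2 ?posrE// ler_nat ltnS.
Qed.

End Subgradients.
End Parallelogram.

(** * Convex functions on a strip that vanish on its base *)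

Section ConvexStrip.
Variable R : realType.
Variables (f : R -> R -> R) (a0 b0 : R).
Hypothesis a00 : 0 < a0.
Hypothesis b00 : 0 < b0.
Hypothesis f0 : forall a, `|a| <= a0 -> f a 0 = 0.

Section Slope.
Variable C : R.
Hypothesis fconv : forall a b a' b' t : R, `|a| <= a0 -> 0 <= b <= b0 -> `|a'| <= a0 -> 0 <= b' <= b0 ->
  0 <= t <= 1 -> f ((1 - t) * a + t * a') ((1 - t) * b + t * b') <= (1 - t) * f a b + t * f a' b'.
Hypothesis fC : forall b, 0 < b <= b0 -> exists2 t : R, 0 < t < b & - C * t <= f 0 t.

Let z0 : `|0 : R| <= a0. Proof. by rewrite normr0 ltW. Qed.

Let f00 : f 0 0 = 0. Proof. exact: f0. Qed.

Let qmono (b b' : R) : 0 < b -> b <= b' -> b' <= b0 -> f 0 b / b <= f 0 b' / b'.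
Proof.
move=> bp bb' b'0; have b'p : 0 < b' by exact: lt_le_trans bb'.
rewrite ler_pdivrMr//; have -> : f 0 b' / b' * b = b / b' * f 0 b' by ring.
have t01 : 0 <= b / b' <= 1 by rewrite divr_ge0 ?ler_pdivrMr ?mul1r// ltW.
have b'1 : 0 <= b' <= b0 by rewrite ltW.
have b01 : 0 <= (0 : R) <= b0 by rewrite lexx ltW.
have := @fconv 0 0 0 b' (b / b') z0 b01 z0 b'1 t01.
by rewrite !mulr0 !add0r f00 mulr0 add0r divfK ?gt_eqF.
Qed.

Let half_conv (a b a' b' : R) : `|a| <= a0 -> 0 <= b <= b0 -> `|a'| <= a0 -> 0 <= b' <= b0 ->
  f ((a + a') / 2) ((b + b') / 2) <= (f a b + f a' b') / 2.
Proof.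
move=> ha hb ha' hb'; have t01 : 0 <= (1 / 2 : R) <= 1 by apply/andP; split; lra.
have := fconv ha hb ha' hb' t01.
have -> : (1 - 1 / 2) * a + 1 / 2 * a' = (a + a') / 2 by lra.
have -> : (1 - 1 / 2) * b + 1 / 2 * b' = (b + b') / 2 by lra.
lra.
Qed.

(** The slope [k] is the infimum of [f 0 b / b]. It passes to other abscissae by midpoints:
    [(0, b/2)] lies between [(a, b)] and [(-a, 0)], and [(a, b)] lies between [(0, 2b)] and
    [(2a, 0)], while [f] vanishes on the base. *)
Lemma slope_along : exists k : R, (forall a b : R, `|a| <= a0 -> 0 < b <= b0 -> k * b <= f a b) /\
  forall om, 0 < om -> exists2 b1 : R, 0 < b1 <= b0 &
    forall a b, `|a| <= a0 / 2 -> 0 < b <= b1 -> f a b <= (k + om) * b.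
Proof.
pose Q := [set f 0 b / b | b in [set b : R | 0 < b <= b0]].
have qC b : 0 < b <= b0 -> - C <= f 0 b / b.
  move=> bb; have [t /andP[t0 tb] tC] := fC bb; case/andP : bb => bp bb0.
  by apply: le_trans (qmono t0 (ltW tb) bb0); rewrite ler_pdivlMr.
have hQ : has_inf Q.
  split; first by exists (f 0 b0 / b0), b0 => //=; rewrite b00 lexx.
  by exists (- C) => _ [b bb <-]; exact: qC.
have b01 : 0 <= (0 : R) <= b0 by rewrite lexx ltW.
exists (inf Q); split=> [a b aa /andP[b1 b2]|om om0].
  have b20 : 0 < b / 2 <= b0 by apply/andP; split; lra.
  have : inf Q <= f 0 (b / 2) / (b / 2) by apply: ge_inf; [exact: hQ.2|exists (b / 2)].
  rewrite ler_pdivlMr ?divr_gt0// => h1.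
  have aa' : `|- a| <= a0 by rewrite normrN.
  have bb : 0 <= b <= b0 by rewrite ltW.
  have := half_conv aa bb aa' b01; rewrite subrr mul0r addr0 (f0 aa'); lra.
have [_ [b /= /andP[bp bb0] <-]] := inf_adherent om0 hQ; move: (inf Q) => k qb.
exists (b / 2); first by apply/andP; split; lra.
move=> a b' aa /andP[b'0 b'b].
have aa2 : `|2 * a| <= a0 by rewrite normrM ger0_norm//; lra.
have bb' : 0 <= 2 * b' <= b0 by apply/andP; split; lra.
have := half_conv z0 bb' aa2 b01; rewrite addr0 add0r (f0 aa2).
have -> : 2 * a / 2 = a by lra.
have -> : 2 * b' / 2 = b' by lra.
have b'2 : 0 < 2 * b' by lra.
have := qmono b'2 _ bb0; rewrite {1}ler_pdivrMr// => h2.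
have {}h2 : f 0 (2 * b') <= f 0 b / b * (2 * b') by apply: h2; lra.
have : f 0 b / b * (2 * b') <= (k + om) * (2 * b') by rewrite ler_pM2r// ltW.
lra.
Qed.

End Slope.

(** A subgradient [(p, r)] at [(a, be)] is tested at [(a ± a0/4, be)], at [(a, 0)] and at
    [(a, be + b)]. As [f] lies between [k b'] and [(k + om) b'], the possible subgradients fill a
    rectangle of area of order [om^2 b]. *)
Lemma slope_box (k b a be om p r : R) : 0 < b -> 3 * b <= b0 -> `|a| <= a0 / 4 -> b <= be <= 2 * b -> 0 < om ->
  (forall a' b' : R, `|a'| <= a0 -> 0 < b' <= b0 -> k * b' <= f a' b') ->
  (forall a' b' : R, `|a'| <= a0 / 2 -> 0 < b' <= 3 * b -> f a' b' <= (k + om) * b') ->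
  (forall a' b' : R, `|a'| <= a0 -> 0 <= b' <= b0 ->
    (a' - a) * p + (b' - be) * (r - k) <= (f a' b' - k * b') - (f a be - k * be)) ->
  a0 / 4 * `|p| <= 2 * om * b /\ 0 <= r - k <= 3 * om.
Proof.
move=> bp b3 aa /andP[be1 be2] om0 low up key.
move: (aa); rewrite ler_norml => /andP[aa1 aa2].
have ob : om * be <= om * (2 * b) by rewrite ler_pM2l.
have aA : `|a| <= a0 by lra.
have beb : 0 < be <= b0 by apply/andP; split; lra.
have beb' : 0 <= be <= b0 by apply/andP; split; lra.
have be3 : 0 < be <= 3 * b by apply/andP; split; lra.
have F0 := low _ _ aA beb.
have side (a' : R) : `|a'| <= a0 / 2 -> (a' - a) * p <= 2 * om * b.
  move=> h1; have h2 : `|a'| <= a0 by lra.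
  by have := key _ _ h2 beb'; have := up _ _ h1 be3; rewrite subrr mul0r; lra.
have p1 : a0 / 4 * p <= 2 * om * b.
  have := side (a + a0 / 4); rewrite [a + _ - a]addrC addKr; apply.
  by rewrite ler_norml; apply/andP; split; lra.
have p2 : - (a0 / 4 * p) <= 2 * om * b.
  have := side (a - a0 / 4); rewrite [a - _ - a]addrC addKr mulNr; apply.
  by rewrite ler_norml; apply/andP; split; lra.
have r1 : 0 <= r - k.
  have h1 : 0 <= (0 : R) <= b0 by apply/andP; split; lra.
  have bep : 0 < be by lra.
  have := key a 0 aA h1; rewrite (f0 aA) subrr mul0r add0r mulr0 subrr => h2.
  by rewrite -(pmulr_rge0 _ bep); lra.
have r2 : r - k <= 3 * om.
  have h1 : 0 <= be + b <= b0 by apply/andP; split; lra.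
  have h2 : 0 < be + b <= 3 * b by apply/andP; split; lra.
  have h3 : `|a| <= a0 / 2 by lra.
  have h6 : om * (be + b) <= om * (3 * b) by rewrite ler_pM2l//; lra.
  have := key a _ aA h1; have := up _ _ h3 h2; rewrite subrr mul0r add0r => h4 h5.
  rewrite -(ler_pM2l bp); lra.
split; last by rewrite r1.
have [p0|p0] := leP 0 p; first by rewrite ger0_norm.
by rewrite ltr0_norm// mulrN.
Qed.

End ConvexStrip.

Section Steepness.
Variable R : realType.
Notation pt := (R * R)%type.
Local Notation mu2 := (@leb2 R).
Implicit Types (z g e d : pt).
Variables (N I : set pt) (sigma : pt -> R).
Hypothesis sc : {within N, continuous sigma}.
Hypothesis IN : I `<=` N.
Hypothesis MA : forall K, compact K -> K `<=` I -> (mu2 K <= mu2 (subgrad_img N sigma K))%E.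
Hypothesis Nconv : forall x y (t : R), N x -> N y -> 0 <= t <= 1 ->
  sigma ((1 - t) *: x + t *: y) <= (1 - t) * sigma x + t * sigma y.

Lemma dec_dual e d z : crossp e d != 0 ->
  z = dotp (dualx e d) z *: e + dotp (dualy e d) z *: d.
Proof.
move=> D0; rewrite [LHS]surjective_pairing [RHS]surjective_pairing /dualx /dualy /dotp.
by congr pair; rewrite /= /GRing.scale /=; rewrite /crossp in D0 *; field; exact: D0.
Qed.

(* If sigma had a finite slope k at m in the direction d, it would have the same slope along the
   whole segment, and the subgradients on a parallelogram of height b above the segment would
   fill an area o(b). *)
Lemma MA_steep m e d (lam a0 b0 : R) : crossp e d != 0 -> 0 < a0 -> 0 < b0 ->
  (forall a b : R, `|a| <= a0 -> 0 <= b <= b0 -> N (m + a *: e + b *: d)) ->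
  (forall a b : R, `|a| <= a0 -> 0 < b <= b0 -> I (m + a *: e + b *: d)) ->
  (forall a : R, `|a| <= a0 -> sigma (m + a *: e) = sigma m + a * lam) ->
  steep sigma m d.
Proof.
move=> D0 a00 b00 Nab Iab aff C; apply: contrapT => nst.
pose f (a b : R) := sigma (m + a *: e + b *: d) - sigma m - a * lam.
have f0 a : `|a| <= a0 -> f a 0 = 0 by move=> /aff E; rewrite /f scale0r addr0 E; ring.
have fconv (a b a' b' t : R) : `|a| <= a0 -> 0 <= b <= b0 -> `|a'| <= a0 -> 0 <= b' <= b0 -> 0 <= t <= 1 ->
    f ((1 - t) * a + t * a') ((1 - t) * b + t * b') <= (1 - t) * f a b + t * f a' b'.
  move=> ha hb ha' hb' ht; have := Nconv (Nab a b ha hb) (Nab a' b' ha' hb') ht.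
  have -> : (1 - t) *: (m + a *: e + b *: d) + t *: (m + a' *: e + b' *: d) =
    m + ((1 - t) * a + t * a') *: e + ((1 - t) * b + t * b') *: d by vring.
  by rewrite /f; lra.
have fC b : 0 < b <= b0 -> exists2 t : R, 0 < t < b & - C * t <= f 0 t.
  move=> /andP[b1 b2]; apply: contrapT => nt; apply: nst; exists b => // t tb.
  rewrite leNgt; apply/negP => h; apply: nt; exists t => //.
  by move: h; rewrite /f scale0r addr0 mul0r; lra.
have [k [low up]] := slope_along a00 b00 f0 fconv fC.
set D := crossp e d in D0.
have Dp : 0 < `|D| by rewrite normr_gt0.
pose a2 := a0 / 4; have a20 : 0 < a2 by rewrite divr_gt0.
(* With this choice the subgradients fill at most area [4/3 a2 b |D|], less than the area
   [2 a2 b |D|] of the parallelogram [K], against the Monge-Ampère inequality. *)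
pose om := a2 * `|D| / 3; have om0 : 0 < om by rewrite divr_gt0// mulr_gt0.
have [b1 /andP[b10 b1b] Hup] := up om om0.
pose b := b1 / 3; have bp : 0 < b by rewrite divr_gt0.
have b3 : 3 * b = b1 by rewrite /b; lra.
have [t1 t2 t3 t4] := dot_dual D0.
set tau := dualx e d in t1 t3; set iota := dualy e d in t2 t4.
have crt : crossp tau iota = D^-1.
  by rewrite /tau /iota /dualx /dualy /crossp /= -/(crossp e d) -/D /D /crossp; field; exact: D0.
have dec z : z = m + dotp tau (z - m) *: e + dotp iota (z - m) *: d.
  have : z - m = dotp tau (z - m) *: e + dotp iota (z - m) *: d by exact: dec_dual.
  by move=> h; rewrite -addrA -h addrC subrK.
pose K := par tau iota (dotp tau m) (dotp iota m + 3 / 2 * b) a2 (b / 2).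
have KE z : K z -> exists a be : R, [/\ z = m + a *: e + be *: d, `|a| <= a2 & b <= be <= 2 * b].
  move=> [h1 h2]; exists (dotp tau (z - m)), (dotp iota (z - m)); split.
  - exact: dec.
  - by rewrite dotpBr.
  - by rewrite dotpBr; move: h2; rewrite ler_norml => /andP[h2 h3]; apply/andP; split; lra.
have rng (a be : R) : `|a| <= a2 -> b <= be <= 2 * b -> `|a| <= a0 /\ 0 < be <= b0.
  rewrite /a2 => ? /andP[? ?]; split; first lra.
  by apply/andP; split; lra.
have KI : K `<=` I.
  by move=> z /KE[a [be [-> aa bb]]]; have [h1 h2] := rng _ _ aa bb; exact: Iab.
have KN : K `<=` N by move=> z /KI /IN.
have cK : compact K.
  apply: (@closed_bounded_compact _ _ (`|m| + a2 * `|e| + 2 * b * `|d|)); first exact: par_closed.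
  move=> z /KE[a [be [-> aa /andP[be1 be2]]]].
  apply: (le_trans (ler_normD _ _)); apply: lerD; last first.
    by rewrite normrZ ger0_norm ?ler_wpM2r//; apply: le_trans be1; exact: ltW.
  by apply: (le_trans (ler_normD _ _)); rewrite lerD2l normrZ ler_wpM2r.
have sub : subgrad_img N sigma K `<=` par e d lam (k + 3 / 2 * om) (2 * om * b / a2) (3 / 2 * om).
  move=> g [x Kx gx]; have [a [be [xE aa bb]]] := KE x Kx.
  suff [h1 h2] : a2 * `|dotp e g - lam| <= 2 * om * b /\ 0 <= dotp d g - k <= 3 * om.
    split; first by rewrite ler_pdivlMr// mulrC.
    by move: h2; rewrite ler_norml => /andP[? ?]; apply/andP; split; lra.
  apply: (@slope_box R f a0 b0 f0 k b a be om) => //.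
  - by rewrite b3.
  - by move=> a' b'; rewrite b3; exact: Hup.
  move=> a' be' ha' hb'; have := gx _ (Nab a' be' ha' hb').
  rewrite -[subp _ x]/(m + a' *: e + be' *: d - x) xE.
  have -> : m + a' *: e + be' *: d - (m + a *: e + be *: d) = (a' - a) *: e + (be' - be) *: d.
    by vring.
  by rewrite dotpDr !dotpZr [dotp g e]dotpC [dotp g d]dotpC /f; lra.
have b20 : 0 <= b / 2 by rewrite divr_ge0// ltW.
have P0 : 0 <= 2 * om * b / a2 by rewrite divr_ge0 ?(ltW a20)// !mulr_ge0// ltW.
have Q0 : 0 <= 3 / 2 * om by rewrite mulr_ge0 ?(ltW om0)// divr_ge0.
have crt0 : crossp tau iota != 0 by rewrite crt invr_eq0.
have mS : measurable (subgrad_img N sigma K : set (mpt R)).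
  by apply: closed_measurable2; exact: subgrad_img_closed.
have le2 : (mu2 (subgrad_img N sigma K) <=
    mu2 (par e d lam (k + 3 / 2 * om) (2 * om * b / a2) (3 / 2 * om)))%E.
  by apply: le_measure; rewrite ?inE//; exact: measurable_par.
have := le_trans (MA cK KI) le2.
rewrite /K !leb2_par// ?(ltW a20)// lee_fin crt -/D normfV invrK.
have -> : 4 * (2 * om * b / a2) * (3 / 2 * om) / `|D| = 4 / 3 * a2 * b * `|D|.
  by rewrite /om; field; rewrite !gt_eqF.
have : 0 < a2 * b * `|D| by rewrite !mulr_gt0.
lra.
Qed.

End Steepness.

(** * Flat parts *)

Section FlatParts.
Variable R : realType.
Notation pt := (R * R)%type.
Local Notation mu2 := (@leb2 R).
Implicit Types (z w g nu tau iota : pt) (E : seq (pt * R)) (Bd : seq (pt * pt)) (T : set pt).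

Section StrictSubgradient.
Variables (N I : set pt) (sigma : pt -> R) (M : R).
Hypothesis sc : {within N, continuous sigma}.
Hypothesis sb : forall x, N x -> `|sigma x| <= M.
Hypothesis oI : open I.
Hypothesis IN : I `<=` N.
Hypothesis MA : forall K, compact K -> K `<=` I -> (mu2 K <= mu2 (subgrad_img N sigma K))%E.
Hypothesis Nconv : forall x y (t : R), N x -> N y -> 0 <= t <= 1 ->
  sigma ((1 - t) *: x + t *: y) <= (1 - t) * sigma x + t * sigma y.
Hypothesis Iseg : forall p x (t : R), I p -> N x -> 0 <= t < 1 -> I ((1 - t) *: p + t *: x).

(** If the supporting plane at [p] met the graph again at [x], then [sigma] would be affine on the
    segment from [p] to [x]. Its midpoint is interior, and [MA_steep] would push [sigma] below the
    plane there. *)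
Lemma strict_subgrad p : I p -> exists g, forall x, N x -> x <> p ->
  sigma p + dotp g (x - p) < sigma x.
Proof.
move=> Ip; have [g Hg] := subgrad_nonempty sc sb oI IN MA Ip.
exists g => x Nx xp; rewrite ltNge; apply/negP => le1.
have gE y : N y -> sigma p + dotp g (y - p) <= sigma y by exact: Hg.
have xE : sigma x = sigma p + dotp g (x - p) by apply/le_anti; rewrite le1 gE.
pose e := x - p; have e0 : e != 0 by rewrite subr_eq0; apply/eqP.
pose m := p + (1 / 2) *: e.
have mE (a : R) : m + a *: e = (1 - (1 / 2 + a)) *: p + (1 / 2 + a) *: x by rewrite /m /e; vring.
have Im (a : R) : `|a| <= 1 / 4 -> I (m + a *: e).
  by rewrite ler_norml mE => /andP[a1 a2]; apply: Iseg => //; apply/andP; split; lra.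
have se (a : R) : `|a| <= 1 / 4 -> sigma (m + a *: e) = sigma p + (1 / 2 + a) * dotp g e.
  move=> aa; have := aa; rewrite ler_norml => /andP[a1 a2].
  apply/le_anti/andP; split.
    have t01 : 0 <= 1 / 2 + a <= 1 by apply/andP; split; lra.
    by have := Nconv (IN Ip) Nx t01; rewrite -mE xE -/e; lra.
  have := gE _ (IN (Im a aa)); suff -> : m + a *: e - p = (1 / 2 + a) *: e by rewrite dotpZr.
  by rewrite /m; vring.
have m0 : m + 0 *: e = m by rewrite scale0r addr0.
have q0 : `|0 : R| <= 1 / 4 by rewrite normr0.
have sm : sigma m = sigma p + 1 / 2 * dotp g e by have := se 0 q0; rewrite m0 addr0.
pose d := perp e.
have D0 : crossp e d != 0 by rewrite crossp_perp -enorm_sqr expf_neq0// enorm_eq0.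
pose K : set pt := [set w | exists2 t, 0 <= t <= 1 / 2 & w = m - (1 / 4) *: e + t *: e].
have KI : K `<=` I.
  move=> w [t /andP[t0 t1] ->]; have -> : m - (1 / 4) *: e + t *: e = m + (t - 1 / 4) *: e by vring.
  by apply: Im; rewrite ler_norml; apply/andP; split; lra.
have [r r0 Hr] := tube (@compact_ray R (m - (1 / 4) *: e) e (1 / 2)) oI KI.
have d1 : 0 < `|d| + 1 by rewrite ltr_wpDl.
pose b0 := r / (`|d| + 1).
have b00 : 0 < b0 by rewrite divr_gt0.
have b0E : b0 * (`|d| + 1) = r by rewrite divfK// gt_eqF.
have Iab (a b : R) : `|a| <= 1 / 4 -> 0 <= b <= b0 -> I (m + a *: e + b *: d).
  move=> aa /andP[bp bb]; apply: (Hr (m + a *: e)).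
    move: aa; rewrite ler_norml => /andP[a1 a2]; exists (a + 1 / 4); last by vring.
    by apply/andP; split; lra.
  rewrite addrC addKr normrZ ger0_norm//; have : b * `|d| <= b0 * `|d| by rewrite ler_wpM2r.
  lra.
have Iab' (a b : R) : `|a| <= 1 / 4 -> 0 < b <= b0 -> I (m + a *: e + b *: d).
  by move=> aa /andP[bp bb]; apply: Iab => //; rewrite ltW.
have Nab (a b : R) : `|a| <= 1 / 4 -> 0 <= b <= b0 -> N (m + a *: e + b *: d).
  by move=> aa bb; apply: IN; exact: Iab.
have aff (a : R) : `|a| <= 1 / 4 -> sigma (m + a *: e) = sigma m + a * dotp g e.
  by move=> aa; rewrite se// sm; ring.
have p4 : 0 < 1 / 4 :> R by rewrite divr_gt0.
(* The constant [1 - dotp g d] makes [sigma] fall below the supporting plane by at least [t] after a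
   step [t]. *)
have [t0 t00 Ht] := MA_steep sc IN MA Nconv D0 p4 b00 Nab Iab' aff (1 - dotp g d).
pose t := Num.min t0 b0 / 2.
have mt : 0 < Num.min t0 b0 by rewrite lt_min t00.
have tt0 : t < t0 by have : Num.min t0 b0 <= t0; [rewrite ge_min lexx|rewrite /t; lra].
have tb0 : t <= b0 by have : Num.min t0 b0 <= b0; [rewrite ge_min lexx orbT|rewrite /t; lra].
have tp : 0 < t by rewrite divr_gt0.
have := Ht t; rewrite tp tt0 => /(_ isT).
have : N (m + t *: d) by have := Nab 0 t q0; rewrite m0; apply; rewrite (ltW tp).
move=> /gE; have -> : m + t *: d - p = (1 / 2) *: e + t *: d by rewrite /m; vring.
rewrite dotpDr !dotpZr sm; lra.
Qed.

End StrictSubgradient.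

Lemma grad_line (u : pt -> R) z g d (c be : R) : 0 < be -> has_grad u z g ->
  (forall t, 0 <= t <= be -> u (z + t *: d) = u z + t * c) -> dotp g d = c.
Proof.
move=> be0 Hg H; apply/eqP; rewrite eq_le; apply/andP; split; rewrite leNgt; apply/negP => lt1.
- have [tau tau0 Ht] := grad_dir Hg lt1; pose t := Num.min tau be / 2.
  have mt : 0 < Num.min tau be by rewrite lt_min tau0.
  have : t < Num.min tau be by rewrite /t; lra.
  rewrite lt_min => /andP[t1 t2]; have tp : 0 < t by rewrite divr_gt0.
  by have := Ht t; rewrite tp t1 H ?ltxx ?(ltW tp) ?(ltW t2)// => /(_ isT).
- have lt2 : - c < dotp (- g) d by rewrite dotpNl ltrN2.
  have [tau tau0 Ht] := grad_dir (has_gradN Hg) lt2; pose t := Num.min tau be / 2.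
  have mt : 0 < Num.min tau be by rewrite lt_min tau0.
  have : t < Num.min tau be by rewrite /t; lra.
  rewrite lt_min => /andP[t1 t2]; have tp : 0 < t by rewrite divr_gt0.
  have := Ht t; rewrite tp t1 H ?(ltW tp) ?(ltW t2)// => /(_ isT).
  by rewrite opprD mulrN ltxx.
Qed.

Definition flat (F : set pt) (h : pt -> R) T : set pt := [set z | F z /\ exists2 s, T s &
  exists2 r : R, 0 < r & forall w, `|w - z| < r -> h w = h z + dotp s (w - z)].

Lemma flat_neg F h T z : flat F (negf h) (negs T) z -> flat F h T z.
Proof.
move=> [Fz [s Ts [r r0 H]]]; split=> //; exists (- s) => //; exists r => // w /H.
by rewrite /negf dotpNl; lra.
Qed.

Lemma flat_open F h T : open F -> open (flat F h T).
Proof.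
move=> /openP oF; apply/openP => z [/oF[r1 r10 H1] [s Ts [r r0 H]]].
exists (Num.min r1 (r / 2)); first by rewrite lt_min r10 divr_gt0.
move=> w; rewrite lt_min => /andP[/H1 Fw wr]; split=> //; exists s => //.
exists (r / 2); first by rewrite divr_gt0.
move=> x xr; have wr' : `|w - z| < r by lra.
have xr' : `|x - z| < r by have := ler_distD w x z; lra.
by rewrite (H _ xr') (H _ wr') !dotpBr; ring.
Qed.

(** For a polygon, a point of N on two non-parallel edges is a corner; this is how slopes at tight
    points are recognized. *)
Definition corner_cond (N : set pt) E T := forall s e e', N s -> e \in E -> e' \in E ->
  crossp e.1 e'.1 != 0 -> dotp e.1 s = e.2 -> dotp e'.1 s = e'.2 -> T s.

Lemma corner_cond_neg N E T : corner_cond N E T -> corner_cond (negs N) (map (@nege R) E) (negs T).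
Proof.
move=> H s _ _ Ns /mapP[e eE ->] /mapP[e' e'E ->] /= c es es'.
apply: (H (- s) e e') => //; rewrite ?dotpNr -?dotpNl//.
by apply: contraNneq c => c; rewrite /crossp /= !mulrNN; apply/eqP.
Qed.

(** [tight_affine] makes [h] affine on a parallelogram with vertex [z0]. The derivatives along its
    sides put the slope on two edges, hence at a corner. The diagonal leads at once into the
    interior of the parallelogram, where [h] is flat. *)
Lemma tight_escape Om F N Good sigma h E Bd T e z0 s : setting Om F N Good sigma h ->
  supports N E -> natural_boundary Om h E Bd -> corner_cond N E T -> e \in E -> F z0 ->
  ~ slack Om h e z0 -> off_ends Bd e.1 z0 -> has_grad h z0 s -> N s ->
  exists2 e', e' \in E & exists2 tau : R, 0 < tau &
    forall t, 0 < t < tau -> flat F h T (z0 + t *: (- (e.1 + e'.1))).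
Proof.
move=> S NE B CC eE Fz nsl oe Hs Ns; have Oz := s_FOm S Fz.
have [e' [be [e'E be0 cr H]]] := tight_affine S NE B eE Oz nsl oe.
have b00 : 0 <= (0 : R) <= be by rewrite lexx ltW.
have es : dotp e.1 s = e.2.
  apply: oppr_inj; rewrite -dotpNl dotpC; apply: (grad_line be0 Hs) => t tb.
  by have [_] := H t 0 tb b00; rewrite scale0r subr0 mul0r subr0 scalerN mulrN.
have es' : dotp e'.1 s = e'.2.
  apply: oppr_inj; rewrite -dotpNl dotpC; apply: (grad_line be0 Hs) => t tb.
  by have [_] := H 0 t b00 tb; rewrite scale0r subr0 mul0r subr0 scalerN mulrN.
have Ts := CC s e e' Ns eE e'E cr es es'.
exists e' => //.
have /openP /(_ _ Fz)[r r0 Hr] := s_Fopen S.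
have n1 : 0 < `|e.1 + e'.1| + 1 by rewrite ltr_wpDl.
exists (Num.min be (r / (`|e.1 + e'.1| + 1))); first by rewrite lt_min be0 divr_gt0.
move=> t /andP[t0]; rewrite lt_min ltr_pdivlMr// => /andP[tb tr].
have hz w (x y : R) : w = z0 - x *: e.1 - y *: e'.1 -> 0 <= x <= be -> 0 <= y <= be ->
    h w = h z0 + dotp s (w - z0).
  move=> wE xb yb; rewrite wE; have [_ ->] := H x y xb yb.
  rewrite (_ : z0 - x *: e.1 - y *: e'.1 - z0 = - (x *: e.1) - y *: e'.1); last by vring.
  by rewrite dotpBr dotpNr !dotpZr ![dotp s _]dotpC es es'; ring.
set z1 := z0 + _.
have z1E : z1 = z0 - t *: e.1 - t *: e'.1 by rewrite /z1; vring.
have tb' : 0 <= t <= be by rewrite !ltW.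
split.
  apply: Hr; rewrite /z1 addrC addKr normrZ normrN gtr0_norm//.
  by have : t * `|e.1 + e'.1| < t * (`|e.1 + e'.1| + 1); [rewrite ltr_pM2l// ltrDl|lra].
exists s => //.
set u := dualx e.1 e'.1; set v := dualy e.1 e'.1.
have c1 : 0 < 2 * (`|u| + `|v|) + 1 by rewrite ltr_wpDl// mulr_ge0// addr_ge0.
have mt : 0 < Num.min t (be - t) by rewrite lt_min t0 subr_gt0.
exists (Num.min t (be - t) / (2 * (`|u| + `|v|) + 1)); first by rewrite divr_gt0.
move=> w; rewrite ltr_pdivlMr// => wr.
have hu := dotp_le u (w - z1); have hv := dotp_le v (w - z1).
have nu0 : 0 <= `|u| * `|w - z1| by rewrite mulr_ge0.
have nv0 : 0 <= `|v| * `|w - z1| by rewrite mulr_ge0.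
have nw0 : 0 <= `|w - z1| by [].
pose x := t - dotp u (w - z1); pose y := t - dotp v (w - z1).
have wE : w = z0 - x *: e.1 - y *: e'.1.
  have wz : w - z1 = dotp u (w - z1) *: e.1 + dotp v (w - z1) *: e'.1 by exact: dec_dual.
  rewrite /x /y; move: (dotp u (w - z1)) (dotp v (w - z1)) wz => a b wz.
  by rewrite -[LHS](subrK z1) wz z1E; vring.
have lt1 : 2 * `|u| * `|w - z1| < Num.min t (be - t) by lra.
have lt2 : 2 * `|v| * `|w - z1| < Num.min t (be - t) by lra.
have xb : 0 <= x <= be.
  have := le_lt_trans hu lt1; rewrite lt_min !ltr_norml => /andP[/andP[? ?] /andP[? ?]].
  by rewrite /x; apply/andP; split; lra.
have yb : 0 <= y <= be.
  have := le_lt_trans hv lt2; rewrite lt_min !ltr_norml => /andP[/andP[? ?] /andP[? ?]].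
  by rewrite /y; apply/andP; split; lra.
rewrite (hz w x y wE xb yb) (hz z1 t t z1E tb' tb') !dotpBr; ring.
Qed.

Lemma negligible_seq (X : eqType) (l : seq X) (A : X -> set pt) :
  (forall x, x \in l -> mu2.-negligible (A x)) -> mu2.-negligible [set z | exists2 x, x \in l & A x z].
Proof.
elim: l => [|x l IH] H.
  by apply: negligibleS (negligible_set0 _) => z [].
apply: negligibleS (negligibleU (H x (mem_head _ _)) (IH (fun y yl => H y (@mem_behead _ (x :: l) y yl)))).
by move=> z [y]; rewrite inE => /predU1P[->|yl] Az; [left|right; exists y].
Qed.

(** Discarded are the points without gradient in N, the lines through endpoints of boundary
    segments, and the points that leave [Z] along one of finitely many diagonals. Elsewhere no edge
    is tight, for [h] or for [-h], so [rigid_at] applies and [flat_edge] excludes slopes outside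
    [T]. *)
Theorem flat_ae Om F N Good sigma h E Bd T : setting Om F N Good sigma h ->
  supports N E -> natural_boundary Om h E Bd -> corner_cond N E T ->
  (forall s, N s -> ~ Good s -> exists tau iota (eta0 : R),
    [/\ crossp tau iota != 0, 0 < eta0 & frozen_germ N Good E s tau iota eta0]) ->
  (forall s, N s -> ~ Good s -> ~ T s -> exists e tau iota (m0 : R),
    [/\ e \in E, crossp tau iota != 0 & 0 < m0] /\
    [/\ dotp e.1 s = e.2, dotp e.1 tau = 0, 0 < dotp e.1 iota &
     forall d m : R, 0 < d < m0 -> `|m| < m0 ->
       N (s + (d *: iota + m *: tau)) /\ steep sigma s (d *: iota + m *: tau)]) ->
  mu2.-negligible (F `\` flat F h T).
Proof.
move=> S NE B CC germ edge.
pose Z := F `\` flat F h T.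
have mZ : measurable (Z : set (mpt R)).
  apply: measurableD; apply: open_measurable2; first exact: s_Fopen S.
  exact: flat_open (s_Fopen S).
pose Z1 := [set z | Om z /\ ~ exists g, has_grad h z g /\ N g].
pose Z2 := [set z | exists2 e, e \in E & exists2 ab, ab \in Bd &
  crossp e.1 (z - ab.1) = 0 \/ crossp e.1 (z - ab.2) = 0].
pose esc d := [set z | Z z /\ exists2 tau : R, 0 < tau & forall t, 0 < t < tau -> ~ Z (z + t *: d)].
(* Diagonals occur with both signs because tightness for [-h] is reached by reflection. *)
pose Z3 := [set z | exists2 e, e \in E & exists2 e', e' \in E &
  (esc (- (e.1 + e'.1)) `|` esc (e.1 + e'.1)) z].
have n2 : mu2.-negligible Z2.
  apply: negligible_seq => e /NE[e0 _]; apply: negligible_seq => ab _.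
  have pe : perp e.1 <> 0.
    move=> pe; apply: e0; have [] : - e.1.2 = 0 /\ e.1.1 = 0 by case: pe.
    by move=> /eqP; rewrite oppr_eq0 => /eqP b a; rewrite [e.1]surjective_pairing a b.
  have cE c z : crossp e.1 (z - c) = dotp (perp e.1) z - dotp (perp e.1) c.
    by rewrite /crossp /dotp /perp /=; ring.
  apply: negligibleS (negligibleU (negligible_line (dotp (perp e.1) ab.1) pe)
    (negligible_line (dotp (perp e.1) ab.2) pe)) => z.
  by rewrite !cE => -[|] /eqP; rewrite subr_eq0 => /eqP; [left|right].
have n3 : mu2.-negligible Z3.
  apply: negligible_seq => e _; apply: negligible_seq => e' _.
  by apply: negligibleU; exact: negligible_escape.
apply: negligibleS (negligibleU (negligibleU (s_ae S) n2) n3) => z [Fz nf].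
have Oz := s_FOm S Fz.
have [[s [Hs Ns]]|nz] := pselect (exists g, has_grad h z g /\ N g); last by left; left.
have [|nz2] := pselect (Z2 z); first by left; right.
have oe e : e \in E -> off_ends Bd e.1 z.
  move=> eE ab abB; split; apply/eqP => c; apply: nz2; exists e => //; exists ab => //; by [left|right].
have Zout d (tau : R) : 0 < tau -> (forall t, 0 < t < tau -> flat F h T (z + t *: d)) -> esc d z.
  by move=> tau0 Hf; split=> //; exists tau => // t /Hf fz [_].
right; apply: contrapT => nz3; have nG := s_frozen S Fz Hs Ns.
have sl e : e \in E -> slack Om h e z /\ slack Om (negf h) (nege e) z.
  move=> eE; split; apply: contrapT => nsl; apply: nz3; exists e => //.
    have [e' e'E [tau tau0 Ht]] := tight_escape S NE B CC eE Fz nsl (oe _ eE) Hs Ns.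
    by exists e' => //; left; exact: Zout tau0 Ht.
  have oe' : off_ends Bd (nege e).1 z.
    move=> ab /(oe _ eE)[h1 h2]; have cN w : crossp (nege e).1 w = - crossp e.1 w.
      by rewrite /crossp /=; ring.
    by rewrite !cN !oppr_eq0.
  have Hs' : has_grad (negf h) z (- s) by apply/has_grad_negf; rewrite opprK.
  have Ns' : negs N (- s) by rewrite /negs /= opprK.
  have [_ /mapP[e' e'E ->] [tau tau0 Ht]] := tight_escape (setting_neg S) (supports_neg NE)
    (natural_boundary_neg B) (corner_cond_neg CC) (map_f _ eE) Fz nsl oe' Hs' Ns'.
  exists e' => //; right; apply: Zout tau0 _ => // t /Ht /flat_neg.
  by rewrite /= -opprD opprK.
have [tau [iota [eta0 [D0 eta00 gm]]]] := germ s Ns nG.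
have [r r0 Hr] := rigid_at S NE gm D0 eta00 Fz Hs sl.
have nT : ~ T s by move=> Ts; apply: nf; split=> //; exists s => //; exists r.
have [e [tau' [iota' [m0 [[eE D0' m00] [es et ei Hm]]]]]] := edge s Ns nG nT.
have [[Y [Y0 seg] hY] _] := sl e eE; have [e0 Ne] := NE e eE.
have [_ d2 _ d4] := dot_dual D0'.
have vE : dualy tau' iota' = (dotp e.1 iota')^-1 *: e.1.
  have ndec := dual_dec e.1 D0'; rewrite [dotp tau' _]dotpC et scale0r add0r [dotp iota' _]dotpC in ndec.
  by rewrite {2}ndec scalerA mulVf ?scale1r// gt_eqF.
set q := (dotp e.1 iota')^-1 in vE; have q0 : 0 < q by rewrite invr_gt0.
have qY : Y / q * q = Y by rewrite divfK// gt_eqF.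
apply: (@flat_edge R Om F N Good sigma h S z s tau' iota' (Y / q) r m0 D0' r0 m00 Oz Ns) => //.
- move=> x Nx; rewrite vE !dotpZl es ler_pM2l//; exact: Ne.
- by rewrite divr_ge0// ltW.
- move=> t /andP[t0 t1]; rewrite vE scalerA; apply: seg; rewrite mulr_ge0 ?(ltW q0)//=.
  by rewrite -ler_pdivlMr.
- by rewrite vE scalerA dotpZl mulrA qY es.
Qed.

End FlatParts.

(** * The polygon *)

Section Polygon.
Variable R : realType.
Notation pt := (R * R)%type.
Implicit Types (z w p q x y : pt).
Variables (P G : seq pt).
Hypothesis cP : ccw_convex_polygon P.

Let n := size P.
Let v i := cv P i.
Let dir i := v i.+1 - v i.
Let nu i := perp (dir i).
Let ell i z := dotp (nu i) (z - v i).

Let n3 : (3 <= n)%N. Proof. by case: cP. Qed.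
Let n0 : (0 < n)%N. Proof. exact: leq_trans n3. Qed.

Let v_mod i : v (i %% n) = v i. Proof. by rewrite /v /cv modn_mod. Qed.

Let vP i : v i \in P. Proof. by rewrite /v /cv mem_nth// ltn_pmod. Qed.

Let ellE i z : crossp (subp (cvnext P i) (cv P i)) (subp z (cv P i)) = ell i z.
Proof. by rewrite /ell /nu /dir /crossp /dotp /perp /=; ring. Qed.

Let dirS i : dir (i %% n) = dir i.
Proof. by rewrite /dir v_mod -[LHS]/(cv P (i %% n).+1 - v i) /cv -addn1 modnDml addn1. Qed.

Let ell_pos i j : (i < n)%N -> (j < n)%N -> j <> i -> j <> (i.+1 %% n)%N -> 0 < ell i (v j).
Proof. by move=> iP jP ji jiS; rewrite -ellE; case: cP => _; apply. Qed.

Let ell0 i : ell i (v i) = 0.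
Proof. by rewrite /ell subrr dotp0r. Qed.

Let ellS i : ell i (v i.+1) = 0.
Proof. by rewrite /ell /nu /dir /perp /dotp /=; ring. Qed.

Let ell_v i j : (i < n)%N -> (j < n)%N -> 0 <= ell i (v j).
Proof.
move=> iP jP; have [->|/eqP ji] := eqVneq j i; first by rewrite ell0.
have [->|/eqP jiS] := eqVneq j (i.+1 %% n)%N; first by rewrite v_mod ellS.
exact/ltW/ell_pos.
Qed.

Lemma polyNP z : polyN P z <-> forall i, (i < n)%N -> 0 <= ell i z.
Proof. by split=> H i iP; have := H i iP; rewrite ellE. Qed.

Lemma interiorNP z : interiorN P z <-> forall i, (i < n)%N -> 0 < ell i z.
Proof. by split=> H i iP; have := H i iP; rewrite ellE. Qed.

Let ell_aff i z w (t : R) : ell i ((1 - t) *: z + t *: w) = (1 - t) * ell i z + t * ell i w.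
Proof. by rewrite /ell /dotp /= /GRing.scale /=; ring. Qed.

Let ell_shift i z w (t : R) : ell i (z + t *: w) = ell i z + t * dotp (nu i) w.
Proof. by rewrite /ell /dotp /= /GRing.scale /=; ring. Qed.

Let succ_neq i : (i < n)%N -> (i.+1 %% n)%N <> i.
Proof.
move=> iP; have := n3; rewrite leq_eqVlt in iP; case/orP : iP => [/eqP iE|iP].
  by rewrite iE modnn => h; lia.
by rewrite modn_small// => h; lia.
Qed.

Let succ2_neq i : (i < n)%N -> (i.+2 %% n)%N <> i /\ (i.+2 %% n)%N <> (i.+1 %% n)%N.
Proof.
move=> iP; have h3 := n3; have [i2|i2] := ltnP i.+2 n; first by rewrite !modn_small//; lia.
have [i1|i1] := ltnP i.+1 n.
  have E : i.+2 = n by lia.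
  by rewrite E modnn (modn_small i1); split; lia.
have -> : i.+2 = (1 + n)%N by lia.
have -> : i.+1 = n by lia.
by rewrite modnDr modnn modn_small//; lia.
Qed.

Let nu_neq0 i : (i < n)%N -> nu i <> 0.
Proof.
move=> iP E; have [h1 h2] := succ2_neq iP.
by have := ell_pos iP (ltn_pmod i.+2 n0) h1 h2; rewrite /ell E dotp0l ltxx.
Qed.

(** Each edge is stored as its inward normal, a quarter turn of the counter-clockwise direction, and
    the minimum over N of the product with this normal. *)
Definition pedges : seq (pt * R) := [seq (perp (cvnext P i - cv P i), dotp (perp (cvnext P i - cv P i)) (cv P i)) | i <- iota 0 (size P)].

Let pedgesP e : e \in pedges -> exists2 i, (i < n)%N & e = (nu i, dotp (nu i) (v i)).
Proof. by move=> /mapP[i]; rewrite mem_iota add0n => iP ->; exists i. Qed.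

Lemma mem_pedges i : (perp (cvnext P i - cv P i), dotp (perp (cvnext P i - cv P i)) (cv P i)) \in pedges.
Proof.
rewrite -[(_, _)]/(nu i, dotp (nu i) (v i)) /nu -dirS -v_mod; apply/mapP.
by exists (i %% n)%N => //; rewrite mem_iota add0n ltn_pmod.
Qed.

Lemma supports_polyN : supports (polyN P) pedges.
Proof.
move=> _ /pedgesP[i iP ->]; split=> [|x /polyNP/(_ i iP)]; first exact: nu_neq0.
by rewrite /= /ell dotpBr subr_ge0.
Qed.

Lemma perp_dec (d w : pt) : dotp d d *: w = dotp d w *: d + dotp (perp d) w *: perp d.
Proof. rewrite /dotp /perp; vring. Qed.

Let dir_neq0 i : (i < n)%N -> dotp (dir i) (dir i) != 0.
Proof.
move=> iP; rewrite -enorm_sqr expf_neq0// enorm_eq0; apply/eqP => E.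
by apply: (nu_neq0 iP); rewrite /nu E /perp /= oppr0.
Qed.

Let pred_idx i : (i < n)%N -> exists2 j, (j < n)%N & i = (j.+1 %% n)%N.
Proof.
move=> iP; exists ((i + n.-1) %% n)%N; first by rewrite ltn_pmod.
by rewrite -addn1 modnDml -addnA addn1 prednK// modnDr modn_small.
Qed.

(* The two adjacent edges cut the segment out of its line. *)
Let on_edge i z : (i < n)%N -> polyN P z -> ell i z = 0 ->
  exists2 t : R, 0 <= t <= 1 & z = (1 - t) *: v i + t *: v i.+1.
Proof.
move=> iP /polyNP Nz ez; have dd := dir_neq0 iP.
pose t := dotp (dir i) (z - v i) / dotp (dir i) (dir i).
have zE : z = (1 - t) *: v i + t *: v i.+1.
  have zv : z - v i = t *: dir i.
    apply: (scalerI dd); rewrite [RHS]scalerA /t [_ * (_ / _)]mulrC divfK// perp_dec.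
    by rewrite -[dotp (perp _) _]/(ell i z) ez scale0r addr0.
  have -> : (1 - t) *: v i + t *: v i.+1 = v i + t *: dir i by rewrite /dir; vring.
  by rewrite -zv addrC subrK.
exists t => //; apply/andP; split.
  have [j jP ij] := pred_idx iP; have [h1 h2] := succ2_neq jP.
  have := Nz j jP; rewrite zE ell_aff.
  have -> : v i = v j.+1 by rewrite ij v_mod.
  have -> : v i.+1 = v (j.+2 %% n)%N.
    by rewrite v_mod -(v_mod i.+1) ij -[((_ %% n).+1)%N]addn1 modnDml addn1 v_mod.
  by rewrite ellS mulr0 add0r pmulr_lge0//; apply: ell_pos => //; exact: ltn_pmod.
have [h1 h2] := succ2_neq iP; have kP := ltn_pmod i.+1 n0.
have := Nz _ kP; rewrite zE ell_aff -[v i.+1]v_mod ell0 mulr0 addr0 pmulr_lge0 ?subr_ge0//.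
apply: ell_pos => //; first by move=> E; exact: (succ_neq iP).
by move=> E; apply: h1; rewrite {2}E -[((_ %% n).+1)%N]addn1 modnDml addn1.
Qed.

(** A point strictly inside edge [i] and on the line of edge [j] would put both endpoints of [i] on
    that line. The strict inequalities of the polygon allow only the endpoints of [j] there, so [i]
    would have to be [j]. *)
Let two_edges i j z : (i < n)%N -> (j < n)%N -> i <> j -> polyN P z -> ell i z = 0 -> ell j z = 0 -> z \in P.
Proof.
move=> iP jP ij Nz ei ej; have [t /andP[t0 t1] zE] := on_edge iP Nz ei.
have [t00|tn0] := eqVneq t 0; first by rewrite zE t00 subr0 scale1r scale0r addr0.
have [t11|tn1] := eqVneq t 1; first by rewrite zE t11 subrr scale1r scale0r add0r.
have tp : 0 < t by rewrite lt_neqAle eq_sym tn0.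
have tp1 : 0 < 1 - t by rewrite subr_gt0 lt_neqAle tn1.
have iS := ltn_pmod i.+1 n0.
have := ell_v jP iP; have := ell_v jP iS; rewrite v_mod => a0 b0.
have q1 : 0 <= (1 - t) * ell j (v i) by rewrite mulr_ge0// ltW.
have q2 : 0 <= t * ell j (v i.+1) by rewrite mulr_ge0// ltW.
move: ej; rewrite zE ell_aff => /eqP; rewrite paddr_eq0// !mulf_eq0 (gt_eqF tp) (gt_eqF tp1) /=.
move=> /andP[/eqP A /eqP B].
have iE : i = (j.+1 %% n)%N.
  apply: contrapT => ijS; have := ell_pos jP iP ij ijS; by rewrite A ltxx.
have [h1 h2] := succ2_neq jP.
have iSE : (i.+1 %% n = j.+2 %% n)%N by rewrite iE -[((_ %% n).+1)%N]addn1 modnDml addn1.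
have h1' : (i.+1 %% n)%N <> j by rewrite iSE.
have h2' : (i.+1 %% n)%N <> (j.+1 %% n)%N by rewrite iSE.
by have := ell_pos jP iS h1' h2'; rewrite v_mod B ltxx.
Qed.

Let ell_pos_off i j z : (i < n)%N -> (j < n)%N -> j <> i -> polyN P z -> ell i z = 0 -> ~ (z \in P) ->
  0 < ell j z.
Proof.
move=> iP jP ji Nz ei zP; rewrite lt_neqAle (polyNP z).1// andbT eq_sym; apply/eqP => ej.
by apply: zP; apply: (two_edges iP jP) => // ij; exact: ji.
Qed.

Lemma corner_polyN (T : set pt) : (forall q, q \in P -> T q) -> corner_cond (polyN P) pedges T.
Proof.
move=> PT s _ _ Ns /pedgesP[i iP ->] /pedgesP[j jP ->] /= c ei ej; apply: PT.
have z0 k : dotp (nu k) s = dotp (nu k) (v k) -> ell k s = 0 by rewrite /ell dotpBr => ->; rewrite subrr.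
apply: (two_edges iP jP) => //; [|exact: z0|exact: z0].
by move=> ij; move: c; rewrite ij crosspp eqxx.
Qed.

Lemma open_all (m : nat) (A : nat -> set pt) : (forall i, (i < m)%N -> open (A i)) ->
  open [set z | forall i, (i < m)%N -> A i z].
Proof.
elim: m => [|m IH] oA; first by rewrite (_ : [set z | _] = setT) ?predeqE//; exact: openT.
rewrite (_ : [set z | _] = [set z | forall i, (i < m)%N -> A i z] `&` A m).
  by apply: openI; [apply: IH => i im; apply: oA; exact: ltnW|exact: oA].
apply/seteqP; split=> z H; first by split=> [i im|]; apply: H => //; exact: ltnW.
by move=> i; rewrite ltnS leq_eqVlt => /predU1P[->|im]; [exact: H.2|exact: H.1].
Qed.

Lemma isolated (l : seq pt) p : exists2 r : R, 0 < r & forall q, q \in l -> q <> p -> r <= `|q - p|.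
Proof.
elim: l => [|q l [r r0 IH]]; first by exists 1.
have [->|/eqP qp] := eqVneq q p.
  by exists r => // x; rewrite inE => /predU1P[->//|]; exact: IH.
exists (Num.min r `|q - p|); first by rewrite lt_min r0 normr_gt0 subr_eq0; exact/eqP.
move=> x; rewrite inE => /predU1P[-> _|xl xp]; first by rewrite ge_min lexx orbT.
by rewrite ge_min IH.
Qed.

Let ell_open i : open [set z | 0 < ell i z].
Proof.
rewrite (_ : [set z | _] = [set z | dotp (- nu i) z < - dotp (nu i) (v i)]); first exact: open_half.
by apply/seteqP; split=> z /=; rewrite dotpNl ltrN2 /ell dotpBr subr_gt0.
Qed.

Lemma interiorN_open : open (interiorN P).
Proof.
rewrite (_ : interiorN P = [set z | forall i, (i < n)%N -> 0 < ell i z]).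
  by apply: open_all => i _; exact: ell_open.
by apply/seteqP; split=> z /interiorNP.
Qed.

Lemma polyN_closed : closed (polyN P).
Proof.
apply/closedP => z H; apply/polyNP => i iP; rewrite leNgt; apply/negP => lt0.
have /openP : open [set w | dotp (nu i) w < dotp (nu i) (v i)] by exact: open_half.
move=> /(_ z); rewrite /= -subr_lt0 -dotpBr => /(_ lt0)[r r0 Hr].
have [w /polyNP /(_ i iP) Nw wz] := H r r0.
by have := Hr w wz; rewrite /= -subr_lt0 -dotpBr ltNge Nw.
Qed.

Lemma interiorN_sub : interiorN P `<=` polyN P.
Proof. by move=> z /interiorNP H; apply/polyNP => i /H /ltW. Qed.

Lemma polyN_conv x y (t : R) : polyN P x -> polyN P y -> 0 <= t <= 1 -> polyN P ((1 - t) *: x + t *: y).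
Proof.
move=> /polyNP Nx /polyNP Ny /andP[t0 t1]; apply/polyNP => i iP.
by rewrite ell_aff addr_ge0// mulr_ge0 ?subr_ge0 ?Nx ?Ny.
Qed.

Lemma interiorN_seg p x (t : R) : interiorN P p -> polyN P x -> 0 <= t < 1 ->
  interiorN P ((1 - t) *: p + t *: x).
Proof.
move=> /interiorNP Ip /polyNP Nx /andP[t0 t1]; apply/interiorNP => i iP.
by rewrite ell_aff ltr_pwDl ?mulr_gt0 ?mulr_ge0 ?subr_gt0 ?Ip ?Nx.
Qed.

Definition regular : set pt := [set z | interiorN P z /\ ~ (z \in G)].

Lemma regular_open : open regular.
Proof.
apply/openP => z [Iz Gz]; have /openP /(_ _ Iz)[r r0 Hr] := interiorN_open.
have [r1 r10 H1] := isolated G z.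
exists (Num.min r r1); first by rewrite lt_min r0.
move=> w; rewrite lt_min => /andP[/Hr Iw wz]; split=> // wG.
have wn : w <> z by move=> E; apply: Gz; rewrite -E.
by have := H1 w wG wn; rewrite leNgt wz.
Qed.

Let frozen_cases s : polyN P s -> ~ regular s -> s \in G \/ exists2 i, (i < n)%N & ell i s = 0.
Proof.
move=> Ns ns; have [sG|sG] := pselect (s \in G); [by left|right].
apply: contrapT => ne; apply: ns; split=> //; apply/interiorNP => i iP.
rewrite lt_neqAle (polyNP s).1// andbT eq_sym; apply/eqP => ei; apply: ne; by exists i.
Qed.

Let near_off i p : (i < n)%N -> polyN P p -> ell i p = 0 -> ~ (p \in P) ->
  exists2 r : R, 0 < r & forall w, `|w - p| < r -> (forall j, (j < n)%N -> j <> i -> 0 < ell j w) /\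
    (w <> p -> ~ (w \in G)).
Proof.
move=> iP Np ei pP.
pose A j := [set w | j = i \/ 0 < ell j w].
have oA : open [set w | forall j, (j < n)%N -> A j w].
  apply: open_all => j _; have [->|/eqP ji] := eqVneq j i.
    by rewrite (_ : A i = setT) ?predeqE; [exact: openT|move=> w; split=> // _; left].
  rewrite (_ : A j = [set w | 0 < ell j w]); first exact: ell_open.
  by apply/seteqP; split=> w; [case|right].
have /openP /(_ p)[|r r0 Hr] := oA.
  move=> j jP; have [->|/eqP ji] := eqVneq j i; [by left|right].
  exact: (ell_pos_off iP jP).
have [r1 r10 H1] := isolated G p.
exists (Num.min r r1); first by rewrite lt_min r0.
move=> w; rewrite lt_min => /andP[/Hr Aw wp]; split=> [j jP ji|wn wG].
  by have [] := Aw j jP.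
by have := H1 w wG wn; rewrite leNgt wp.
Qed.

Let inward_edge i p : (i < n)%N -> polyN P p -> ell i p = 0 -> ~ (p \in P) -> inward regular (nu i) p.
Proof.
move=> iP Np ei pP w nw; have [r r0 Hr] := near_off iP Np ei pP.
have w0 : 0 < `|w| + 1 by rewrite ltr_wpDl.
exists (r / (`|w| + 1)); first by rewrite divr_gt0.
move=> d /andP[d0]; rewrite ltr_pdivlMr// => dr.
have dw : `|p + d *: w - p| < r.
  rewrite addrC addKr normrZ gtr0_norm//.
  by have : d * `|w| < d * (`|w| + 1); [rewrite ltr_pM2l// ltrDl|lra].
have [h1 h2] := Hr _ dw.
have ep : 0 < ell i (p + d *: w) by rewrite ell_shift ei add0r mulr_gt0.
split.
  apply/interiorNP => j jP; have [->//|/eqP ji] := eqVneq j i.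
  exact: h1.
by apply: h2 => E; move: ep; rewrite E ei ltxx.
Qed.

(** Close to [s] there are no other corners or gas points and no edges missing [s]. A frozen slope
    near [s] thus lies in the relative interior of an edge through [s], and at most two edges pass
    through a point. *)
Lemma germ_polyN s : polyN P s -> ~ regular s -> exists tau iota (eta0 : R),
  [/\ crossp tau iota != 0, 0 < eta0 & frozen_germ (polyN P) regular pedges s tau iota eta0].
Proof.
move=> Ns _.
pose A j := [set w | ell j s = 0 \/ 0 < ell j w].
have oA : open [set w | forall j, (j < n)%N -> A j w].
  apply: open_all => j _; have [e0|/eqP ne] := eqVneq (ell j s) 0.
    by rewrite (_ : A j = setT) ?predeqE; [exact: openT|move=> w; split=> // _; left].
  rewrite (_ : A j = [set w | 0 < ell j w]); first exact: ell_open.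
  by apply/seteqP; split=> w; [case|right].
have /openP /(_ s)[|r r0 Hr] := oA.
  move=> j jP; have [e0|ne] := eqVneq (ell j s) 0; [by left|right].
  by rewrite lt_neqAle (polyNP s).1// andbT eq_sym.
have [r1 r10 H1] := isolated G s; have [r2 r20 H2] := isolated P s.
pose eta0 := Num.min r (Num.min r1 r2).
have eta00 : 0 < eta0 by rewrite !lt_min r0 r10.
have core p : polyN P p -> ~ regular p -> `|p - s| < eta0 -> p <> s -> exists i, [/\ (i < n)%N,
    ell i s = 0, ell i p = 0 & inward regular (nu i) p].
  move=> Np np; rewrite !lt_min => /and3P[pr p1 p2] ps.
  have [pG|[i iP ei]] := frozen_cases Np np.
    by have := H1 p pG ps; rewrite leNgt p1.
  have pP : ~ (p \in P) by move=> /H2 /(_ ps); rewrite leNgt p2.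
  exists i; split=> //; last exact: inward_edge.
  by have [//|] := Hr p pr i iP; rewrite ei ltxx.
suff [tau [iota [D0 Hax]]] : exists tau iota, crossp tau iota != 0 /\ forall i, (i < n)%N -> ell i s = 0 ->
    forall w, dotp (nu i) w = 0 -> crossp w tau = 0 \/ crossp w iota = 0.
  exists tau, iota, eta0; split=> // p Np np pe ps; have [i [iP es ep inw]] := core p Np np pe ps.
  have dE z : ell i z = 0 -> dotp (nu i) z = dotp (nu i) (v i).
    by rewrite /ell dotpBr => /eqP; rewrite subr_eq0 => /eqP.
  split; first by apply: (Hax i iP es); rewrite dotpBr !dE// subrr.
  exists (nu i, dotp (nu i) (v i)); first exact: mem_pedges.
  by split=> //; exact: dE.
have axis i w : dotp (nu i) w = 0 -> crossp w (dir i) = 0.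
  by rewrite /nu /perp /dotp /crossp /= => h; lra.
have [[i iP es]|ne] := pselect (exists2 i, (i < n)%N & ell i s = 0); last first.
  (* No edge passes through [s], so there is no frozen slope close to it and any basis will do. *)
  exists (1, 0), (0, 1); split; first by rewrite /crossp /= !mulr0 mulr1 subr0 oner_eq0.
  by move=> i iP es; exfalso; apply: ne; exists i.
have [[j [jP ji ej]]|nj] := pselect (exists j, [/\ (j < n)%N, j <> i & ell j s = 0]).
  have sP : s \in P by exact: (two_edges jP iP).
  have mP : (index s P < n)%N by rewrite index_mem.
  pose m := index s P.
  have sE : s = v m by rewrite /v /cv modn_small// nth_index.
  have [q qP qm] := pred_idx mP; have [h1 h2] := succ2_neq qP.
  (* At a corner the axes are the preceding edge [q] and the following edge [m]; their cross product
     is the height over [q] of the corner after next. *)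
  exists (dir q), (dir m); split.
    have -> : crossp (dir q) (dir m) = ell q (v (q.+2 %% n)%N).
      have -> : v (q.+2 %% n)%N = v m.+1.
        by rewrite -(v_mod m.+1) /m qm -[((_ %% n).+1)%N]addn1 modnDml addn1.
      have e0 : ell q (v m) = 0 by rewrite /m qm v_mod ellS.
      rewrite -[LHS]add0r -e0 /ell /nu /dir /perp /crossp /dotp /=; ring.
    by rewrite gt_eqF// ell_pos// ltn_pmod.
  move=> k kP ek w nw; have [E|/eqP mk] := eqVneq m k.
    by right; apply: axis; rewrite E.
  left; apply: axis; suff <- : k = q by [].
  have mE : m = (k.+1 %% n)%N.
    by apply: contrapT => mS; have := ell_pos kP mP mk mS; rewrite -/m -sE ek ltxx.
  have : (k + 1 == q + 1 %[mod n])%N by rewrite !addn1 -mE -qm.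
  by rewrite eqn_modDr !modn_small// => /eqP.
exists (dir i), (nu i); split; first by rewrite crossp_perp dir_neq0.
move=> k kP ek w nw; left; have [E|/eqP ki] := eqVneq k i; first by apply: axis; rewrite -E.
by exfalso; apply: nj; exists k.
Qed.

Lemma edge_strip s : polyN P s -> ~ regular s -> ~ (s \in P) -> ~ (s \in G) ->
  exists i (t rho : R), let d : pt := cvnext P i - cv P i in
  [/\ (i < size P)%N, 0 < t < 1, s = affc (cv P i) (cvnext P i) t & 0 < rho] /\
  [/\ dotp d d != 0, dotp (perp d) s = dotp (perp d) (cv P i),
   forall a : R, `|a| <= rho -> boundaryN P (s + a *: d) &
   forall a b : R, `|a| <= rho -> 0 < b <= rho -> interiorN P (s + a *: d + b *: perp d)].
Proof.
move=> Ns ns sP sG; have [//|[i iP es]] := frozen_cases Ns ns.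
have [t /andP[t0 t1] sE] := on_edge iP Ns es.
have tn0 : t != 0.
  by apply/eqP => E; apply: sP; rewrite sE E subr0 scale1r scale0r addr0.
have tn1 : t != 1.
  by apply/eqP => E; apply: sP; rewrite sE E subrr scale0r scale1r add0r.
have [r r0 Hr] := near_off iP Ns es sP.
have c0 : 0 < `|dir i| + `|nu i| + 1 by rewrite ltr_wpDl// addr_ge0.
pose rho := r / (`|dir i| + `|nu i| + 1) / 2.
have rho0 : 0 < rho by rewrite !divr_gt0.
have rhoE : rho * (`|dir i| + `|nu i| + 1) < r.
  by rewrite /rho mulrAC divfK ?gt_eqF//; lra.
have near (x y : R) : `|x| <= rho -> 0 <= y <= rho -> forall j, (j < n)%N -> j <> i ->
    0 < ell j (s + x *: dir i + y *: nu i).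
  move=> xr /andP[y0 yr]; apply: (Hr _ _).1.
  rewrite -[s + _ + _]addrA [s + _]addrC addrK; apply: le_lt_trans (ler_normD _ _) _.
  rewrite !normrZ (ger0_norm y0); apply: le_lt_trans rhoE.
  have : `|x| * `|dir i| <= rho * `|dir i| by rewrite ler_wpM2r.
  have : y * `|nu i| <= rho * `|nu i| by rewrite ler_wpM2r.
  lra.
have nd : dotp (nu i) (dir i) = 0 by rewrite /nu /perp /dotp /=; ring.
have nn : 0 < dotp (nu i) (nu i).
  by rewrite -enorm_sqr exprn_even_gt0//= enorm_eq0; apply/eqP; exact: nu_neq0.
have elli (x y : R) : ell i (s + x *: dir i + y *: nu i) = y * dotp (nu i) (nu i).
  by rewrite !ell_shift es nd mulr0 !add0r.
exists i, t, rho => d; split; split=> //.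
- by rewrite !lt_neqAle eq_sym tn0 t0 tn1.
- by rewrite affcE sE; vring.
- exact: dir_neq0.
- by move/eqP : es; rewrite /ell dotpBr subr_eq0 => /eqP.
- move=> x xr; have yr : 0 <= (0 : R) <= rho by rewrite lexx ltW.
  have h := near x 0 xr yr; have h' := elli x 0; rewrite scale0r addr0 mul0r in h h'.
  split; last by move=> /interiorNP /(_ i iP); rewrite h' ltxx.
  apply/polyNP => j jP; have [->|/eqP ji] := eqVneq j i; first by rewrite h'.
  exact/ltW/h.
- move=> x y xr /andP[y0 yr]; apply/interiorNP => j jP.
  have [->|/eqP ji] := eqVneq j i; first by rewrite elli mulr_gt0.
  by apply: near => //; rewrite (ltW y0).
Qed.

Lemma vertex_mem : cv P 0 \in P.
Proof. exact: vP. Qed.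

Lemma polyN_halfplane p : ~ polyN P p -> exists (a : pt) (b : R),
  [/\ a <> 0, dotp a p < b & forall x, polyN P x -> b <= dotp a x].
Proof.
move=> np; apply: contrapT => nex; apply: np; apply/polyNP => i iP; rewrite leNgt; apply/negP => lt0.
apply: nex; exists (nu i), (dotp (nu i) (v i)); split; first exact: nu_neq0.
  by rewrite -subr_lt0 -dotpBr.
by move=> x /polyNP /(_ i iP); rewrite /ell dotpBr subr_ge0.
Qed.

End Polygon.

(** * The theorem *)

Section PiecewiseAffine.
Variable R : realType.
Implicit Types (f : R -> R) (s : nat -> R).

Lemma locate_right s n t : s 0%N <= t < s n -> exists2 m, (m < n)%N & s m <= t < s m.+1.
Proof.
elim: n => [|n IH] /andP[t0 tn]; first by have := le_lt_trans t0 tn; rewrite ltxx.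
have [nt|tn'] := leP (s n) t; first by exists n => //; rewrite nt.
by have [|m mn Hm] := IH; [rewrite t0|exists m => //; exact: ltnW].
Qed.

Lemma locate_left s n t : s 0%N < t <= s n -> exists2 m, (m < n)%N & s m < t <= s m.+1.
Proof.
elim: n => [|n IH] /andP[t0 tn]; first by have := lt_le_trans t0 tn; rewrite ltxx.
have [nt|tn'] := ltP (s n) t; first by exists n => //; rewrite nt.
by have [|m mn Hm] := IH; [rewrite t0|exists m => //; exact: ltnW].
Qed.

Lemma deriv1_side f t sl a (e d : R) : has_deriv1 f t sl -> `|e| = 1 -> 0 < d ->
  (forall x, 0 <= x <= d -> f (t + e * x) = f t + a * (e * x)) -> a = sl.
Proof.
move=> Hf e1 d0 H; apply/eqP; rewrite -subr_eq0; apply/negPn/negP => ne.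
have ep : 0 < `|a - sl| / 2 by rewrite divr_gt0// normr_gt0.
have [r r0 Hr] := Hf _ ep; pose x := Num.min d (r / 2).
have x0 : 0 < x by rewrite lt_min d0 divr_gt0.
have xd : x <= d by rewrite ge_min lexx.
have xr : x < r by have : x <= r / 2; [rewrite ge_min lexx orbT|lra].
have te : t + e * x - t = e * x by ring.
have := Hr (t + e * x); rewrite te H ?(ltW x0)// normrM e1 mul1r gtr0_norm// => /(_ xr).
have -> : f t + a * (e * x) - f t - sl * (e * x) = (a - sl) * (e * x) by ring.
rewrite !normrM e1 mul1r (gtr0_norm x0); have : 0 < `|a - sl| * x by rewrite mulr_gt0 ?normr_gt0.
lra.
Qed.

(** The pieces to the right and to the left of [t] must both have slope [sl], so a break point at
    [t] would be spurious. This is how a slope outside [Qset] yields an affine boundary datum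
    nearby. *)
Lemma pw_affine_smooth f t sl : pw_affine01 f -> 0 < t < 1 -> has_deriv1 f t sl ->
  exists2 d : R, 0 < d & forall t', `|t' - t| <= d -> f t' = f t + sl * (t' - t).
Proof.
move=> [n [s [s0 [sn [_ Ha]]]]] /andP[t0 t1] Hf.
have [|m mn /andP[m1 m2]] := @locate_right s n t; first by rewrite s0 sn (ltW t0).
have [|k kn /andP[k1 k2]] := @locate_left s n t; first by rewrite s0 sn t0 ltW.
have [a [b Hab]] := Ha m mn; have [a' [b' Hab']] := Ha k kn.
have aE : a = sl.
  apply: (@deriv1_side f t sl a 1 (s m.+1 - t)) => //; rewrite ?normr1 ?subr_gt0//.
  move=> x /andP[x0 x1]; rewrite !Hab; first ring.
    by rewrite m1 ltW.
  by apply/andP; split; lra.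
have aE' : a' = sl.
  apply: (@deriv1_side f t sl a' (-1) (t - s k)) => //; rewrite ?normrN ?normr1 ?subr_gt0//.
  move=> x /andP[x0 x1]; rewrite !Hab'; first ring.
    by rewrite k2 ltW.
  by apply/andP; split; lra.
exists (Num.min (s m.+1 - t) (t - s k)); first by rewrite lt_min !subr_gt0 m2.
move=> t'; rewrite le_min !ler_norml => /andP[/andP[h1 h2] /andP[h3 h4]].
have [tt|tt] := leP t t'.
  rewrite !Hab ?aE; first ring; apply/andP; split; lra.
rewrite !Hab' ?aE'; first ring; apply/andP; split; lra.
Qed.

End PiecewiseAffine.

(** * The minimizer satisfies the abstract hypotheses *)

Section Assembly.
Variable R : realType.
Notation pt := (R * R)%type.
Local Notation mu2 := (@leb2 R).
Variables (P G : seq pt) (c L sigma : pt -> R) (Om : set pt) (comps : seq (seq pt))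
  (asg : nat -> nat -> nat) (h0 h : pt -> R).
Hypothesis cP : ccw_convex_polygon P.
Hypothesis cG : forall q, q \in G -> 0 < c q.
Hypothesis bL : boundary_datum P L.
Hypothesis st : surface_tension P G c L sigma.
Hypothesis nd : natural_domain P Om comps asg.
Hypothesis nbv : natural_boundary_value P Om comps asg h0.
Hypothesis hm : is_minimizer P sigma Om h0 h.

Let sigma_conv x y (t : R) : polyN P x -> polyN P y -> 0 <= t <= 1 ->
  sigma ((1 - t) *: x + t *: y) <= (1 - t) * sigma x + t * sigma y.
Proof.
move=> Nx Ny t01; have -> : (1 - t) *: x + t *: y = affc x y t by rewrite affcE; vring.
by case: st => cv _; exact: cv.
Qed.

Let sigma_cont : {within polyN P, continuous sigma}.
Proof. by case: st => _ [_ []]. Qed.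

Let sigma_MA (K : set pt) : compact K -> K `<=` interiorN P -> (mu2 K <= mu2 (subgrad_img (polyN P) sigma K))%E.
Proof.
move=> cK KI; case: st => _ [_ [_ [_ ->//]]]; rewrite leeDl// lee_fin big_seq_cond.
by apply: sumr_ge0 => q /andP[qG _]; exact/ltW/cG.
Qed.

Let boundary_sigma z : boundaryN P z -> sigma z = L z.
Proof. by case: st => _ [_ [_ [H _]]]; exact: H. Qed.

Let F := Om `\` closure (liquid P G Om h).
Let T : set pt := [set a | a \in P \/ Qset P L a \/ a \in G].

Lemma minimizer_setting : setting Om F (polyN P) (regular P G) sigma h.
Proof.
case: (nd) => -[oOm [_ [_ [[M HM] _]]]] _.
case: (hm) => -[hlip [hae hbd]] hmin; case: (st) => _ [[Ms HMs] _].
split.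
- exact: oOm.
- by exists M => z /HM[h1 h2]; apply/norm_leP.
- by rewrite /F setDE; apply: openI => //; apply: closed_openC; exact: closed_closure.
- by move=> z [].
- exact: polyN_closed.
- by move=> x y t; exact: polyN_conv.
- exact: polyN_halfplane.
- exact: regular_open.
- by move=> z [/interiorN_sub].
- exact: sigma_conv.
- exact: sigma_cont.
- by exists Ms.
- move=> p Rp; have [Ip _] := Rp; have [g Hg] := strict_subgrad sigma_cont HMs (@interiorN_open R P)
    (@interiorN_sub R P) sigma_MA sigma_conv (@interiorN_seg R P) Ip.
  exists g; split=> [x Nx|x Nx nx].
    have [->|/eqP xp] := eqVneq x p; first by rewrite subrr dotp0r addr0.
    exact/ltW/Hg.
  by apply: Hg => // E; apply: nx; rewrite E.
- have [K HK] := hlip; exists (2 * `|K|); first by rewrite mulr_ge0.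
  move=> x y cx cy; apply: le_trans (HK x y cx cy) _.
  apply: (@le_trans _ _ (`|K| * enorm (subp x y))).
    by rewrite ler_wpM2r ?enorm_ge0// ler_norm.
  by rewrite [2 * _]mulrC -mulrA ler_wpM2l// -[subp x y]/(x - y) enorm_le.
- exact: hae.
- move=> z x [Oz nc] Hx _ [Ix xG]; apply: nc; apply: subset_closure; split=> //.
  by exists x.
- move=> u ulip uae ubd; apply: hmin; split=> //; split=> // z cz.
  by rewrite ubd// hbd.
Qed.

Let Bd : seq (pt * pt) := flatten [seq [seq (cv C j, cvnext C j) | j <- iota 0 (size C)] | C <- comps].

Let BdP ab : ab \in Bd <-> exists a j, [/\ (a < size comps)%N, (j < size (nth [::] comps a))%N &
  ab = (cv (nth [::] comps a) j, cvnext (nth [::] comps a) j)].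
Proof.
split=> [/flatten_mapP[C /(nthP [::])[a aS <-] /mapP[j]]|[a [j [aS jS ->]]]].
  by rewrite mem_iota add0n => jS ->; exists a, j.
apply/flatten_mapP; exists (nth [::] comps a); first exact: mem_nth.
by apply/mapP; exists j => //; rewrite mem_iota add0n.
Qed.

Let normal_dir (d w : pt) : d <> 0 -> w <> 0 -> dotp w d = 0 -> exists2 l : R, l != 0 & w = l *: perp d.
Proof.
move=> d0 w0 wd; have dd : dotp d d != 0 by rewrite -enorm_sqr expf_neq0// enorm_eq0; exact/eqP.
have wE : w = (dotp (perp d) w / dotp d d) *: perp d.
  apply: (scalerI dd); rewrite scalerA [_ * (_ / _)]mulrC divfK//.
  by rewrite perp_dec [dotp d w]dotpC wd scale0r add0r.
exists (dotp (perp d) w / dotp d d) => //; apply/eqP => l0.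
by apply: w0; rewrite wE l0 scale0r.
Qed.

(** On the segment from vertex [j] to the next one, [h0] has the assigned corner as slope. By (ND1)
    or (ND3) the segment is orthogonal to one of the two edges of N that meet at this corner, so the
    corner gives the minimal value for that edge. *)
Lemma minimizer_boundary : natural_boundary Om h (pedges P) Bd.
Proof.
case: (nd) => -[_ [_ [_ [_ [_ [simp [disj bdE]]]]]]] nat.
case: (hm) => -[_ [_ hbd]] _; case: (nbv) => _ nv.
have segbd ab z : ab \in Bd -> seg ab.1 ab.2 z -> (closure Om `\` Om) z.
  move=> /BdP[a [j [aS jS ->]]] zs; rewrite bdE; exists a => //; by exists j.
split.
- move=> z cz nz; have : (closure Om `\` Om) z by [].
  rewrite bdE => -[a aS [j jS zs]].
  by exists (cv (nth [::] comps a) j, cvnext (nth [::] comps a) j) => //; apply/BdP; exists a, j.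
- by move=> z ab abB /(segbd _ _ abB)[].
- move=> z ab ab' /BdP[a [j [aS jS abE]]] /BdP[a' [j' [aS' jS' abE']]] ne; rewrite abE abE' => zs zs'.
  have [aa|/eqP aa] := eqVneq a a'; last first.
    exfalso; have /disj_setPS H := disj a a' aS aS' aa.
    by apply: (H z); split; [exists j|exists j'].
  rewrite -aa in jS' zs' abE'; have jj : j <> j' by move=> E; apply: ne; rewrite abE abE' E.
  have [_ [_ H]] := simp a aS.
  by have [[_ ->]|[_ ->]] := H j j' z jS jS' jj zs zs'; [right|left].
move=> ab abB; have /BdP[a [j [aS jS abE]]] := abB.
have [nS ND] := nat a j aS jS; set C := nth [::] comps a in jS abE nS ND.
have [_ [ed _]] := simp a aS; have cne : cvnext C j - cv C j <> 0.
  by move=> /eqP; rewrite subr_eq0 => /eqP E; exact: (ed j jS (esym E)).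
set m := asg a j in nS ND.
have hE t : 0 <= t <= 1 -> h (affc (cv C j) (cvnext C j) t) =
    h (cv C j) + t * dotp (cv P m) (cvnext C j - cv C j).
  move=> t01; have sg : seg (cv C j) (cvnext C j) (affc (cv C j) (cvnext C j) t) by exists t.
  have s0 : seg (cv C j) (cvnext C j) (cv C j) by exists 0; rewrite affc0 lexx ler01.
  have sb z : seg (cv C j) (cvnext C j) z -> (closure Om `\` Om) z.
    by move=> zs; apply: (segbd ab) => //; rewrite abE.
  rewrite (hbd _ (sb _ sg)) (hbd _ (sb _ s0)).
  rewrite (nv a j aS jS _ (or_intror sg)) addrC; congr (_ + _).
  have subpE (x y : pt) : subp x y = x - y by [].
  by rewrite affcE subpE [cv C j + _]addrC addrK dotpZr.
suff [k [kE dk]] : exists k, dotp (perp (cvnext P k - cv P k)) (cv P k) = dotp (perp (cvnext P k - cv P k)) (cv P m)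
    /\ (cvnext P k - cv P k <> 0 /\ dotp (cvnext C j - cv C j) (cvnext P k - cv P k) = 0).
  case: dk => d0 dk; have [l l0 wE] := normal_dir d0 cne dk.
  exists (perp (cvnext P k - cv P k), dotp (perp (cvnext P k - cv P k)) (cv P k)), l; split=> //.
  - exact: mem_pedges.
  - by rewrite abE.
  - by move=> t t01; rewrite abE /= hE// wE dotpZr [dotp (cv P m) _]dotpC kE mulrA.
have dn k : cvnext P k - cv P k <> 0.
  move=> E; have [] := supports_polyN cP (mem_pedges cP k); rewrite /= E /perp /= oppr0.
  by case.
(* (ND1) selects the edge leaving the assigned corner, (ND3) the edge arriving at it; the index
   [m + (size P).-1] is the predecessor of [m] modulo [size P]. *)
case: ND => [[_ D]|[_ D]].
  by exists m.
have pS : cvnext P (m + (size P).-1) = cv P m.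
  have P0 : (0 < size P)%N by apply: leq_ltn_trans nS.
  by rewrite /cvnext /cv -addnS prednK// modnDr.
exists (m + (size P).-1)%N; split; last by split; [exact: dn|rewrite pS].
rewrite pS /perp /dotp /=; ring.
Qed.

(** As [s] is neither corner nor in [Qset], the datum [L] is affine on the edge near [s], and so is
    [sigma]. [MA_steep] then applies in every direction transversal to the edge and pointing
    inwards. *)
Lemma edge_steepness s : polyN P s -> ~ regular P G s -> ~ T s -> exists e tau iota (m0 : R),
  [/\ e \in pedges P, crossp tau iota != 0 & 0 < m0] /\
  [/\ dotp e.1 s = e.2, dotp e.1 tau = 0, 0 < dotp e.1 iota &
   forall d m : R, 0 < d < m0 -> `|m| < m0 ->
     polyN P (s + (d *: iota + m *: tau)) /\ steep sigma s (d *: iota + m *: tau)].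
Proof.
move=> Ns ns nT.
have [i [t [rho [[iP t01 sE rho0] [dd es bdy int]]]]] := edge_strip cP Ns ns
  (fun h => nT (or_introl h)) (fun h => nT (or_intror (or_intror h))).
set d := cvnext P i - cv P i in dd es bdy int.
have [sl Hsl] : exists sl, has_deriv1 (fun t' => L (affc (cv P i) (cvnext P i) t')) t sl.
  apply: contrapT => ne; apply: nT; right; left; by exists i, t.
case: (bL) => _ [pw _]; have [del del0 Hdel] := pw_affine_smooth (pw i iP) t01 Hsl.
have affs (a : R) : s + a *: d = affc (cv P i) (cvnext P i) (t + a).
  by rewrite sE !affcE -/d; vring.
have r00 : `|0 : R| <= rho by rewrite normr0 ltW.
have sig (a : R) : `|a| <= Num.min rho del -> sigma (s + a *: d) = sigma s + a * sl.
  rewrite le_min => /andP[ar ad].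
  have s0 : s + 0 *: d = s by rewrite scale0r addr0.
  rewrite (boundary_sigma (bdy a ar)) -[in RHS]s0 (boundary_sigma (bdy 0 r00)) !affs addr0 Hdel.
    by ring.
  by rewrite addrC addKr.
pose m0 := Num.min 1 (rho / 2).
have m00 : 0 < m0 by rewrite lt_min ltr01 divr_gt0.
exists (perp d, dotp (perp d) (cv P i)), d, (perp d), m0; split.
  by split=> //; [exact: mem_pedges|rewrite crossp_perp].
have nn : 0 < dotp (perp d) (perp d).
  have -> : dotp (perp d) (perp d) = dotp d d by rewrite /perp /dotp /=; ring.
  by rewrite lt_neqAle eq_sym dd -enorm_sqr sqr_ge0.
split=> //; first by rewrite /perp /dotp /=; ring.
move=> b m /andP[b0]; rewrite !lt_min => /andP[b1 br] /andP[m1 mr].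
have strip (a be : R) : `|a| <= rho / 2 -> 0 < be <= 1 ->
    interiorN P (s + a *: d + be *: (b *: perp d + m *: d)).
  move=> ar /andP[be0 be1].
  have -> : s + a *: d + be *: (b *: perp d + m *: d) = s + (a + be * m) *: d + (be * b) *: perp d by vring.
  apply: int.
    apply: le_trans (ler_normD _ _) _; rewrite normrM (gtr0_norm be0).
    have : be * `|m| <= 1 * `|m| by rewrite ler_wpM2r.
    lra.
  by rewrite mulr_gt0//=; have : be * b <= 1 * b; [rewrite ler_wpM2r// ltW|lra].
have bd0 (a : R) : `|a| <= rho -> polyN P (s + a *: d) by move=> /bdy[].
split.
  have := @strip 0 1; rewrite scale0r addr0 scale1r => h1; apply: interiorN_sub; apply: h1.
    by rewrite normr0 divr_ge0// ltW.
  by rewrite ltr01 lexx.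
case: (st) => _ [[M HM] _].
pose a0 := Num.min (rho / 2) del.
have a00 : 0 < a0 by rewrite lt_min del0 divr_gt0.
apply: (@MA_steep R (polyN P) (interiorN P) sigma sigma_cont (@interiorN_sub R P) sigma_MA sigma_conv
  s d (b *: perp d + m *: d) sl a0 1) => //.
- have -> : crossp d (b *: perp d + m *: d) = b * dotp d d.
    by rewrite -crossp_perp /crossp /= /GRing.scale /=; ring.
  by rewrite mulf_neq0// gt_eqF.
- move=> a be; rewrite le_min => /andP[ar _] /andP[]; rewrite le_eqVlt => /predU1P[<-|be0] be1.
    by rewrite scale0r addr0; apply: bd0; lra.
  by apply: interiorN_sub; apply: strip => //; rewrite be0.
- by move=> a be; rewrite le_min => /andP[ar _]; exact: strip.
- move=> a; rewrite le_min => /andP[ar ad]; apply: sig; rewrite le_min ad andbT; lra.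
Qed.

Lemma minimizer_flat_ae : mu2.-negligible (F `\` flat F h T).
Proof.
apply: (flat_ae minimizer_setting (supports_polyN cP) minimizer_boundary).
- by apply: corner_polyN => // q; left.
- by move=> s Ns ns; exact: germ_polyN.
- exact: edge_steepness.
Qed.

End Assembly.

(** * Passing to countably many pieces *)

Section Countable.
Variable R : realType.
Notation pt := (R * R)%type.
Local Notation mu2 := (@leb2 R).

(** For each affine function, the points near which [h] equals it form an open set, and different
    functions give disjoint sets. A flat point shares its function with a nearby rational point, so
    countably many functions suffice. *)
Lemma flat_countably_pw_affine (F T : set pt) (h : pt -> R) s0 : open F -> T s0 ->
  mu2.-negligible (F `\` flat F h T) -> countably_pw_affine F h T.
Proof.
move=> oF Ts0 neg.
pose V (sc : pt * R) : set pt := [set z | F z /\ exists2 r : R, 0 < r &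
  forall w, `|w - z| < r -> h w = dotp sc.1 w + sc.2].
have oV sc : open (V sc).
  apply/openP => z [Fz [r r0 H]]; have /openP /(_ _ Fz)[r1 r10 H1] := oF.
  exists (Num.min r1 (r / 2)); first by rewrite lt_min r10 divr_gt0.
  move=> w; rewrite lt_min => /andP[/H1 Fw wr]; split=> //; exists (r / 2); first by rewrite divr_gt0.
  by move=> x xr; apply: H; have := ler_distD w x z; lra.
have Vuniq sc sc' z : V sc z -> V sc' z -> sc = sc'.
  move=> [_ [r r0 H]] [_ [r' r'0 H']].
  have g : has_grad h z sc.1.
    by apply: (has_grad_near r0 _ (@has_grad_aff R sc.1 sc.2 z)) => w /H ->.
  have g' : has_grad h z sc'.1.
    by apply: (has_grad_near r'0 _ (@has_grad_aff R sc'.1 sc'.2 z)) => w /H' ->.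
  have e1 := has_grad_unique g g'.
  have hz := H z; have hz' := H' z; rewrite subrr normr0 in hz hz'.
  have e2 : sc.2 = sc'.2 by have := hz r0; rewrite (hz' r'0) e1; lra.
  by rewrite [sc]surjective_pairing [sc']surjective_pairing e1 e2.
pose q (k : nat) : pt := if unpickle k is Some ab then (ratr ab.1, ratr ab.2) : R * R else 0.
have qdense z (r : R) : 0 < r -> exists k, `|q k - z| < r.
  move=> r0.
  have rq (x : R) : exists a : rat, `|ratr a - x| < r.
    have xr : x - r < x + r by lra.
    have [a] := rat_in_itvoo xr.
    by rewrite in_itv /= => /andP[h1 h2]; exists a; rewrite ltr_norml; apply/andP; split; lra.
  have [a Ha] := rq z.1; have [b Hb] := rq z.2.
  by exists (pickle (a, b)); rewrite /q pickleK; apply/norm_ltP.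
(* At a rational point that is not flat the default [(s0, 0)] is taken; its slope lies in [T], so
   the resulting piece, possibly empty, is still admissible. *)
have /choice[sc Hsc] : forall k, exists sc : pt * R, T sc.1 /\ (flat F h T (q k) -> V sc (q k)).
  move=> k; have [[Fq [s Ts [r r0 H]]]|nf] := pselect (flat F h T (q k)); last by exists (s0, 0).
  exists (s, h (q k) - dotp s (q k)); split=> // _; split=> //; exists r => // w /H ->.
  by rewrite dotpBr /=; ring.
(* Many rational points give the same function; only the first index keeps its set, so that the
   pieces become disjoint. *)
pose U k : set pt := [set z | V (sc k) z /\ forall j, (j < k)%N -> sc j <> sc k].
exists U; split; [|split; [|split]].
- move=> k; split; last by move=> z [[]].
  have [H|H] := pselect (forall j, (j < k)%N -> sc j <> sc k).
    by rewrite (_ : U k = V (sc k))//; apply/seteqP; split=> z [].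
  by rewrite (_ : U k = set0) ?predeqE; [exact: open0|move=> z; split=> // -[]].
- move=> i j ij; apply/disj_setPS => z [[Vi Hi] [Vj Hj]].
  have E := Vuniq _ _ _ Vi Vj; have [lt|gt|//] := ltngtP i j.
    exact: (Hj i lt E).
  exact: (Hi j gt (esym E)).
- move=> k; exists (sc k).1, (sc k).2; split; first exact: (Hsc k).1.
  by move=> z [[_ [r r0 H]] _]; apply: H; rewrite subrr normr0.
apply: negligibleS neg => z [Fz nU]; split=> // fz; apply: nU.
have [_ [s Ts [r r0 H]]] := fz.
have /openP /(_ _ fz)[r1 r10 H1] := @flat_open R F h T oF.
have rp : 0 < Num.min r1 (r / 2) by rewrite lt_min r10 divr_gt0.
have [k] := qdense z _ rp; rewrite lt_min => /andP[/H1 fq qz].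
have Vz' : V (s, h z - dotp s z) z.
  by split=> //; exists r => // w /H ->; rewrite dotpBr /=; ring.
have Vq : V (s, h z - dotp s z) (q k).
  split; first by case: fq.
  exists (r / 2) => [|w wq]; first by rewrite divr_gt0.
  by rewrite H ?dotpBr /=; [ring|have := ler_distD (q k) w z; lra].
have Vz : V (sc k) z by rewrite (Vuniq _ _ _ ((Hsc k).2 fq) Vq).
pose p (j : nat) := `[< sc j = sc k >].
have pk : exists j, p j by exists k; apply/asboolP.
have [j /asboolP Ej Hj] := ex_minnP pk.
exists j => //; split; first by rewrite Ej.
move=> i ij E; have pi : p i by apply/asboolP; rewrite E Ej.
by have := Hj i pi; rewrite leqNgt ij.
Qed.

End Countable.

Theorem theorem1p9 (R : realType)
    (P G : seq (R * R)) (c : R * R -> R) (L sigma : R * R -> R)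
    (Om : set (R * R)) (comps : seq (seq (R * R))) (asg : nat -> nat -> nat)
    (h0 h : R * R -> R) :
  ccw_convex_polygon P ->
  uniq G -> (forall q, q \in G -> interiorN P q) ->
  (forall q, q \in G -> 0 < c q) ->
  boundary_datum P L ->
  surface_tension P G c L sigma ->
  natural_domain P Om comps asg ->
  natural_boundary_value P Om comps asg h0 ->
  is_minimizer P sigma Om h0 h ->
  countably_pw_affine (Om `\` closure (liquid P G Om h)) h
    [set a | a \in P \/ Qset P L a \/ a \in G].
Proof.
move=> cP _ _ cG bL st nd nbv hm.
apply: (@flat_countably_pw_affine _ _ _ _ (cv P 0)); last exact: (minimizer_flat_ae cP cG bL st nd nbv hm).
- case: nd => -[oOm _] _; rewrite setDE; apply: openI => //.
  by apply: closed_openC; exact: closed_closure.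
- by left; exact: vertex_mem.
Qed.
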